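(* Suppose Assumption 1 holds and $\Psi$ is directionally pathwise differentiable at $P$ relative to $\mathcal T$ with derivative $\gamma$. Let $T_n$ be asymptotically linear at $P$ with influence function $\phi\in L_2^0(P)$: $$\sqrt n\{T_n-\Psi(P)\}=n^{-1/2}\sum_{i=1}^n\phi(X_i)+o_{P^n}(1).$$ Define the agreement set $\mathcal E(\phi):=\{h\in\mathcal T:\gamma(h)=\langle\phi,h\rangle\}$. Then $$\mathcal R^{\rm cone}(T_n)=\{C\text{ convex cone}:C\subseteq\mathcal E(\phi)\},\qquad \mathcal R(T_n)=\{V\text{ linear subspace}:V\subseteq\mathcal E(\phi)\}.$$ For $V\in\mathcal R(T_n)$, the representer and convolution laws are $$\tilde\psi_V=\Pi_{\overline V}\phi,\qquad L=N(0,\|\phi\|^2),\qquad M_V=N(0,\|\phi-\Pi_{\overline V}\phi\|^2),$$ where $L$ is the limit law of $\sqrt n\{T_n-\Psi(P)\}$ under $P^n$ and $L=N(0,\|\tilde\psi_V\|^2)*M_V$; and $v(T_n)=\sup_{C\subseteq\mathcal E(\phi)}\|\Pi_{\overline{\operatorname{span}}\,C}\phi\|^2$, with the supremum over convex cones $C$. Under every local alternative (DQM path) with score $h\in\mathcal T$, $$\sqrt n\{T_n-\Psi(P_{n,h})\}\rightsquigarrow N(\langle\phi,h\rangle-\gamma(h),\|\phi\|^2)\quad\text{under }P^n_{n,h}.$$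
   Context: Model. $\mathcal P$ is a set of probability measures on a measurable space, $P\in\mathcal P$ is fixed, $X_1,\dots,X_n$ are i.i.d. observations. $L_2^0(P)$ is the mean-zero subspace of $L_2(P)$, with inner product $\langle\cdot,\cdot\rangle$ and norm $\|\cdot\|$. A DQM path with score $h\in L_2^0(P)$ is a map $t\mapsto P_t\in\mathcal P$, $t\in[0,\varepsilon)$, $P_0=P$, with $\int[(dP_t^{1/2}-dP^{1/2})/t-\tfrac12h\,dP^{1/2}]^2\to0$ as $t\downarrow0$; $P_{t,h}$ denotes such a path, $P_{n,h}:=P_{n^{-1/2},h}$, $P^n_{n,h}$ its $n$-fold product. The tangent space $\mathcal T\subseteq L_2^0(P)$ is a linear subspace. Assumption 1: $\mathcal T$ is closed in $L_2(P)$ and every $h\in\mathcal T$ is the score of some DQM path in $\mathcal P$. Directional pathwise differentiability: there is a positively homogeneous $\gamma:\mathcal T\to\mathbb R$ such that for every $h\in\mathcal T$ and every DQM path with score $h$, $t^{-1}\{\Psi(P_{t,h})-\Psi(P)\}\to\gamma(h)$ as $t\downarrow0$. $T_n$ is regular along a convex cone $C\subseteq\mathcal T$ if there is one Borel law $L$ such that for every $h\in C$ and every DQM path with score $h$, $\sqrt n\{T_n-\Psi(P_{n,h})\}\rightsquigarrow L$ under $P^n_{n,h}$. $\mathcal R(T_n)$ is the family of linear subspaces of $\mathcal T$, and $\mathcal R^{\rm cone}(T_n)$ the family of convex cones in $\mathcal T$, along which $T_n$ is regular. For a convex cone $C$ on which $\gamma$ agrees with a bounded linear functional on $\operatorname{span}C$,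 $\tilde\psi_C\in\overline{\operatorname{span}}\,C$ is the Riesz representer of its continuous extension to $\overline{\operatorname{span}}\,C$, and $V_C:=\|\tilde\psi_C\|^2$. $v(T_n):=\sup_{C\in\mathcal R^{\rm cone}(T_n)}V_C$. $\Pi$ denotes orthogonal projection in $L_2^0(P)$. *)

(* Defs.v *)
From HB Require Import structures.
From mathcomp Require Import all_boot all_order all_algebra.
From mathcomp Require Import all_classical all_reals all_analysis.

Set Implicit Arguments.
Unset Strict Implicit.
Unset Printing Implicit Defensive.

Import Order.TTheory GRing.Theory Num.Theory.
Import numFieldNormedType.Exports.

Local Open Scope classical_set_scope.
Local Open Scope ring_scope.

(** Elements of L_2(P) are represented by
    square-integrable measurable functions; the subsets of L_2(P) considered
    below (subspaces, cones) are required to be stable under P-a.e. equality,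
    so that they are exactly the subsets of the quotient space. *)

Section L2.
Context (d : measure_display) (T : measurableType d) (R : realType).
Variable P : probability T R.

Definition L2 : set (T -> R) := [set f | f \in Lfun P 2%:E].

Definition L20 : set (T -> R) := [set f | L2 f /\ ('E_P[f] = 0)%E].

Definition L2inner (f g : T -> R) : R := \int[P]_x (f x * g x).

Definition L2norm (f : T -> R) : R := Num.sqrt (L2inner f f).

Definition ae_stable (A : set (T -> R)) : Prop :=
  forall f g, A f -> L2 g -> f = g %[ae P] -> A g.

Definition linear_subspace (V : set (T -> R)) : Prop :=
  [/\ V `<=` L20, ae_stable V, V 0 &
      forall (a : R) f g, V f -> V g -> V (a *: f + g)].

(* A cone is not required to contain 0. *)
Definition convex_cone (C : set (T -> R)) : Prop :=
  [/\ C `<=` L20, ae_stable C, C !=set0,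
      (forall f g, C f -> C g -> C (f + g)) &
      (forall (a : R) f, 0 < a -> C f -> C (a *: f))].

Definition L2closure (A : set (T -> R)) : set (T -> R) :=
  [set f | L2 f /\ forall e : R, 0 < e -> exists2 g, A g & L2norm (f - g) < e].

Definition L2closed (A : set (T -> R)) : Prop := L2closure A `<=` A.

Definition L2span (A : set (T -> R)) : set (T -> R) :=
  smallest linear_subspace A.

Definition is_projection (W : set (T -> R)) (f g : T -> R) : Prop :=
  W g /\ forall h, W h -> L2inner (f - g) h = 0.

(* [L2proj W f] is a version of the (a.e. unique) projection. *)
Definition L2proj (W : set (T -> R)) (f : T -> R) : T -> R :=
  xget 0 [set g | is_projection W f g].

Definition bounded_linear_on (V : set (T -> R)) (l : (T -> R) -> R) : Prop :=
  (forall (a : R) f g, V f -> V g -> l (a *: f + g) = a * l f + l g) /\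
  (exists K : R, forall f, V f -> `|l f| <= K * L2norm f).

(* The Riesz representer of gamma on C: [l] is the bounded linear functional
   on the span of C agreeing with gamma on C, and [lbar] its continuous extension. *)
Definition is_representer (gamma : (T -> R) -> R) (C : set (T -> R))
    (psi : T -> R) : Prop :=
  exists l lbar : (T -> R) -> R,
    [/\ bounded_linear_on (L2span C) l,
        (forall h, C h -> gamma h = l h),
        bounded_linear_on (L2closure (L2span C)) lbar,
        (forall h, L2span C h -> lbar h = l h) &
        L2closure (L2span C) psi /\
        (forall h, L2closure (L2span C) h -> lbar h = L2inner psi h)].

(* [representer gamma C] is a version of the (a.e. unique) representer. *)
Definition representer (gamma : (T -> R) -> R) (C : set (T -> R)) : T -> R :=
  xget 0 [set psi | is_representer gamma C psi].

End L2.

Section dominating_measure.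
Context (d : measure_display) (T : measurableType d) (R : realType).
Variables Q P : probability T R.

Definition sum_measure : set T -> \bar R := measure_add Q P.

HB.instance Definition _ := Measure.on sum_measure.

Lemma sum_measure_fin : fin_num_fun sum_measure.
Proof.
move=> A mA; rewrite /sum_measure measure_addE.
by rewrite fin_numD !fin_num_measure.
Qed.

HB.instance Definition _ := @Measure_isFinite.Build d T R sum_measure
  sum_measure_fin.

Definition density (M : probability T R) (x : T) : R :=
  fine (Radon_Nikodym (charge_of_finite_measure M) sum_measure x).

(* \int [(dQ^{1/2} - dP^{1/2}) / t - (1/2) h dP^{1/2}]^2, computed with the
   dominating measure Q + P (its value does not depend on this choice). *)
Definition dqm_remainder (h : T -> R) (t : R) : \bar R :=
  let r (x : T) : R :=
    (Num.sqrt (density Q x) - Num.sqrt (density P x)) / t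
    - 2^-1 * h x * Num.sqrt (density P x) in
  (\int[sum_measure]_x (r x ^+ 2)%:E)%E.

End dominating_measure.

Section product.
Context (d : measure_display) (T : measurableType d) (R : realType).

Definition tcons n (x : T * n.-tuple T) : n.+1.-tuple T :=
  [the n.+1.-tuple T of x.1 :: x.2].

Lemma measurable_tcons n : measurable_fun [set: T * n.-tuple T] (@tcons n).
Proof.
by apply: measurable_cons; [exact: measurable_fst|exact: measurable_snd].
Qed.

HB.instance Definition _ n := isMeasurableFun.Build _ _ _ _ (@tcons n)
  (@measurable_tcons n).

Fixpoint prod_prob (P : probability T R) (n : nat) :
    probability (n.-tuple T) R :=
  match n with
  | 0 => dirac [tuple]
  | n.+1 => distribution (P \x prod_prob P n)%E (@tcons n)
  end.

End product.

Section laws.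
Context (R : realType).

Definition law : Type := probability (measurableTypeR R) R.

Definition eq_law (L M : law) : Prop :=
  forall A : set (measurableTypeR R), measurable A -> L A = M A.

(* N(m, v), with v the variance; N(m, 0) is the point mass at m. *)
Definition normal_law (m v : R) : law :=
  if v == 0 then (dirac (m : measurableTypeR R) : law)
  else (normal_prob m (Num.sqrt v) : law).

Definition add_pair (x : measurableTypeR R * measurableTypeR R) :
  measurableTypeR R := (x.1 : R) + x.2.

Lemma measurable_add_pair : measurable_fun setT add_pair.
Proof.
exact: (@measurable_realfun.measurable_funD _ _ R setT
  (fst : measurableTypeR R * measurableTypeR R -> R)
  (snd : measurableTypeR R * measurableTypeR R -> R)).
Qed.

HB.instance Definition _ := isMeasurableFun.Build _ _ _ _ add_pair
  measurable_add_pair.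

Definition convolution (L M : law) : law := distribution (L \x M)%E add_pair.

End laws.

Section asymptotics.
Context (d : measure_display) (T : measurableType d) (R : realType).

(* Y_n converges in law to L under the n-fold product of Q_n. *)
Definition weakly_converges (Q : nat -> probability T R)
    (Y : forall n, n.-tuple T -> R) (L : law R) : Prop :=
  forall f : R -> R, continuous f -> (exists K : R, forall x, `|f x| <= K) ->
    \int[prod_prob (Q n) n]_w f (Y n w) @[n --> \oo] --> (\int[L]_x f x : R).

Definition asymptotically_linear (P : probability T R)
    (Psi : probability T R -> R) (Tn : forall n, n.-tuple T -> R)
    (phi : T -> R) : Prop :=
  forall e : R, 0 < e ->
    prod_prob P n [set w | e <= `| Num.sqrt n%:R * (Tn n w - Psi P)
                 - (Num.sqrt n%:R)^-1 * \sum_(i < n) phi (tnth w i) |]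
      @[n --> \oo] --> 0%E.

End asymptotics.

Section model.
Context (d : measure_display) (T : measurableType d) (R : realType).
Variables (model : set (probability T R)) (P : probability T R).

(* A path is a total map R -> probability T R, constrained on [0, eps[ only. *)
Definition dqm_path (h : T -> R) (Q : R -> probability T R) : Prop :=
  [/\ L20 P h, Q 0 = P,
      (exists2 eps : R, 0 < eps & forall t, 0 <= t < eps -> model (Q t)) &
      dqm_remainder (Q t) P h t @[t --> 0^'+] --> 0%E].

(* P_{n,h}; it lies in the model once n^{-1/2} < eps. *)
Definition local_alt (Q : R -> probability T R) (n : nat) : probability T R :=
  Q (Num.sqrt n%:R)^-1.

(* Psi is a total map, but only its values on the model matter below. *)
Variables (tangent : set (T -> R)) (Psi : probability T R -> R).

Definition tangent_assumption : Prop :=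
  L2closed P tangent /\ forall h, tangent h -> exists Q, dqm_path h Q.

Definition directionally_differentiable (gamma : (T -> R) -> R) : Prop :=
  (forall (a : R) h, 0 < a -> tangent h -> gamma (a *: h) = a * gamma h) /\
  (forall h Q, tangent h -> dqm_path h Q ->
    t^-1 * (Psi (Q t) - Psi P) @[t --> 0^'+] --> gamma h).

Definition agreement_set (gamma : (T -> R) -> R) (phi : T -> R) :
    set (T -> R) :=
  [set h | tangent h /\ gamma h = L2inner P phi h].

Variable Tn : forall n, n.-tuple T -> R.

Definition centered (Q : nat -> probability T R) (n : nat) (w : n.-tuple T) :=
  Num.sqrt n%:R * (Tn w - Psi (Q n)).

Definition regular_along (C : set (T -> R)) : Prop :=
  exists L : law R, forall h Q, C h -> dqm_path h Q ->
    weakly_converges (local_alt Q) (centered (local_alt Q)) L.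

Definition regular_subspaces : set (set (T -> R)) :=
  [set V | [/\ linear_subspace P V, V `<=` tangent & regular_along V]].

Definition regular_cones : set (set (T -> R)) :=
  [set C | [/\ convex_cone P C, C `<=` tangent & regular_along C]].

Definition cone_bound (gamma : (T -> R) -> R) (C : set (T -> R)) : R :=
  L2norm P (representer P gamma C) ^+ 2.

Definition sup_bound (gamma : (T -> R) -> R) : \bar R :=
  ereal_sup [set (cone_bound gamma C)%:E | C in regular_cones].

End model.

(* Main.v *)
(* Laws on the line are handled through their phases
   [int cos (t x + a) dL]; they determine [L], and their pointwise convergence
   implies weak convergence (Gaussian smoothing).  Differentiability in quadratic
   mean expands [n int (cos (t phi / sqrt n + a) - cos a) dQ_n], hence under
   P_{n,h}^n the phases of [n^{-1/2} sum phi(X_i)] converge to those of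
   N(<phi,h>, |phi|^2); contiguity transfers the o(1) remainder of the linear
   expansion from P^n to P_{n,h}^n.  This gives the limit law
   N(<phi,h> - gamma h, |phi|^2) along every score h.  If it is the same along h
   and 2h, then by homogeneity its mean vanishes, i.e. h lies in the agreement
   set.  Where gamma agrees with <phi,.>, the representer is the projection of
   phi, and the convolution factor is found by dividing Gaussian phases. *)
Require Import Defs.
From HB Require Import structures.
From mathcomp Require Import all_boot all_order all_algebra.
From mathcomp Require Import all_classical all_reals all_analysis.
From mathcomp Require Import measurable_realfun ring lra.

Set Implicit Arguments.
Unset Strict Implicit.
Unset Printing Implicit Defensive.

Import Order.TTheory GRing.Theory Num.Theory.
Import numFieldNormedType.Exports.

Local Open Scope classical_set_scope.
Local Open Scope ring_scope.

(** The expansion is carried out directly under [Q_n], with no log-likelihood and no joint limit. If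
    [a], [b] are the root densities of [Q_n] and [P], then [a - b = t (h b / 2 + r)] with
    [t = n^{-1/2}], so [a^2 - b^2] is an exact polynomial in [b], [h b] and [r]. After
    multiplication by [n = t^-2] and by a test function of size [O(t)], only its cross term
    survives, and this term produces [<phi,h>]. Since [phi] and [h] have just two moments, the
    majorants used for dominated convergence have degree two in them. Contiguity comes from
    iterating Cauchy-Schwarz over the coordinates, at the cost of a factor [c^n], bounded because
    [c = 1 + O(1/n)]. This requires a likelihood ratio in L_2(P), hence a truncation; the mass that
    it discards is [o(1/n)] per observation. Elements of L_2 are functions, so the projection is
    obtained from a minimizing sequence modified so as to converge at every point. *)

Section Rintegral_tools.
Context (d : measure_display) (T : measurableType d) (R : realType).

Lemma Rdominated_cvg (mu : {measure set T -> \bar R}) (f_ : nat -> T -> R)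
    (f g : T -> R) :
  (forall n, measurable_fun setT (f_ n)) ->
  (forall x, f_ n x @[n --> \oo] --> f x) ->
  mu.-integrable setT (EFin \o g) ->
  (forall n x, `|f_ n x| <= g x) ->
  \int[mu]_x f_ n x @[n --> \oo] --> \int[mu]_x f x.
Proof.
move=> mf_ f_f ig fg.
have mf : measurable_fun setT f.
  by apply: (measurable_fun_cvg mf_) => x _; exact: f_f.
have [intf _ cvgf] : [/\ mu.-integrable setT (EFin \o f),
    [sequence \int[mu]_x `|(f_ n x)%:E - (f x)%:E|]_n @ \oo --> 0 &
    [sequence \int[mu]_x (f_ n x)%:E]_n @ \oo --> \int[mu]_x (f x)%:E]%E.
  apply: (@dominated_convergence _ _ _ mu setT measurableT
    (fun n => EFin \o f_ n) (EFin \o f) (EFin \o g)).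
  - by move=> n; exact/measurable_EFinP.
  - exact/measurable_EFinP.
  - by apply: aeW => x _; apply: cvg_EFin; [exact: nearW|exact: f_f].
  - exact: ig.
  - by apply: aeW => x n _ /=; rewrite lee_fin.
apply: fine_cvg; rewrite fineK//.
exact: integrable_fin_num.
Qed.

Lemma integrable_dominated (mu : {measure set T -> \bar R}) (f g : T -> R) :
  measurable_fun setT f -> mu.-integrable setT (EFin \o g) ->
  (forall x, `|f x| <= g x) -> mu.-integrable setT (EFin \o f).
Proof.
move=> mf ig fg; apply: le_integrable ig => //; first exact/measurable_EFinP.
by move=> x _ /=; rewrite lee_fin (le_trans (fg x))// ler_norm.
Qed.

Lemma integrable_bounded (mu : {finite_measure set T -> \bar R}) (f : T -> R)
    (K : R) :
  measurable_fun setT f -> (forall x, `|f x| <= K) ->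
  mu.-integrable setT (EFin \o f).
Proof.
move=> mf fK; apply: (integrable_dominated (g := cst K)) => //.
exact: finite_measure_integrable_cst.
Qed.

Lemma normr_Rintegral_le (mu : {measure set T -> \bar R}) (f g : T -> R) :
  measurable_fun setT f -> mu.-integrable setT (EFin \o g) ->
  (forall x, `|f x| <= g x) -> `|\int[mu]_x f x| <= \int[mu]_x g x.
Proof.
move=> mf ig fg; have intf := integrable_dominated mf ig fg.
apply: le_trans (le_normr_Rintegral _ intf) _ => //.
apply: le_Rintegral => //; exact: integrable_norm.
Qed.

Lemma Rintegral_prob_cst (P : probability T R) (c : R) : \int[P]_x c = c.
Proof. by rewrite Rintegral_cst//= probability_setT/= mulr1. Qed.

Lemma normr_Rintegral_le_cst (P : probability T R) (f : T -> R) (K : R) :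
  measurable_fun setT f -> (forall x, `|f x| <= K) -> `|\int[P]_x f x| <= K.
Proof.
move=> mf fK; rewrite -[leRHS](Rintegral_prob_cst P K).
by apply: normr_Rintegral_le => //; exact: finite_measure_integrable_cst.
Qed.

Lemma RintegralN (mu : {measure set T -> \bar R}) (f : T -> R) :
  mu.-integrable setT (EFin \o f) -> \int[mu]_x - f x = - \int[mu]_x f x.
Proof.
move=> intf; rewrite -mulN1r -RintegralZl//.
by apply: eq_Rintegral => x _; rewrite mulN1r.
Qed.

Lemma integrable_EFinD (mu : {measure set T -> \bar R}) (f g : T -> R) :
  mu.-integrable setT (EFin \o f) -> mu.-integrable setT (EFin \o g) ->
  mu.-integrable setT (EFin \o (fun x => f x + g x)).
Proof. by move=> fi gi; exact: (integrableD measurableT fi gi). Qed.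

Lemma integrable_EFinB (mu : {measure set T -> \bar R}) (f g : T -> R) :
  mu.-integrable setT (EFin \o f) -> mu.-integrable setT (EFin \o g) ->
  mu.-integrable setT (EFin \o (fun x => f x - g x)).
Proof. by move=> fi gi; exact: (integrableB measurableT fi gi). Qed.

Lemma integrable_EFinZl (mu : {measure set T -> \bar R}) (k : R) (f : T -> R) :
  mu.-integrable setT (EFin \o f) ->
  mu.-integrable setT (EFin \o (fun x => k * f x)).
Proof. by move=> fi; exact: (integrableZl measurableT k fi). Qed.

Lemma integrable_EFin_measurable (mu : {measure set T -> \bar R}) (f : T -> R) :
  mu.-integrable setT (EFin \o f) -> measurable_fun setT f.
Proof. by move=> /measurable_int/measurable_EFinP. Qed.

Lemma Rintegral_indic (mu : {finite_measure set T -> \bar R}) (A : set T) :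
  measurable A -> \int[mu]_x \1_A x = fine (mu A).
Proof. by move=> mA; rewrite /Rintegral integral_indic// setIT. Qed.

End Rintegral_tools.

(** * Fubini's theorem for real-valued integrals *)

Section RFubini.
Context (d1 d2 : measure_display) (T1 : measurableType d1)
  (T2 : measurableType d2) (R : realType).
Variables (m1 : {sigma_finite_measure set T1 -> \bar R})
  (m2 : {sigma_finite_measure set T2 -> \bar R}).
Variable f : T1 * T2 -> R.
Hypothesis f_int : (m1 \x m2)%E.-integrable setT (EFin \o f).
Hypothesis f_int2 : forall x, m2.-integrable setT (EFin \o (fun y => f (x, y))).

(** Integrability of every section, rather than of almost every one, lets [fine] and [EFin] cancel
    pointwise. *)
Lemma RFubini1 :
  \int[(m1 \x m2)%E]_z f z = \int[m1]_x \int[m2]_y f (x, y).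
Proof.
rewrite /Rintegral -(integral12_prod_meas1 f_int); congr fine.
apply: eq_integral => x _; rewrite fineK//.
exact: integrable_fin_num (f_int2 x).
Qed.

Hypothesis f_int1 : forall y, m1.-integrable setT (EFin \o (fun x => f (x, y))).

Lemma RFubini2 :
  \int[(m1 \x m2)%E]_z f z = \int[m2]_y \int[m1]_x f (x, y).
Proof.
rewrite /Rintegral -(integral21_prod_meas1 f_int); congr fine.
apply: eq_integral => y _; rewrite fineK//.
exact: integrable_fin_num (f_int1 y).
Qed.

Lemma RFubini :
  \int[m1]_x \int[m2]_y f (x, y) = \int[m2]_y \int[m1]_x f (x, y).
Proof. by rewrite -RFubini1 RFubini2. Qed.

Lemma measurable_Rintegral1 :
  measurable_fun setT (fun x => \int[m2]_y f (x, y)).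
Proof.
apply/measurable_EFinP; have := measurable_fubini_F f_int.
apply: eq_measurable_fun => x _; rewrite /fubini_F /Rintegral /= fineK//.
exact: integrable_fin_num (f_int2 x).
Qed.

End RFubini.

Section prob_Fubini.
Context (d1 d2 : measure_display) (T1 : measurableType d1)
  (T2 : measurableType d2) (R : realType).
Variables (P1 : probability T1 R) (P2 : probability T2 R) (f : T1 * T2 -> R)
  (K : R).
Hypotheses (mf : measurable_fun setT f) (fK : forall z, `|f z| <= K).

Let f_int : (P1 \x P2)%E.-integrable setT (EFin \o f).
Proof. exact: (@integrable_bounded _ _ _ ((P1 \x P2)%E : probability _ R) f K mf fK). Qed.

Let f_int2 x : P2.-integrable setT (EFin \o (fun y => f (x, y))).
Proof.
apply: (integrable_bounded _ (K := K)) => // .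
by apply: (measurableT_comp mf); exact: pair1_measurable.
Qed.

Let f_int1 y : P1.-integrable setT (EFin \o (fun x => f (x, y))).
Proof.
apply: (integrable_bounded _ (K := K)) => //.
by apply: (measurableT_comp mf); exact: pair2_measurable.
Qed.

Lemma prob_Fubini1 :
  \int[(P1 \x P2)%E]_z f z = \int[P1]_x \int[P2]_y f (x, y).
Proof. exact: RFubini1. Qed.

Lemma prob_Fubini2 :
  \int[(P1 \x P2)%E]_z f z = \int[P2]_y \int[P1]_x f (x, y).
Proof. exact: RFubini2. Qed.

Lemma measurable_Rintegral_prob :
  measurable_fun setT (fun x => \int[P2]_y f (x, y)).
Proof. exact: measurable_Rintegral1 f_int f_int2. Qed.

End prob_Fubini.

(** * Gaussian phases *)

Section normal_density.
Context {R : realType}.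
Local Notation mu := (@lebesgue_measure R).
Implicit Types m s x t a : R.

Lemma is_derive_normal_pdf m s x : s != 0 ->
  is_derive x 1 (normal_pdf m s) (- ((x - m) / s ^+ 2) * normal_pdf m s x).
Proof.
move=> s0; rewrite normal_pdfE// /normal_fun.
have s2 : s ^+ 2 != 0 by rewrite sqrf_eq0.
apply: trigger_derive.
rewrite /GRing.scale /=; field.
exact: s0.
Qed.

Lemma continuous_is_derive (f df : R -> R) :
  (forall x, is_derive x 1 f (df x)) -> continuous f.
Proof.
by move=> fdf x; apply/differentiable_continuous/derivable1_diffP; case: (fdf x).
Qed.

(** The fundamental theorem of calculus on growing symmetric intervals, followed by dominated
    convergence. It replaces integration by parts over the whole line. *)
Lemma Rintegral_derive_eq0 (f df : R -> R) :
  (forall x, is_derive x 1 f (df x)) -> continuous df ->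
  mu.-integrable setT (EFin \o df) ->
  f (- n%:R) @[n --> \oo] --> 0 -> f n%:R @[n --> \oo] --> 0 ->
  \int[mu]_x df x = 0.
Proof.
move=> fdf cdf idf fN fP.
have cf := continuous_is_derive fdf.
(* [n.+1] keeps the interval nondegenerate at [n = 0], as [continuous_FTC2] demands. *)
pose D (n : nat) : set R := `[- n.+1%:R, n.+1%:R]%classic.
have mD n : measurable (D n) by exact: measurable_itv.
have FTC n : \int[mu]_x (df \_ (D n)) x = f n.+1%:R - f (- n.+1%:R).
  rewrite -Rintegral_mkcond /Rintegral (@continuous_FTC2 _ df f) //.
  - by rewrite (@lt_trans _ _ 0)// oppr_lt0.
  - exact: continuous_subspaceT.
  - split.
    + by move=> x _; case: (fdf x).
    + exact/cvg_at_right_filter/cf.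
    + exact/cvg_at_left_filter/cf.
  - by move=> x _; rewrite derive1E; case: (fdf x).
have cvg1 : \int[mu]_x (df \_ (D n)) x @[n --> \oo] --> \int[mu]_x df x.
  apply: (@Rdominated_cvg _ _ _ mu (fun n => df \_ (D n)) df (fun x => `|df x|)).
  - move=> n; apply/(measurable_restrictT _ (mD n))/measurable_funTS.
    exact: integrable_EFin_measurable idf.
  - move=> x; apply: cvg_near_cst; near=> n; rewrite patchE mem_set//.
    rewrite /D/= in_itv/= -ler_norml.
    apply: (@le_trans _ _ n%:R); last by rewrite ler_nat.
    by near: n; apply: nbhs_infty_ger.
  - exact: integrable_norm.
  - by move=> n x; rewrite patchE; case: ifP => //= _; rewrite normr0.
have cvg2 : \int[mu]_x (df \_ (D n)) x @[n --> \oo] --> (0 : R).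
  rewrite (_ : (fun n => _) = (fun n => f n.+1%:R - f (- n.+1%:R))).
    rewrite -[0]subr0; apply: cvgB.
    - by rewrite (cvg_shiftS (fun n => f n%:R)).
    - by rewrite (cvg_shiftS (fun n => f (- n%:R))).
  by apply/funext => n; rewrite FTC.
exact: cvg_unique cvg1 cvg2.
Unshelve. all: end_near. Qed.

(** Half of the Gaussian exponent absorbs the factor [|x - m|]; the other half is a Gaussian of
    doubled variance. This one pointwise bound yields the first moment, its integrability and the
    decay at infinity. *)
Lemma normal_pdf_moment_bound m s x : 0 < s ->
  `|x - m| * normal_pdf m s x
  <= Num.sqrt 2 * s * normal_pdf m (Num.sqrt 2 * s) x.
Proof.
move=> s0; have r2 : 0 < Num.sqrt 2 :> R by rewrite sqrtr_gt0.
have t0 : Num.sqrt 2 * s != 0 by rewrite mulf_neq0 ?gt_eqF.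
rewrite !normal_pdfE ?gt_eqF ?mulr_gt0// /normal_peak /normal_fun.
rewrite exprMn sqr_sqrtr//.
rewrite (_ : 2 * s ^+ 2 * pi *+ 2 = 2 * (s ^+ 2 * pi *+ 2)); last by ring.
rewrite (sqrtrM (s ^+ 2 * pi *+ 2)) ?ler0n//.
set q := Num.sqrt 2 in r2 *; set p := Num.sqrt _.
have p0 : 0 < p.
  by rewrite sqrtr_gt0 mulrn_wgt0// mulr_gt0 ?pi_gt0// exprn_gt0.
rewrite (_ : q * s * _ = p^-1 * (s * expR (- (x - m) ^+ 2 / (2 * s ^+ 2 *+ 2)))).
  rewrite mulrCA ler_pM2l ?invr_gt0//.
  (* The exponent of the density is [- 2 y]. One [y] pays for [|x - m|], because
     [s (1 + y) - |x - m|] is [s] times a square and [1 + y <= expR y]. *)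
  set y := (x - m) ^+ 2 / (s ^+ 2 * 4).
  have -> : - (x - m) ^+ 2 / (2 * s ^+ 2 *+ 2) = - y.
    by rewrite /y; field; rewrite gt_eqF.
  have -> : - (x - m) ^+ 2 / (s ^+ 2 *+ 2) = - y + - y.
    by rewrite /y; field; rewrite gt_eqF.
  have xy : `|x - m| <= s * expR y.
    apply: (@le_trans _ _ (s * (1 + y))); last first.
      by rewrite ler_pM2l// expR_ge1Dx.
    rewrite -subr_ge0.
    have -> : s * (1 + y) - `|x - m| = s * (1 - `|x - m| / (2 * s)) ^+ 2.
      by rewrite /y -(real_normK (num_real (x - m))); field; rewrite gt_eqF.
    by rewrite mulr_ge0 ?sqr_ge0// ltW.
  rewrite expRD mulrA ler_wpM2r ?expR_ge0//.
  by rewrite expRN ler_pdivrMr ?expR_gt0.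
by field; rewrite !gt_eqF.
Qed.

Lemma measurable_cosD (t a : R) : measurable_fun setT (fun x : R => cos (t * x + a)).
Proof.
apply: continuous_measurable_fun => x; apply: continuous_comp.
  by apply: continuousD; [exact: mulrl_continuous|exact: cst_continuous].
exact: continuous_cos.
Qed.

Lemma integrable_normal_moment m s : 0 < s ->
  mu.-integrable setT (EFin \o (fun x => `|x - m| * normal_pdf m s x)).
Proof.
move=> s0; apply: (@integrable_dominated _ _ _ mu _ ( fun x =>
    Num.sqrt 2 * s * normal_pdf m (Num.sqrt 2 * s) x)).
- apply: measurable_funM; last exact: measurable_normal_pdf.
  apply: measurableT_comp => //; exact: measurable_funB.
- by apply: integrable_EFinZl; exact: integrable_normal_pdf.
- move=> x; rewrite ger0_norm; last by rewrite mulr_ge0// normal_pdf_ge0.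
  exact: normal_pdf_moment_bound.
Qed.

Lemma Rintegral_normal_pdf m s : \int[mu]_x normal_pdf m s x = 1.
Proof. by rewrite /Rintegral integral_normal_pdf. Qed.

Lemma normal_moment_le m s : 0 < s ->
  \int[mu]_x (`|x - m| * normal_pdf m s x) <= Num.sqrt 2 * s.
Proof.
move=> s0; apply: (@le_trans _ _
    (\int[mu]_x (Num.sqrt 2 * s * normal_pdf m (Num.sqrt 2 * s) x))).
  apply: le_Rintegral => //; first exact: integrable_normal_moment.
    by apply: integrable_EFinZl; exact: integrable_normal_pdf.
  by move=> x _; exact: normal_pdf_moment_bound.
rewrite RintegralZl//; last exact: integrable_normal_pdf.
by rewrite Rintegral_normal_pdf mulr1.
Qed.

Lemma integrable_bounded_pdf m s (f : R -> R) (K : R) :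
  measurable_fun setT f -> (forall x, `|f x| <= K) ->
  mu.-integrable setT (EFin \o (fun x => f x * normal_pdf m s x)).
Proof.
move=> mf fK; apply: (@integrable_dominated _ _ _ mu _ ( fun x => K * normal_pdf m s x)).
- by apply: measurable_funM => //; exact: measurable_normal_pdf.
- by apply: integrable_EFinZl; exact: integrable_normal_pdf.
- by move=> x; rewrite normrM (ger0_norm (normal_pdf_ge0 _ _ _)) ler_wpM2r// normal_pdf_ge0.
Qed.

(** The moment bound, divided by [|u n - m|], with the wider density bounded by its peak. *)
Lemma cvg_normal_pdf_infty m s (u : nat -> R) : 0 < s ->
  `|u n - m| @[n --> \oo] --> +oo -> normal_pdf m s (u n) @[n --> \oo] --> (0 : R).
Proof.
move=> s0 uy; have C0 : 0 < Num.sqrt 2 * s by rewrite mulr_gt0// sqrtr_gt0.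
set C := Num.sqrt 2 * s * normal_peak (Num.sqrt 2 * s).
apply: (squeeze_cvgr (f := cst 0) (h := fun n => C * `|u n - m|^-1)).
- near=> n; rewrite normal_pdf_ge0/=.
  have un : 0 < `|u n - m| by near: n; exact: cvgry_gt.
  rewrite ler_pdivlMr// mulrC; apply: le_trans (normal_pdf_moment_bound _ _ s0) _.
  by rewrite ler_wpM2l ?(ltW C0)// normal_pdf_ub ?gt_eqF.
- exact: cvg_cst.
- rewrite -[0](mulr0 C); apply: cvgM; first exact: cvg_cst.
  by apply/gtr0_cvgV0 => //; near=> n; near: n; exact: cvgry_gt.
Unshelve. all: end_near. Qed.

Section normal_phase.
Variables (m s a : R).
Hypothesis s0 : 0 < s.

Let w t := \int[mu]_x (cos (t * (x - m) + a) * normal_pdf m s x).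

Let cosE t x : t * (x - m) + a = t * x + (a - t * m).
Proof. by ring. Qed.

Let mcos t : measurable_fun setT (fun x : R => cos (t * (x - m) + a)).
Proof. by under eq_fun do rewrite cosE; exact: measurable_cosD. Qed.

Let icos t : mu.-integrable setT
  (EFin \o (fun x => cos (t * (x - m) + a) * normal_pdf m s x)).
Proof.
apply: (@integrable_bounded_pdf _ _ _ 1) => [|x]; [exact: mcos|exact: cos_max].
Qed.

Let df (t x : R) : R := - sin (t * (x - m) + a) * (x - m) * normal_pdf m s x.

Let dfP t x : is_derive t 1 (fun t => cos (t * (x - m) + a) * normal_pdf m s x)
  (df t x).
Proof.
apply: trigger_derive; rewrite /GRing.scale /= /df; ring.
Qed.

Let wP t : is_derive t 1 w (\int[mu]_x df t x).
Proof.
have I : `]t - 1, t + 1[%classic t by rewrite /= in_itv/= ltrBlDr ltrDl ltr01.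
have E y x : partial1of2 (fun t x => cos (t * (x - m) + a) * normal_pdf m s x) y x
    = df y x.
  by rewrite partial1of2E; have [_ ->] := dfP y x.
have G y x : `|df y x| <= `|x - m| * normal_pdf m s x.
  rewrite !normrM normrN (ger0_norm (normal_pdf_ge0 _ _ _)) -mulrA ler_piMl//.
    by rewrite mulr_ge0// normal_pdf_ge0.
  exact: sin_max.
apply: DeriveDef.
  apply: (@derivable_under_integral _ _ _ mu _ setT measurableT t (t - 1) (t + 1)
    I _ _ (fun x => `|x - m| * normal_pdf m s x)).
  - by move=> x _; exact: icos.
  - by move=> y x _ _; case: (dfP y x).
  - by move=> x; rewrite mulr_ge0// normal_pdf_ge0.
  - exact: integrable_normal_moment.
  - by move=> y x _ _; rewrite E.
rewrite -derive1E (@differentiation_under_integral _ _ _ mu _ setT measurableT t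
  (t - 1) (t + 1) I _ _ (fun x => `|x - m| * normal_pdf m s x)).
- by apply: eq_Rintegral => x _; rewrite E.
- by move=> x _; exact: icos.
- by move=> y x _ _; case: (dfP y x).
- by move=> x; rewrite mulr_ge0// normal_pdf_ge0.
- exact: integrable_normal_moment.
- by move=> y x _ _; rewrite E.
Qed.

Let idf t : mu.-integrable setT (EFin \o df t).
Proof.
apply: (@integrable_dominated _ _ _ mu _ _ _ (integrable_normal_moment m s0)).
  apply: measurable_funM; last exact: measurable_normal_pdf.
  apply: measurable_funM; last exact: measurable_funB.
  apply: measurableT_comp => //; apply: continuous_measurable_fun => x.
  apply: continuous_comp; last exact: continuous_sin.
  apply: continuousD; last exact: cst_continuous.
  apply: continuousM; first exact: cst_continuous.
  by apply: continuousB; [exact: cvg_id|exact: cst_continuous].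
move=> x; rewrite !normrM normrN (ger0_norm (normal_pdf_ge0 _ _ _)) -mulrA ler_piMl//.
  by rewrite mulr_ge0// normal_pdf_ge0.
exact: sin_max.
Qed.

(* Integration by parts: [sin (t (x - m) + a) pdf x] vanishes at infinity. *)
Let wE t : \int[mu]_x df t x = - (s ^+ 2 * t) * w t.
Proof.
pose F (x : R) : R := sin (t * (x - m) + a) * normal_pdf m s x.
pose dF (x : R) : R := t * (cos (t * (x - m) + a) * normal_pdf m s x) + s ^- 2 * df t x.
have FdF x : is_derive x 1 F (dF x).
  have := is_derive_normal_pdf m x (lt0r_neq0 s0) => pP.
  by apply: trigger_derive; rewrite /GRing.scale /= /dF /df; field; rewrite gt_eqF.
have F0 (u : nat -> R) : `|u n - m| @[n --> \oo] --> +oo ->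
    F (u n) @[n --> \oo] --> (0 : R).
  move=> uy; apply: norm_cvg0; apply: (squeeze_cvgr _ (cvg_cst 0)
    (cvg_normal_pdf_infty s0 uy)).
  apply: nearW => n /=; rewrite normr_ge0 normrM (ger0_norm (normal_pdf_ge0 _ _ _)).
  by rewrite ler_piMl ?normal_pdf_ge0// sin_max.
have : \int[mu]_x dF x = 0.
  apply: (Rintegral_derive_eq0 FdF).
  - have cc x : t * (y - m) + a @[y --> x] --> t * (x - m) + a.
      apply: cvgD; last exact: cvg_cst.
      apply: cvgM; first exact: cvg_cst.
      by apply: cvgB; [exact: cvg_id|exact: cvg_cst].
    have cp := @continuous_normal_pdf _ m s (lt0r_neq0 s0).
    rewrite /dF /df => x.
    apply: cvgD.
      apply: cvgM; first exact: cvg_cst.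
      apply: cvgM; last exact: cp.
      by apply: (cvg_comp _ _ (cc x)); exact: continuous_cos.
    apply: cvgM; first exact: cvg_cst.
    apply: cvgM; last exact: cp.
    apply: cvgM; last by apply: cvgB; [exact: cvg_id|exact: cvg_cst].
    apply: cvgN.
    by apply: (cvg_comp _ _ (cc x)); exact: continuous_sin.
  - by apply: integrable_EFinD; apply: integrable_EFinZl; [exact: icos|exact: idf].
  - apply: F0; apply/cvgryPge => A; near=> n; rewrite distrC opprK.
    rewrite (le_trans _ (ler_norm _))// -lerBlDl.
    by near: n; exact: nbhs_infty_ger.
  - apply: F0; apply/cvgryPge => A; near=> n.
    rewrite (le_trans _ (ler_norm _))// lerBrDr.
    by near: n; exact: nbhs_infty_ger.
rewrite RintegralD//; [|exact/integrable_EFinZl/icos|exact/integrable_EFinZl/idf].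
rewrite (RintegralZl _ measurableT (icos t)) (RintegralZl _ measurableT (idf t)).
rewrite -/(w t) => /eqP; rewrite addr_eq0 => /eqP H.
apply: (@mulfI _ (s ^- 2)); first by rewrite invr_neq0// sqrf_eq0 gt_eqF.
by apply: oppr_inj; rewrite -H; field; rewrite gt_eqF.
Unshelve. all: end_near. Qed.

(** By [wP] and [wE], [w' = - s^2 t w], so [w t] times [expR (s^2 t^2 / 2)] is constant; its value
    at [t = 0] is [cos a]. *)
Lemma normal_phase_centered t :
  \int[mu]_x (cos (t * (x - m) + a) * normal_pdf m s x)
  = expR (- (s ^+ 2 * t ^+ 2 / 2)) * cos a.
Proof.
have wc : w t * expR (s ^+ 2 * t ^+ 2 / 2) = w 0.
  transitivity (w 0 * expR (s ^+ 2 * 0 ^+ 2 / 2)); last first.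
    by rewrite expr0n/= mulr0 mul0r expR0 mulr1.
  apply: (@is_derive_0_is_cst _ (fun t => w t * expR (s ^+ 2 * t ^+ 2 / 2))).
  move=> {}t; have := wP t; rewrite wE => wP'.
  by apply: trigger_derive; rewrite /GRing.scale/=; field.
have w0 : w 0 = cos a.
  rewrite /w; under eq_Rintegral do rewrite mul0r add0r.
  rewrite RintegralZl//; last exact: integrable_normal_pdf.
  by rewrite Rintegral_normal_pdf mulr1.
by rewrite -/(w t) expRN -w0 -wc mulrCA mulVf ?mulr1// lt0r_neq0// expR_gt0.
Qed.

End normal_phase.
End normal_density.

(** * Phases and weak convergence *)

Section clamp.
Context {R : realType}.

(** The ramps [clamp (c * (x - y))] serve both as continuous approximations of half-line indicators
    and, with [|y|] in place of [y], as compactly supported cutoffs. *)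
Definition clamp (u : R) : R := Num.min 1 (Num.max 0 u).

Lemma clamp_ge0 u : 0 <= clamp u.
Proof. by rewrite le_min ler01 le_max lexx. Qed.

Lemma clamp_le1 u : clamp u <= 1.
Proof. by rewrite ge_min lexx. Qed.

Lemma normr_clamp u : `|clamp u| <= 1.
Proof. by rewrite ger0_norm ?clamp_ge0// clamp_le1. Qed.

Lemma clamp_eq1 u : 1 <= u -> clamp u = 1.
Proof.
move=> u1; rewrite /clamp; apply/min_idPl.
by rewrite le_max u1 orbT.
Qed.

Lemma clamp_eq0 u : u <= 0 -> clamp u = 0.
Proof.
by move=> u0; rewrite /clamp (max_idPl u0); apply/min_idPr.
Qed.

Lemma continuous_clamp : continuous clamp.
Proof.
move=> u; apply: (@continuous_min R R^o (fun=> 1) (fun u => Num.max 0 u)).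
  exact: cst_continuous.
by apply: (@continuous_max R R^o (fun=> 0) id); [exact: cst_continuous|exact: cvg_id].
Qed.

Lemma continuous_clamp_affine (c x : R) : continuous (fun y => clamp (c * (x - y))).
Proof.
move=> y; apply: (@continuous_comp _ _ _ (fun y => c * (x - y)) clamp).
  apply: continuousM; first exact: cst_continuous.
  by apply: continuousB; [exact: cst_continuous|exact: cvg_id].
exact: continuous_clamp.
Qed.

End clamp.

Section eq_law.
Context {R : realType}.

Lemma Rintegral_eq_law (L M : law R) (f : R -> R) : eq_law L M ->
  \int[L]_x f x = \int[M]_x f x.
Proof.
by move=> LM; congr fine; apply: eq_measure_integral => A mA _; exact: LM.
Qed.

(** Open half-lines form a pi-system generating the Borel sets, and their indicators are the
    pointwise limits of the ramps [clamp (n * (x - y))]. *)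
Lemma eq_law_Rintegral (L M : law R) :
  (forall f : R -> R, continuous f -> (exists K, forall x, `|f x| <= K) ->
    \int[L]_x f x = \int[M]_x f x) -> eq_law L M.
Proof.
move=> LM A mA.
apply: (@measure_unique _ R (measurableTypeR R) (@RGenInftyO.G R) (fun n => `]-oo, n%:R[%classic)) => //.
- exact: RGenInftyO.measurableE.
- move=> _ _ [x ->] [y ->]; exists (Num.min x y).
  by apply/seteqP; split => z /=; rewrite !in_itv/= lt_min; [case=> -> ->|move=> /andP].
- by move=> n; exists n%:R.
- apply/seteqP; split => // x _; have [n xn] : exists n : nat, x < n%:R.
    by exists (Num.truncn `|x|).+1; rewrite (le_lt_trans (ler_norm x))// truncnS_gt.
  by exists n => //=; rewrite in_itv/=.
- move=> _ [x ->].
  have cvgI (N : law R) :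
      \int[N]_y clamp (n%:R * (x - y)) @[n --> \oo] --> fine (N `]-oo, x[%classic).
    rewrite -Rintegral_indic//.
    apply: (@Rdominated_cvg _ _ _ _ _ _ (cst 1)).
    + by move=> n; apply: continuous_measurable_fun; exact: continuous_clamp_affine.
    + move=> y; apply: cvg_near_cst; rewrite indicE.
      have [yx|xy] := ltP y x.
        rewrite mem_set/= ?in_itv//=.
        near=> n; rewrite clamp_eq1// -ler_pdivrMr ?subr_gt0//.
        by near: n; exact: nbhs_infty_ger.
      rewrite memNset/= ?in_itv/= ?ltNge ?xy//.
      by apply: nearW => n; rewrite clamp_eq0// mulr_ge0_le0// subr_le0.
    + exact: finite_measure_integrable_cst.
    + by move=> n y; exact: normr_clamp.
  suff : fine (L `]-oo, x[%classic) = fine (M `]-oo, x[%classic).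
    by move=> h; rewrite -[LHS]fineK ?fin_num_measure// h fineK// fin_num_measure.
  have E n : \int[L]_y clamp (n%:R * (x - y)) = \int[M]_y clamp (n%:R * (x - y)).
    apply: LM; first exact: continuous_clamp_affine.
    by exists 1 => y; exact: normr_clamp.
  have cM : \int[L]_y clamp (n%:R * (x - y)) @[n --> \oo]
      --> fine (M `]-oo, x[%classic).
    by under eq_fun do rewrite E; exact: cvgI.
  exact: cvg_unique (cvgI L) cM.
- by move=> k; rewrite (le_lt_trans (probability_le1 _ _))// ltry.
Unshelve. all: end_near. Qed.

End eq_law.

Section phase.
Context {R : realType}.
Local Notation mu := (@lebesgue_measure R).

(** The real part of [exp (i a)] times the characteristic function at [t]: [a = 0] and
    [a = - pi / 2] recover its real and imaginary parts. *)
Definition phase (L : law R) (t a : R) : R := \int[L]_x cos (t * x + a).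

Lemma phase_eq_law (L M : law R) t a : eq_law L M -> phase L t a = phase M t a.
Proof. exact: Rintegral_eq_law. Qed.

Lemma Rintegral_normal_prob m s (f : R -> R) (K : R) :
  measurable_fun setT f -> (forall x, `|f x| <= K) ->
  \int[normal_prob m s]_x f x = \int[mu]_x (f x * normal_pdf m s x).
Proof.
move=> mf fK; congr fine.
have dom := normal_prob_dominates m s.
have intf : (normal_prob m s).-integrable setT (EFin \o f).
  exact: (@integrable_bounded _ _ _ (normal_prob m s) f K mf fK).
rewrite -(Radon_Nikodym_change_of_variables dom)//.
under [RHS]eq_integral do rewrite EFinM.
apply: ae_eq_integral => //.
- apply: emeasurable_funM; first exact/measurable_EFinP.
  by apply: (measurable_int mu); exact: Radon_Nikodym_integrable.
- apply: emeasurable_funM; first exact/measurable_EFinP.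
  by apply/measurable_EFinP; exact: measurable_normal_pdf.
- apply: ae_eqe_mul2l.
  apply: integral_ae_eq => //.
  + exact: Radon_Nikodym_integrable.
  + by apply/measurable_EFinP; exact: measurable_normal_pdf.
  + by move=> E _ mE; rewrite -Radon_Nikodym_integral.
Qed.

Lemma phase_normal m v t a : 0 <= v ->
  phase (normal_law m v) t a = expR (- (v * t ^+ 2 / 2)) * cos (t * m + a).
Proof.
rewrite le_eqVlt /normal_law => /predU1P[<-|v0].
  rewrite eqxx mul0r mul0r oppr0 expR0 mul1r /phase /Rintegral integral_dirac//.
    by rewrite diracT mul1e.
  by apply/measurable_EFinP; exact: measurable_cosD.
rewrite gt_eqF// /phase (Rintegral_normal_prob _ _ (measurable_cosD t a) (K := 1)); last first.
  by move=> x; exact: cos_max.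
have s0 : 0 < Num.sqrt v by rewrite sqrtr_gt0.
rewrite -[in RHS](sqr_sqrtr (ltW v0)) -(normal_phase_centered m (t * m + a) s0).
apply: eq_Rintegral => x _; congr (cos _ * _); ring.
Qed.

(** With the normal variable integrated first, the other variable [y] only moves the phase from [a]
    to [t * y + a]. *)
Lemma phase_convolution_normal (v : R) (M : law R) t a : 0 <= v ->
  phase (convolution (normal_law 0 v) M) t a = expR (- (v * t ^+ 2 / 2)) * phase M t a.
Proof.
move=> v0; rewrite {1}/phase.
pose g (z : measurableTypeR R * measurableTypeR R) : R := cos (t * ((z.1 : R) + z.2) + a).
have mg : measurable_fun setT g.
  exact: (measurableT_comp (measurable_cosD t a) (@measurable_add_pair R)).
have g1 z : `|g z| <= 1 by exact: cos_max.
have gE y : (fun x => g (x, y)) = (fun x => cos (t * x + (t * y + a))).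
  by apply/funext => x; rewrite /g/= mulrDr addrA.
have -> : \int[convolution (normal_law 0 v) M]_x cos (t * x + a) =
   \int[(normal_law 0 v \x M)%E]_z g z.
  congr fine; rewrite integral_distribution//.
    by apply/measurable_EFinP; exact: measurable_cosD.
  exact: (@integrable_bounded _ _ _ ((normal_law 0 v \x M)%E : probability _ R) g 1 mg g1).
rewrite (prob_Fubini2 _ _ mg g1).
rewrite -RintegralZl//; last first.
  apply: (@integrable_bounded _ _ _ M _ 1 (measurable_cosD t a)) => z; exact: cos_max.
apply: eq_Rintegral => y _; rewrite gE.
by rewrite -/(phase _ _ _) phase_normal// mulr0 add0r.
Qed.

End phase.

(** * Continuity theorem for phases, by Gaussian smoothing *)

Section levy.
Context {R : realType}.
Local Notation mu := (@lebesgue_measure R).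

Lemma normal_pdf_shift (x y e : R) : normal_pdf x e y = normal_pdf 0 e (y - x) \/ e = 0.
Proof.
have [->|e0] := eqVneq e 0; [by right|left].
by rewrite !normal_pdfE// /normal_fun subr0.
Qed.

Lemma measurable_normal_pdf2 (e : R) : e != 0 ->
  measurable_fun setT
    (fun z : measurableTypeR R * measurableTypeR R => normal_pdf z.1 e z.2 : R).
Proof.
move=> e0; under eq_fun => z.
  have [->|/eqP] := normal_pdf_shift z.1 z.2 e; last by rewrite (negPf e0).
  over.
apply: (measurableT_comp (measurable_normal_pdf 0 e)).
apply: (@measurable_funB _ _ R setT
  (snd : measurableTypeR R * measurableTypeR R -> R)
  (fst : measurableTypeR R * measurableTypeR R -> R)) => //.
Qed.

(** The Gaussian is its own Fourier transform: a kernel of width [e] is a mixture of cosines whose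
    frequencies follow the centered normal law of standard deviation [1 / e]. *)
Lemma normal_pdf_phase (x y e : R) : 0 < e ->
  normal_pdf x e y =
  normal_peak e * \int[normal_prob 0 e^-1]_s cos (s * x - s * y).
Proof.
move=> e0; rewrite normal_pdfE ?gt_eqF//; congr (_ * _).
have s0 : 0 < e^-1 by rewrite invr_gt0.
under eq_Rintegral do rewrite -mulrBr mulrC -[_ * _]addr0.
rewrite (Rintegral_normal_prob _ _ (measurable_cosD (x - y) 0) (K := 1)); last first.
  by move=> s; exact: cos_max.
have := normal_phase_centered 0 0 s0 (x - y).
under eq_Rintegral do rewrite subr0.
move=> ->; rewrite cos0 mulr1 /normal_fun; congr expR; field.
by rewrite gt_eqF.
Qed.

(* Gaussian smoothing makes the mean of [f] a functional of the phases. *)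
Definition smooth (e : R) (f : R -> R) (x : R) : R :=
  \int[mu]_y (f y * normal_pdf x e y).

(** Within [del] of [x] the oscillation of [f] is at most [eta]; farther away it is at most
    [2 K <= 2 K |y - x| / del], which the first absolute moment of the kernel controls. *)
Lemma smooth_near (e del eta K : R) (f : R -> R) (x : R) : 0 < e -> 0 < del ->
  measurable_fun setT f -> (forall y, `|f y| <= K) ->
  (forall y, `|x - y| < del -> `|f x - f y| <= eta) -> 
  `|smooth e f x - f x| <= eta + 2 * K / del * (Num.sqrt 2 * e).
Proof.
move=> e0 del0 mf fK fxy.
have K0 : 0 <= K by exact: le_trans (fK x).
have eta0 : 0 <= eta.
  by have := fxy x; rewrite !subrr normr0; apply.
have if1 : mu.-integrable setT (EFin \o (fun y => f y * normal_pdf x e y)).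
  exact: integrable_bounded_pdf mf fK.
have ip c : mu.-integrable setT (EFin \o (fun y => c * normal_pdf x e y)).
  by apply: integrable_EFinZl; exact: integrable_normal_pdf.
have im c : mu.-integrable setT (EFin \o (fun y => c * (`|y - x| * normal_pdf x e y))).
  by apply: integrable_EFinZl; exact: integrable_normal_moment.
have -> : smooth e f x - f x = \int[mu]_y (f y * normal_pdf x e y - f x * normal_pdf x e y).
  rewrite RintegralB// RintegralZl//; last exact: integrable_normal_pdf.
  by rewrite Rintegral_normal_pdf mulr1.
apply: (@le_trans _ _ (\int[mu]_y (eta * normal_pdf x e y +
   2 * K / del * (`|y - x| * normal_pdf x e y)))).
  apply: (@normr_Rintegral_le _ _ _ mu).
  - apply: measurable_funB; apply: measurable_funM => //; exact: measurable_normal_pdf.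
  - exact: integrable_EFinD.
  - move=> y; rewrite -mulrBl normrM (ger0_norm (normal_pdf_ge0 _ _ _)) mulrA -mulrDl.
    rewrite ler_wpM2r ?normal_pdf_ge0//.
    have [yx|yx] := ltP `|x - y| del.
      by rewrite distrC (le_trans (fxy _ yx))// lerDl mulr_ge0// divr_ge0 ?mulr_ge0// ltW.
    rewrite (@le_trans _ _ (2 * K))//.
      by rewrite (le_trans (ler_normB _ _))// mulr2n mulrDl mul1r lerD.
    rewrite -[leLHS]add0r lerD// -mulrA ler_peMr ?mulr_ge0//.
    by rewrite mulrC ler_pdivlMr// mul1r distrC.
rewrite RintegralD// !RintegralZl//; [|exact: integrable_normal_moment|exact: integrable_normal_pdf].
rewrite Rintegral_normal_pdf mulr1 lerD2l ler_wpM2l ?normal_moment_le//.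
by rewrite divr_ge0 ?mulr_ge0// ltW.
Qed.

Section smooth_cvg.
Variables (e K : R) (f : R -> R).
Hypotheses (e0 : 0 < e) (mf : measurable_fun setT f).
Hypothesis f_int : mu.-integrable setT (EFin \o f).

(** The Lebesgue density of [L] convolved with the centered normal law of standard deviation [e]. *)
Let kernel (L : law R) (y : R) : R := \int[L]_x normal_pdf x e y.

Let diag (L : law R) (y s : R) : R := phase L s (- (s * y)).

Let diag_le1 L y s : `|diag L y s| <= 1.
Proof. by apply: normr_Rintegral_le_cst => [|x]; [exact: measurable_cosD|exact: cos_max]. Qed.

Let g (y : R) (z : measurableTypeR R * measurableTypeR R) : R := cos (z.1 * z.2 + - (z.1 * y)).

Let mg y : measurable_fun setT (g y).
Proof.
apply: (@measurableT_comp _ _ _ _ _ _ (@cos R)).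
  by apply: continuous_measurable_fun; exact: continuous_cos.
have m1 := @measurable_fst _ _ (measurableTypeR R) (measurableTypeR R).
have m2 := @measurable_snd _ _ (measurableTypeR R) (measurableTypeR R).
apply: (@measurable_funD _ _ R setT
  (fun z : measurableTypeR R * measurableTypeR R => (z.1 : R) * z.2)
  (fun z : measurableTypeR R * measurableTypeR R => - ((z.1 : R) * y))).
  exact: (@measurable_funM _ _ R _ _ _ m1 m2).
apply: measurableT_comp => //.
exact: (@measurable_funM _ _ R _ _ _ m1 (measurable_cst _)).
Qed.

Let g1 y z : `|g y z| <= 1.
Proof. exact: cos_max. Qed.

Let mdiag L y : measurable_fun setT (diag L y).
Proof.
exact: (measurable_Rintegral_prob L L (mg y) (g1 y)).
Qed.

(** Fourier inversion for the smoothed law: its density is a Gaussian average of the phases of [L],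
    so convergence of phases gives pointwise convergence of densities. *)
Let kernelE (L : law R) y :
  kernel L y = normal_peak e * \int[normal_prob 0 e^-1]_s diag L y s.
Proof.
rewrite /kernel.
under eq_Rintegral do rewrite normal_pdf_phase//.
rewrite RintegralZl//; last first.
  apply: (@integrable_bounded _ _ _ L _ 1).
    apply: (measurable_Rintegral_prob L (normal_prob 0 e^-1)
      (f := fun z => g y (z.2, z.1)) (K := 1)) => [|z]; last exact: g1.
    exact: (measurableT_comp (mg y) (@measurable_swap _ _ _ _)).
  move=> x; apply: normr_Rintegral_le_cst => [|z]; last exact: cos_max.
  exact: (measurableT_comp (mg y) (pair2_measurable x)).
congr (_ * _).
rewrite -(prob_Fubini2 (normal_prob 0 e^-1) L (mg y) (g1 y)).
by rewrite (prob_Fubini1 (normal_prob 0 e^-1) L (mg y) (g1 y)).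
Qed.

Let F (z : measurableTypeR R * measurableTypeR R) : R := f z.2 * normal_pdf z.1 e z.2.

Let F_le x y : `|F (x, y)| <= normal_peak e * `|f y|.
Proof.
rewrite normrM (ger0_norm (normal_pdf_ge0 _ _ _)) mulrC ler_wpM2r//.
by rewrite normal_pdf_ub// gt_eqF.
Qed.

Let mF : measurable_fun setT F.
Proof.
apply: (@measurable_funM _ _ R _ (fun z : measurableTypeR R * measurableTypeR R => f z.2)).
  exact: (measurableT_comp mf (@measurable_snd _ _ _ _)).
by apply: measurable_normal_pdf2; rewrite gt_eqF.
Qed.

Let peak_int : mu.-integrable setT (EFin \o (fun y => normal_peak e * `|f y|)).
Proof. by apply: integrable_EFinZl; exact: integrable_norm. Qed.

Let F_int2 x : mu.-integrable setT (EFin \o (fun y => F (x, y))).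
Proof.
apply: (@integrable_dominated _ _ _ mu _ _ _ peak_int) => [|y]; last exact: F_le.
exact: (measurableT_comp mF (pair1_measurable x)).
Qed.

Let F_int (L : law R) : (L \x mu)%E.-integrable setT (EFin \o F).
Proof.
apply/integrable12ltyP; first exact/measurable_EFinP.
apply: (@le_lt_trans _ _ (\int[L]_x cst (\int[mu]_y (normal_peak e * `|f y|)%:E) x)%E).
  have mabs : measurable_fun setT (fun z => `|(F z)%:E|%E).
    by apply: measurableT_comp => //; exact/measurable_EFinP.
  apply: ge0_le_integral => //.
    by move=> x _; exact: integral_ge0.
    exact: (measurable_fun_fubini_tonelli_F (m2 := mu) (fun z => `|(F z)%:E|%E)
      mabs (fun=> abse_ge0 _)).
  move=> x _; apply: ge0_le_integral => //.
  - by apply: measurableT_comp => //; exact: measurable_int (F_int2 x).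
  - exact: measurable_int peak_int.
  - by move=> y _; rewrite lee_fin F_le.
rewrite integral_cst//= probability_setT mule1.
exact: integrable_lty peak_int.
Qed.

(** Fubini against Lebesgue measure, which is infinite: the product is integrable because [f] is and
    the Gaussian kernel is bounded. *)
Let smoothE (L : law R) : \int[L]_x smooth e f x = \int[mu]_y (f y * kernel L y).
Proof.
rewrite /smooth (RFubini (m1 := L) (m2 := mu) (f := F) (F_int L) F_int2) //.
- apply: eq_Rintegral => y _; rewrite /F/= RintegralZl//.
  apply: (@integrable_bounded _ _ _ L _ (normal_peak e)).
    exact: (measurableT_comp (measurable_normal_pdf2 (lt0r_neq0 e0)) (pair2_measurable y)).
  by move=> x; rewrite (ger0_norm (normal_pdf_ge0 _ _ _)) normal_pdf_ub ?gt_eqF.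
- move=> y; apply: (@integrable_bounded _ _ _ L _ (normal_peak e * `|f y|)).
    exact: (measurableT_comp mF (pair2_measurable y)).
  by move=> x; exact: F_le.
Qed.

Lemma measurable_smooth : measurable_fun setT (smooth e f).
(* The point mass [normal_law 0 0] is an arbitrary law, chosen so that the Fubini lemma applies. *)
Proof. exact: (measurable_Rintegral1 (F_int (normal_law 0 0)) F_int2). Qed.

(** Dominated convergence twice: over the random frequency [s] for each fixed [y], with majorant
    [1], and then over [y], with majorant [|f y|] times the peak. *)
Lemma cvg_smooth (nu : nat -> law R) (L : law R) :
  (forall t a, phase (nu n) t a @[n --> \oo] --> phase L t a) ->
  \int[nu n]_x smooth e f x @[n --> \oo] --> \int[L]_x smooth e f x.
Proof.
move=> nuL; under eq_fun do rewrite smoothE; rewrite smoothE.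
have kernel_le M y : `|kernel M y| <= normal_peak e.
  rewrite kernelE normrM (ger0_norm (normal_peak_ge0 _)) ler_piMr ?normal_peak_ge0//.
  by apply: normr_Rintegral_le_cst => [|s]; [exact: mdiag|exact: diag_le1].
have mkernel M : measurable_fun setT (kernel M).
  apply: (measurable_Rintegral_prob M M
    (f := fun z => normal_pdf z.2 e z.1) (K := normal_peak e)).
    exact: (measurableT_comp (measurable_normal_pdf2 (lt0r_neq0 e0))
      (@measurable_swap _ _ _ _)).
  by move=> z; rewrite (ger0_norm (normal_pdf_ge0 _ _ _)) normal_pdf_ub ?gt_eqF.
apply: (@Rdominated_cvg _ _ _ mu _ _ (fun y => `|f y| * normal_peak e)).
- by move=> n; exact: (measurable_funM mf (mkernel (nu n))).
- move=> y; apply: cvgM; first exact: cvg_cst.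
  under eq_fun do rewrite kernelE; rewrite kernelE.
  apply: cvgM; first exact: cvg_cst.
  apply: (@Rdominated_cvg _ _ _ _ _ _ (cst 1)).
  + by move=> n; exact: mdiag.
  + by move=> s; exact: nuL.
  + exact: finite_measure_integrable_cst.
  + by move=> n s; exact: diag_le1.
- under eq_fun do rewrite mulrC; apply: integrable_EFinZl; exact: integrable_norm.
- by move=> n y; rewrite normrM ler_wpM2l.
Qed.

End smooth_cvg.
End levy.

Section levy_continuity.
Context {R : realType}.
Local Notation mu := (@lebesgue_measure R).

Lemma compact_support_uniformly_continuous (f : R -> R) (N eta : R) :
  continuous f -> (forall x, N <= `|x| -> f x = 0) -> 0 < eta ->
  exists2 del, 0 < del & forall x y, `|x - y| < del -> `|f x - f y| <= eta.
Proof.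
move=> cf f0 eta0.
(* The unit margin handles points outside the interval: with [del < 1], if [|x| > N + 1] then
   [|y| >= N] too, and both values vanish. *)
have : compact `[- (N + 1), N + 1]%classic by exact: segment_compact.
move=> /compact_near_coveringP.
move=> /(_ R (0^'+) (fun del x => forall y, `|x - y| < del -> `|f x - f y| <= eta)).
have cover x : `[- (N + 1), N + 1]%classic x ->
    \forall x' \near x & i \near 0^'+,
      forall y, `|x' - y| < i -> `|f x' - f y| <= eta.
  move=> _.
  have /cvgrPdist_lt /(_ (eta / 2)) := cf x; rewrite divr_gt0// => /(_ isT).
  move=> /nbhs_ballP[r /= r0 xr].
  exists (ball x (r / 2), [set i | i < r / 2]).
    split => /=; first by apply: nbhsx_ballx; rewrite divr_gt0.
    by apply: nbhs_right_lt; rewrite divr_gt0.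
  move=> [x' i] /= [xx' ir] y x'y.
  have r2 : r / 2 < r by rewrite ltr_pdivrMr// mulr2n mulrDr mulr1 ltrDl.
  have -> : f x' - f y = (f x - f y) - (f x - f x') by ring.
  rewrite (le_trans (ler_normB _ _))// [leRHS]splitr lerD//; apply/ltW/xr.
    rewrite /ball/= (_ : x - y = (x - x') + (x' - y)); last by ring.
    by rewrite (le_lt_trans (ler_normD _ _))// [ltRHS]splitr ltrD// (lt_trans x'y).
  by apply: le_ball xx'; exact: ltW.
move=> /(_ _ cover) near0.
have : \forall del \near 0^'+, [/\ 0 < del, del < 1 & `[- (N + 1), N + 1]%classic `<=`
    (fun x => forall y, `|x - y| < del -> `|f x - f y| <= eta)].
  near=> del; split.
  - by near: del; exact: nbhs_right_gt.
  - by near: del; exact: nbhs_right_lt.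
  - by near: del; exact: near0.
move=> /filter_ex[del [del0 del1 H]]; exists del => // x y xy.
have [xN|Nx] := leP `|x| (N + 1); first by apply: H => //=; rewrite in_itv/= -ler_norml.
have Ny : N <= `|y|.
  have : `|x| <= `|x - y| + `|y| by rewrite -{1}(subrK y x) ler_normD.
  by move: xy del1 Nx; lra.
rewrite !f0// ?subrr ?normr0 ?ltW// (le_lt_trans _ Nx)// lerDl//.
Unshelve. all: end_near. Qed.

Lemma levy_compact_support (nu : nat -> law R) (L : law R) (f : R -> R) (N K : R) :
  (forall t a, phase (nu n) t a @[n --> \oo] --> phase L t a) ->
  continuous f -> (forall x, `|f x| <= K) -> (forall x, N <= `|x| -> f x = 0) ->
  \int[nu n]_x f x @[n --> \oo] --> \int[L]_x f x.
Proof.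
move=> nuL cf fK f0.
have mf : measurable_fun setT f by exact: continuous_measurable_fun.
have intf : mu.-integrable setT (EFin \o f).
  have [N0|N0] := ltP N 0.
    apply: (eq_integrable measurableT (cst 0%E)); last exact: integrable0.
    by move=> x _; rewrite /= f0// (le_trans (ltW N0)).
  have : mu.-integrable `[- N, N]%classic (EFin \o f).
    apply: continuous_compact_integrable; first exact: segment_compact.
    exact: continuous_subspaceT.
  move=> /(integrable_mkcond (mu := mu) (EFin \o f) (measurable_itv `[- N, N])).1.
  apply: eq_integrable => // x _; rewrite patchE; case: ifPn => //.
  rewrite notin_setE/= in_itv/= -ler_norml => /negP; rewrite -ltNge => Nx.
  by rewrite f0// ltW.
apply/cvgrPdist_lt => eps eps0.
have [del del0 fdel] := compact_support_uniformly_continuous cf f0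
  (divr_gt0 eps0 (ltr0n _ 6) : 0 < eps / 6%:R).
have K0 : 0 <= K by exact: le_trans (fK 0).
(* With this width the far term of [smooth_near] is at most [eps / 6]. The near term is at most
   [eps / 6] too, so smoothing moves every mean by at most [eps / 3]. The [+ 1] keeps the
   denominator positive. *)
pose e := eps / 6 / (2 * K / del * Num.sqrt 2 + 1).
have D0 : 0 <= 2 * K / del * Num.sqrt 2.
  by rewrite mulr_ge0 ?sqrtr_ge0// divr_ge0 ?mulr_ge0// ltW.
have D1 : 0 < 2 * K / del * Num.sqrt 2 + 1 by rewrite ltr_wpDl.
have e0 : 0 < e by rewrite divr_gt0// divr_gt0.
have De : 2 * K / del * (Num.sqrt 2 * e) <= eps / 6.
  rewrite mulrA /e mulrCA ler_piMr ?divr_ge0 ?(ltW eps0)//.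
  by rewrite ler_pdivrMr// mul1r lerDl.
have near_f (M : law R) : `|\int[M]_x smooth e f x - \int[M]_x f x| <= eps / 3.
  have msm : measurable_fun setT (smooth e f) by exact: measurable_smooth.
  have smx x : `|smooth e f x - f x| <= eps / 3.
    apply: le_trans (smooth_near e0 del0 mf fK (fdel x)) _.
    by apply: le_trans (lerD (lexx _) De) _; lra.
  rewrite -RintegralB//.
  - exact: (@normr_Rintegral_le_cst _ _ _ M _ _ (measurable_funB msm mf) smx).
  - apply: (@integrable_bounded _ _ _ M _ (K + eps / 3)) => // x.
    by have := smx x; have := fK x; rewrite !ler_norml; lra.
  - exact: (@integrable_bounded _ _ _ M _ K).
have /cvgrPdist_lt /(_ (eps / 3)) := cvg_smooth e0 mf intf nuL.
rewrite divr_gt0// => /(_ isT); apply: filterS => n H.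
have := near_f L; have := near_f (nu n).
move: H; rewrite !ltr_norml !ler_norml; lra.
Qed.

(** Tightness follows from the compactly supported case applied to the cutoffs: [chi N] has mean
    close to [1] under [L] for large [N], hence also under [nu n] eventually, and cutting [f] off
    costs at most [K] times the missing mean. *)
Lemma levy_continuity (nu : nat -> law R) (L : law R) (f : R -> R) :
  (forall t a, phase (nu n) t a @[n --> \oo] --> phase L t a) ->
  continuous f -> (exists K, forall x, `|f x| <= K) ->
  \int[nu n]_x f x @[n --> \oo] --> \int[L]_x f x.
Proof.
move=> nuL cf [K fK].
pose chi (N : nat) (x : R) : R := clamp (1 * (N.+1%:R - `|x|)).
have cchi N : continuous (chi N).
  move=> x; apply: (@continuous_comp _ _ _ (fun x : R => `|x|)
    (fun y => clamp (1 * (N.+1%:R - y)))).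
    exact: norm_continuous.
  exact: continuous_clamp_affine.
have mchi N : measurable_fun setT (chi N) by exact: continuous_measurable_fun.
have chi1 N x : `|chi N x| <= 1 by exact: normr_clamp.
have chi0 N x : N.+1%:R <= `|x| -> chi N x = 0.
  by move=> Nx; rewrite /chi clamp_eq0// mul1r subr_le0.
have ichi (M : law R) N : M.-integrable setT (EFin \o chi N).
  exact: (@integrable_bounded _ _ _ M _ 1 (mchi N) (chi1 N)).
have mf : measurable_fun setT f by exact: continuous_measurable_fun.
have mfchi N : measurable_fun setT (fun x => f x * chi N x) by exact: (measurable_funM mf (mchi N)).
have K0 : 0 <= K by exact: le_trans (fK 0).
have fchiK N x : `|f x * chi N x| <= K.
  by rewrite normrM -[K]mulr1 ler_pM.
have ifM (M : law R) : M.-integrable setT (EFin \o f).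
  exact: (@integrable_bounded _ _ _ M _ K mf fK).
have ifchi (M : law R) N : M.-integrable setT (EFin \o (fun x => f x * chi N x)).
  exact: (@integrable_bounded _ _ _ M _ K (mfchi N) (fchiK N)).
have i1 (M : law R) : M.-integrable setT (EFin \o (fun=> 1 : R)).
  exact: finite_measure_integrable_cst.
have ic (M : law R) N : M.-integrable setT (EFin \o (fun x => 1 - chi N x)).
  exact: (integrable_EFinB (i1 M) (ichi M N)).
have tail (M : law R) N : `|\int[M]_x f x - \int[M]_x (f x * chi N x)| <=
    K * (1 - \int[M]_x chi N x).
  rewrite -(RintegralB measurableT (ifM M) (ifchi M N)).
  have -> : K * (1 - \int[M]_x chi N x) = \int[M]_x (K * (1 - chi N x)).
    rewrite (RintegralZl _ measurableT (ic M N)).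
    by rewrite (RintegralB measurableT (i1 M) (ichi M N)) Rintegral_prob_cst.
  apply: (@normr_Rintegral_le _ _ _ M).
  - exact: (measurable_funB mf (mfchi N)).
  - exact: (integrable_EFinZl K (ic M N)).
  - move=> x; rewrite -{1}[f x]mulr1 -mulrBr normrM.
    by rewrite ler_pM// ger0_norm// subr_ge0 clamp_le1.
have chiL : \int[L]_x chi N x @[N --> \oo] --> (1 : R).
  rewrite -[X in _ --> X](Rintegral_prob_cst L 1).
  apply: (@Rdominated_cvg _ _ _ _ _ _ (cst 1)) => //.
  - move=> x; apply: cvg_near_cst; near=> k.
    rewrite /chi clamp_eq1// mul1r lerBrDr -addn1 natrD addrC lerD2r.
    by near: k; exact: nbhs_infty_ger.
  - exact: finite_measure_integrable_cst.
apply/cvgrPdist_lt => eps eps0.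
(* The cutoff costs [K e] under [L] and [2 K e] under [nu n], where the mean of [chi N] is within
   [e] of one that is within [e] of [1]. The truncated integrals differ by less than [e], and one
   more [e] leaves slack. *)
pose e := eps / (3 * K + 2).
have e0 : 0 < e by rewrite divr_gt0// ltr_wpDl// mulr_ge0.
have eE : e * (3 * K + 2) = eps.
  by rewrite /e divfK// gt_eqF// ltr_wpDl// mulr_ge0.
have /cvgrPdist_lt /(_ e e0) /filter_ex[N LN] := chiL.
have /cvgrPdist_lt /(_ e e0) nuchi := levy_compact_support nuL (cchi N) (chi1 N) (chi0 N).
have /cvgrPdist_lt /(_ e e0) nuf : \int[nu n]_x (f x * chi N x) @[n --> \oo] -->
    \int[L]_x (f x * chi N x).
  apply: (levy_compact_support nuL _ (fchiK N) (N := N.+1%:R)).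
    by move=> x; apply: cvgM; [exact: cf|exact: cchi].
  by move=> x Nx; rewrite chi0// mulr0.
near=> n.
have := tail L N; have := tail (nu n) N.
have : `|\int[L]_x chi N x - \int[nu n]_x chi N x| < e by near: n.
have : `|\int[L]_x (f x * chi N x) - \int[nu n]_x (f x * chi N x)| < e by near: n.
rewrite ltr_norml => /andP[h1 h2]; rewrite ltr_norml => /andP[h3 h4].
rewrite ler_norml => /andP[h5 h6]; rewrite ler_norml => /andP[h7 h8].
move: LN; rewrite ltr_norml => /andP[h9 h10].
have := ler_wpM2l K0 (ltW h10); have := ler_wpM2l K0 (ltW h4).
move: (\int[L]_x f x) (\int[nu n]_x f x) (\int[L]_x chi N x)
 (\int[nu n]_x chi N x) (\int[L]_x (f x * chi N x)) (\int[nu n]_x (f x * chi N x))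
 h1 h2 h3 h4 h5 h6 h7 h8 h9 h10 => a b c d u v h1 h2 h3 h4 h5 h6 h7 h8 h9 h10 h11 h12.
rewrite ltr_norml -eE; apply/andP; split; nra.
Unshelve. all: end_near. Qed.

(** By [levy_continuity], the constant sequence [L] converges to [M] as well as to itself. *)
Lemma eq_law_phase (L M : law R) :
  (forall t a, phase L t a = phase M t a) -> eq_law L M.
Proof.
move=> LM; apply: eq_law_Rintegral => f cf fK.
have LMc t a : phase L t a @[_ --> \oo] --> phase M t a by rewrite LM; exact: cvg_cst.
exact: cvg_unique (cvg_cst _) (levy_continuity LMc cf fK).
Qed.
End levy_continuity.

(** * Square integrability and product measures *)

Lemma discriminant_le (R : realType) (A B C : R) : 0 <= A ->
  (forall s, 0 <= s ^+ 2 * A + B - 2 * s * C) -> C ^+ 2 <= A * B.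
Proof.
move=> A0 quad; have [A00|A00] := eqVneq A 0.
  have [->|C0] := eqVneq C 0; first by rewrite expr0n/= A00 mul0r.
  (* In the degenerate case the quadratic is affine in [s]; this [s] would make it equal to
     [- 1]. *)
  have := quad ((B + 1) / (2 * C)); rewrite A00 mulr0 add0r.
  have -> : 2 * ((B + 1) / (2 * C)) * C = B + 1 by field.
  lra.
have Apos : 0 < A by rewrite lt_neqAle eq_sym A00.
have := quad (C / A).
have -> : (C / A) ^+ 2 * A + B - 2 * (C / A) * C = (A * B - C ^+ 2) / A by field.
by rewrite pmulr_lge0 ?invr_gt0// subr_ge0.
Qed.

Section square_integrable.
Context (d : measure_display) (T : measurableType d) (R : realType).
Variable mu : {measure set T -> \bar R}.
Implicit Types f g : T -> R.

(** Stated for an arbitrary measure because root densities live in L_2 of [Q + P], which has mass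
    two; over a probability it is equivalent to [L2]. *)
Definition square_integrable f :=
  measurable_fun setT f /\ mu.-integrable setT (EFin \o (fun x => f x ^+ 2)).

Lemma square_integrable_le f g : measurable_fun setT f ->
  (forall x, `|f x| <= `|g x|) -> square_integrable g -> square_integrable f.
Proof.
move=> mf fg [mg ig]; split => //; apply: integrable_dominated ig _.
  exact: measurable_funX.
by move=> x; rewrite normrX -(real_normK (num_real (g x))) lerXn2r// ?nnegrE.
Qed.

Lemma square_integrableM f g : square_integrable f -> square_integrable g ->
  mu.-integrable setT (EFin \o (fun x => f x * g x)).
Proof.
move=> [mf f2] [mg g2].
apply: (integrable_dominated _ (integrable_EFinD f2 g2)) => [|x].
  exact: measurable_funM.
rewrite normrM -(real_normK (num_real (f x))) -(real_normK (num_real (g x))).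
by have := sqr_ge0 (`|f x| - `|g x|); have := sqr_ge0 (`|f x| + `|g x|); nra.
Qed.

Lemma square_integrableD f g : square_integrable f -> square_integrable g ->
  square_integrable (fun x => f x + g x).
Proof.
move=> sf sg; have [mf f2] := sf; have [mg g2] := sg; split.
  exact: measurable_funD.
have fg := square_integrableM sf sg.
apply: (integrable_dominated _ (integrable_EFinD (integrable_EFinD f2 g2)
  (integrable_EFinZl 2 fg))) => [|x].
  by apply: measurable_funX; exact: measurable_funD.
by rewrite ger0_norm ?sqr_ge0//; lra.
Qed.

Lemma square_integrableZ k f : square_integrable f ->
  square_integrable (fun x => k * f x).
Proof.
move=> [mf f2]; split; first exact: measurable_funM.
under [X in EFin \o X]eq_fun do rewrite exprMn.
exact: integrable_EFinZl.
Qed.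

Lemma square_integrableB f g : square_integrable f -> square_integrable g ->
  square_integrable (fun x => f x - g x).
Proof.
move=> sf sg; have := square_integrableD sf (square_integrableZ (-1) sg).
by under eq_fun do rewrite mulN1r.
Qed.

Lemma square_integrable_norm f : square_integrable f ->
  square_integrable (fun x => `|f x|).
Proof.
move=> sf; apply: (square_integrable_le _ _ sf) => [|x]; last by rewrite normr_id.
by apply: measurableT_comp => //; case: sf.
Qed.

Lemma Rintegral_cauchy_schwarz f g :
  square_integrable f -> square_integrable g ->
  `|\int[mu]_x (f x * g x)|
  <= Num.sqrt (\int[mu]_x f x ^+ 2) * Num.sqrt (\int[mu]_x g x ^+ 2).
Proof.
move=> sf sg; set A := \int[mu]_x f x ^+ 2; set B := \int[mu]_x g x ^+ 2.
set C := \int[mu]_x (f x * g x).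
have A0 : 0 <= A by apply: Rintegral_ge0 => x _; exact: sqr_ge0.
have quad s : 0 <= s ^+ 2 * A + B - 2 * s * C.
  have -> : s ^+ 2 * A + B - 2 * s * C = \int[mu]_x (s * f x - g x) ^+ 2.
    have [_ f2] := sf; have [_ g2] := sg; have fg := square_integrableM sf sg.
    rewrite -!RintegralZl// -RintegralD//; last exact: integrable_EFinZl.
    rewrite -RintegralB//.
    - by apply: eq_Rintegral => x _; ring.
    - by apply: integrable_EFinD => //; exact: integrable_EFinZl.
    - exact: integrable_EFinZl.
  by apply: Rintegral_ge0 => x _; exact: sqr_ge0.
rewrite -sqrtrM// -sqrtr_sqr ler_wsqrtr//.
exact: discriminant_le.
Qed.

End square_integrable.

Section prod_prob.
Context (d : measure_display) (T : measurableType d) (R : realType).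
Implicit Types P Q : probability T R.

Lemma Rintegral_prod_probS P n (f : n.+1.-tuple T -> R) (K : R) :
  measurable_fun setT f -> (forall w, `|f w| <= K) ->
  \int[prod_prob P n.+1]_w f w
  = \int[P]_x \int[prod_prob P n]_w f (tcons (x, w)).
Proof.
move=> mf fK.
have mft := measurableT_comp mf (@measurable_tcons _ T n).
transitivity (\int[(P \x prod_prob P n)%E]_z f (tcons z)).
  congr fine; rewrite /= integral_distribution//; first exact/measurable_EFinP.
  exact: (@integrable_bounded _ _ _ ((P \x prod_prob P n)%E : probability _ R)
    _ K mft (fun z => fK _)).
exact: (prob_Fubini1 P (prod_prob P n) mft (fun z => fK _)).
Qed.

Lemma measurable_tcons_section n (x : T) :
  measurable_fun setT (fun w : n.-tuple T => tcons (x, w)).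
Proof. exact: (measurableT_comp (@measurable_tcons _ T n) (pair1_measurable x)). Qed.

Lemma measurable_tsum n (psi : T -> R) : measurable_fun setT psi ->
  measurable_fun setT (fun w : n.-tuple T => \sum_(i < n) psi (tnth w i)).
Proof.
move=> mpsi; apply: measurable_sum => i.
by apply: (measurableT_comp mpsi); exact: measurable_tnth.
Qed.

Lemma measurable_cos_comp (d' : measure_display) (U : measurableType d')
    (g : U -> R) : measurable_fun setT g -> measurable_fun setT (fun x => cos (g x)).
Proof.
move=> mg; apply: (@measurableT_comp _ _ _ _ _ _ (@cos R)) => //.
by apply: continuous_measurable_fun; exact: continuous_cos.
Qed.

(* Replacing the summands one at a time, as in Lindeberg's argument; the phase
   [a] absorbs the remaining summands, so no complex numbers are needed. *)
Lemma prod_prob_phase Q (psi : T -> R) (theta v D : R) : measurable_fun setT psi ->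
  0 <= v ->
  (forall a, `|\int[Q]_x cos (psi x + a) - expR (- v) * cos (theta + a)| <= D) ->
  forall n a, `|\int[prod_prob Q n]_w cos (\sum_(i < n) psi (tnth w i) + a)
    - expR (- (n%:R * v)) * cos (n%:R * theta + a)| <= n%:R * D.
Proof.
move=> mpsi v0 HD; elim=> [|n IHn] a.
  under eq_Rintegral do rewrite big_ord0 add0r.
  by rewrite Rintegral_prob_cst !mul0r oppr0 expR0 mul1r add0r subrr normr0.
have mc m : measurable_fun setT
    (fun w : m.-tuple T => cos (\sum_(i < m) psi (tnth w i) + a)).
  by apply: measurable_cos_comp; apply: measurable_funD => //; exact: measurable_tsum.
rewrite (Rintegral_prod_probS _ (mc _) (K := 1)); last by move=> w; exact: cos_max.
have step x : \int[prod_prob Q n]_w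
      cos (\sum_(i < n.+1) psi (tnth (tcons (x, w)) i) + a) =
    \int[prod_prob Q n]_w cos (\sum_(i < n) psi (tnth w i) + (psi x + a)).
  apply: eq_Rintegral => w _; rewrite big_ord_recl /= tnth0 -addrA addrCA.
  by congr (cos (_ + _)); apply: eq_bigr => i _; rewrite tnthS.
pose u x := \int[prod_prob Q n]_w cos (\sum_(i < n) psi (tnth w i) + (psi x + a)).
have mu : measurable_fun setT u.
  rewrite (_ : u = fun x => \int[prod_prob Q n]_w
      cos (\sum_(i < n.+1) psi (tnth (tcons (x, w)) i) + a)); last first.
    by apply/funext => x; rewrite step.
  apply: (measurable_Rintegral_prob Q (prod_prob Q n)
    (measurableT_comp (mc n.+1) (@measurable_tcons _ T n)) (K := 1)) => z.
  exact: cos_max.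
have -> : \int[Q]_x \int[prod_prob Q n]_w
    cos (\sum_(i < n.+1) psi (tnth (tcons (x, w)) i) + a) = \int[Q]_x u x.
  by apply: eq_Rintegral => x _; exact: step.
(* The intermediate term of the replacement: the first observation is still random, and the [n]
   others are already replaced. *)
pose b x := expR (- (n%:R * v)) * cos (psi x + (n%:R * theta + a)).
have mcb : measurable_fun setT (fun x => cos (psi x + (n%:R * theta + a))).
  by apply: measurable_cos_comp; exact: measurable_funD.
have icb : Q.-integrable setT (EFin \o (fun x => cos (psi x + (n%:R * theta + a)))).
  by apply: (@integrable_bounded _ _ _ Q _ 1) => // x; exact: cos_max.
have iu : Q.-integrable setT (EFin \o u).
  apply: (@integrable_bounded _ _ _ Q _ 1) => // x.
  apply: normr_Rintegral_le_cst => [|w]; last exact: cos_max.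
  by apply: measurable_cos_comp; apply: measurable_funD => //; exact: measurable_tsum.
have ib : Q.-integrable setT (EFin \o b) by exact: integrable_EFinZl.
have e1 : expR (- (n%:R * v)) <= 1 by rewrite -expR0 ler_expR oppr_le0 mulr_ge0.
have h1 : `|\int[Q]_x u x - \int[Q]_x b x| <= n%:R * D.
  rewrite -RintegralB//; apply: normr_Rintegral_le_cst => [|x].
    by apply: measurable_funB => //; exact: measurable_funM.
  have := IHn (psi x + a); rewrite /b.
  by rewrite (_ : n%:R * theta + (psi x + a) = psi x + (n%:R * theta + a))//; ring.
have h2 : `|\int[Q]_x b x - expR (- (n.+1%:R * v)) * cos (n.+1%:R * theta + a)| <= D.
  rewrite RintegralZl//.
  have -> : expR (- (n.+1%:R * v)) = expR (- (n%:R * v)) * expR (- v).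
    by rewrite -expRD; congr expR; rewrite -natr1; ring.
  rewrite -mulrA -mulrBr normrM ger0_norm ?expR_ge0//.
  have := HD (n%:R * theta + a).
  rewrite (_ : theta + (n%:R * theta + a) = n.+1%:R * theta + a); last first.
    by rewrite -natr1; ring.
  by apply: le_trans; rewrite ler_piMl.
rewrite -[in leRHS]natr1 mulrDl mul1r; apply: le_trans (lerD h1 h2).
by rewrite (le_trans _ (ler_normD _ _))// subrKA.
Qed.

Lemma prod_prob_indicS P n (A : set (n.+1.-tuple T)) : measurable A ->
  fine (prod_prob P n.+1 A)
  = \int[P]_x fine (prod_prob P n ((fun w => tcons (x, w)) @^-1` A)).
Proof.
move=> mA; rewrite -(Rintegral_indic (prod_prob P n.+1) mA).
rewrite (Rintegral_prod_probS _ _ (K := 1)); last 2 first.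
- exact: measurable_indic.
- by move=> w; rewrite indicE; case: (_ \in _); rewrite ?normr1 ?normr0.
apply: eq_Rintegral => x _; rewrite -Rintegral_indic//.
by rewrite -[X in measurable X]setTI; exact: measurable_tcons_section.
Qed.

Lemma measurable_prod_prob_section P n (A : set (n.+1.-tuple T)) : measurable A ->
  measurable_fun setT
    (fun x => fine (prod_prob P n ((fun w => tcons (x, w)) @^-1` A))).
Proof.
move=> mA.
have m1A : measurable_fun setT (fun z : T * n.-tuple T => \1_A (tcons z) : R).
  apply: (measurableT_comp (f := \1_A : _ -> R)); first exact: measurable_indic.
  exact: measurable_tcons.
have b1A z : `|\1_A (tcons (n := n) z) : R| <= 1.
  by rewrite indicE; case: (_ \in _); rewrite ?normr1 ?normr0.
have := measurable_Rintegral_prob P (prod_prob P n) m1A b1A.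
apply: eq_measurable_fun => x _; rewrite -Rintegral_indic//.
by rewrite -[X in measurable X]setTI; exact: measurable_tcons_section.
Qed.

(* Contiguity with explicit constants: [k] is a part of dQ/dP in L_2, and [e]
   the mass of Q that it misses. *)
Lemma prod_prob_contiguity P Q (k : T -> R) (c e : R) :
  square_integrable P k -> (forall x, 0 <= k x) -> 0 <= e ->
  \int[P]_x k x <= 1 -> \int[P]_x k x ^+ 2 <= c ->
  (forall u : T -> R, measurable_fun setT u -> (forall x, 0 <= u x <= 1) ->
    \int[Q]_x u x <= \int[P]_x (k x * u x) + e) ->
  forall n (A : set (n.-tuple T)), measurable A ->
  fine (prod_prob Q n A) <= Num.sqrt (c ^+ n * fine (prod_prob P n A)) + n%:R * e.
Proof.
move=> sk k0 e0 k1 k2 HQ; elim=> [|n IHn] A mA.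
  rewrite expr0 mul1r mul0r addr0. rewrite /= /dirac indicE.
  by case: (_ \in _); rewrite /= ?sqrtr1 ?sqrtr0.
have c0 : 0 <= c by apply: le_trans k2; apply: Rintegral_ge0 => x _; exact: sqr_ge0.
pose sec x := (fun w : n.-tuple T => tcons (x, w)) @^-1` A.
have msec x : measurable (sec x).
  by rewrite -[X in measurable X]setTI; exact: measurable_tcons_section.
pose F (M : probability T R) x := fine (prod_prob M n (sec x)).
have mF M : measurable_fun setT (F M) by exact: measurable_prod_prob_section.
have F01 M x : 0 <= F M x <= 1.
  rewrite fine_ge0//= -[leRHS]/(fine 1%E) fine_le ?fin_num_measure//.
  exact: probability_le1.
rewrite !prod_prob_indicS// -/(F Q) -/(F P).
have s1 : square_integrable P (fun=> 1).
  by split => //; exact: finite_measure_integrable_cst.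
have ik : P.-integrable setT (EFin \o k).
  by have := square_integrableM sk s1; under eq_fun do rewrite mulr1.
have sFE x : Num.sqrt (F P x) ^+ 2 = F P x.
  by rewrite sqr_sqrtr//; case/andP: (F01 P x).
have sF : square_integrable P (fun x => Num.sqrt (F P x)).
  split.
    apply: (@measurableT_comp _ _ _ _ _ _ (@Num.sqrt R)) => //.
    by apply: continuous_measurable_fun; exact: sqrt_continuous.
  under eq_fun do rewrite sFE.
  apply: (@integrable_bounded _ _ _ P _ 1) => // x.
  by have /andP[F0 F1] := F01 P x; rewrite ger0_norm.
have skF := square_integrableM sk sF.
apply: le_trans (HQ _ (mF Q) (F01 Q)) _.
rewrite -natr1 mulrDl mul1r addrA lerD2r.
(* [HQ] was applied to the conditional probability [F Q] given the first coordinate. The induction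
   hypothesis bounds it by [sqrt (c^n F P) + n e], which is now weighted by [k]. *)
apply: (@le_trans _ _ (\int[P]_x (Num.sqrt (c ^+ n) * (k x * Num.sqrt (F P x))
    + n%:R * e * k x))).
  apply: le_Rintegral => //.
  - apply: (integrable_dominated _ ik) => [|x].
      by apply: measurable_funM => //; exact: sk.1.
    have /andP[F0 F1] := F01 Q x.
    by rewrite normrM (ger0_norm (k0 x)) (ger0_norm F0) ler_piMr.
  - by apply: integrable_EFinD; exact: integrable_EFinZl.
  - move=> x _; have := IHn (sec x) (msec x); rewrite sqrtrM ?exprn_ge0// -/(F P x) => H.
    by have := ler_wpM2l (k0 x) H; rewrite -/(F Q x); lra.
rewrite RintegralD//; [|exact: integrable_EFinZl|exact: integrable_EFinZl].
rewrite !RintegralZl// lerD//; last first.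
  by rewrite ler_piMr// mulr_ge0.
(* Cauchy-Schwarz for [k] and the root of [F P] supplies the missing factor [c]. The accumulated
   error [n e] did not grow, since [k] has mean at most [1]. *)
rewrite exprSr -mulrA sqrtrM ?exprn_ge0// ler_wpM2l ?sqrtr_ge0//.
rewrite sqrtrM//; apply: le_trans (ler_norm _) _.
apply: le_trans (Rintegral_cauchy_schwarz sk sF) _.
rewrite ler_pM ?sqrtr_ge0// ?ler_wsqrtr//.
by under eq_Rintegral do rewrite sFE.
Qed.

End prod_prob.

(** * Differentiability in quadratic mean *)

Section sqrt_density.
Context (d : measure_display) (T : measurableType d) (R : realType).
Variables Q P : probability T R.
Local Notation mu := (sum_measure Q P).

Definition sqrt_density (M : probability T R) (x : T) : R :=
  Num.sqrt (density Q P M x).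

Variable M : probability T R.
Hypothesis Mmu : M `<< mu.
Local Notation f := (Radon_Nikodym_SigmaFinite.f M mu).

Let f_ge0 : forall x, (0 <= f x)%E.
Proof. exact: Radon_Nikodym_SigmaFinite.f_ge0. Qed.

Let mf : measurable_fun setT f.
Proof. exact: measurable_int (Radon_Nikodym_SigmaFinite.f_integrable Mmu). Qed.

Lemma measurable_sqrt_density : measurable_fun setT (sqrt_density M).
Proof.
apply: (@measurableT_comp _ _ _ _ _ _ (@Num.sqrt R)) => //.
  by apply: continuous_measurable_fun; exact: sqrt_continuous.
apply: (@measurableT_comp _ _ _ _ _ _ (@fine R)) => //.
Qed.

(** [density] is the finite part of a derivative known only almost everywhere. Comparison with the
    version [f], nonnegative and finite at every point, shows that squaring the root recovers the
    density. *)
Let densityE : ae_eq mu setT (fun x => (sqrt_density M x ^+ 2)%:E) f.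
Proof.
have := ae_eq_Radon_Nikodym_SigmaFinite Mmu measurableT.
apply: filterS => x /= /(_ I) fx _.
have fin := Radon_Nikodym_SigmaFinite.f_fin_num Mmu x.
rewrite /sqrt_density /density -fx sqr_sqrtr ?fineK//.
exact: fine_ge0.
Qed.

Let ae_eq_M (F : T -> R) : ae_eq mu setT
  (fun x => (F x * sqrt_density M x ^+ 2)%:E) (fun x => (F x)%:E * f x)%E.
Proof. by apply: filterS densityE => x /= /(_ I) fx _; rewrite EFinM fx. Qed.

Lemma integrable_sqrt_density (F : T -> R) : M.-integrable setT (EFin \o F) ->
  mu.-integrable setT (EFin \o (fun x => F x * sqrt_density M x ^+ 2)).
Proof.
move=> intF; have mF := integrable_EFin_measurable intF.
have mFd : measurable_fun setT (fun x => F x * sqrt_density M x ^+ 2).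
  by apply: measurable_funM => //; apply: measurable_funX; exact: measurable_sqrt_density.
apply/integrableP; split; first exact/measurable_EFinP.
rewrite (ae_eq_integral (fun x => `|F x|%:E * f x)%E) //.
- rewrite Radon_Nikodym_SigmaFinite.change_of_variables//.
    by case/integrableP: intF.
  by apply/measurable_EFinP; exact: measurableT_comp.
- by apply: measurableT_comp => //; exact/measurable_EFinP.
- by apply: emeasurable_funM => //; apply/measurable_EFinP; exact: measurableT_comp.
- apply: filterS (ae_eq_M F) => x /= /(_ I) fx _.
  by rewrite -abse_EFin fx abseM (gee0_abs (f_ge0 x)).
Qed.

Lemma Rintegral_sqrt_density (F : T -> R) : M.-integrable setT (EFin \o F) ->
  \int[M]_x F x = \int[mu]_x (F x * sqrt_density M x ^+ 2).
Proof.
move=> intF; have mF := integrable_EFin_measurable intF.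
have mFd : measurable_fun setT (fun x => F x * sqrt_density M x ^+ 2).
  by apply: measurable_funM => //; apply: measurable_funX; exact: measurable_sqrt_density.
congr fine; rewrite -(Radon_Nikodym_change_of_variables Mmu measurableT intF).
apply: ae_eq_integral => //.
- apply: emeasurable_funM; first exact/measurable_EFinP.
  by apply: (measurable_int mu); exact: Radon_Nikodym_integrable.
- exact/measurable_EFinP.
have := ae_eq_Radon_Nikodym_SigmaFinite Mmu measurableT.
apply: filterS2 (ae_eq_M F) => x /= /(_ I) -> /(_ I) fx _.
by rewrite fx.
Qed.

Lemma square_integrable_sqrt_density (F : T -> R) : square_integrable M F ->
  square_integrable mu (fun x => F x * sqrt_density M x).
Proof.
move=> [mF F2]; split.
  by apply: measurable_funM => //; exact: measurable_sqrt_density.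
by under [X in EFin \o X]eq_fun do rewrite exprMn; exact: integrable_sqrt_density.
Qed.

End sqrt_density.

Section dominated.
Context (d : measure_display) (T : measurableType d) (R : realType).
Variables Q P : probability T R.
Local Notation mu := (sum_measure Q P).

Let muE A : (mu A = Q A + P A)%E.
Proof. by rewrite /sum_measure measure_addE. Qed.

Lemma dominates_suml : Q `<< mu.
Proof.
apply/null_content_dominatesP => A mA muA; apply/eqP.
have /eqP : (Q A + P A = 0)%E by rewrite -muE.
by rewrite padde_eq0 ?measure_ge0// => /andP[].
Qed.

Lemma dominates_sumr : P `<< mu.
Proof.
apply/null_content_dominatesP => A mA muA; apply/eqP.
have /eqP : (Q A + P A = 0)%E by rewrite -muE.
by rewrite padde_eq0 ?measure_ge0// => /andP[].
Qed.

End dominated.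

Lemma measurable_invr (R : realType) : measurable_fun setT (fun y : R => y^-1).
Proof.
have -> : (fun y : R => y^-1) = (fun y => if 0 < `|y| then y^-1 else 0).
  by apply/funext => y; case: ifPn => //; rewrite normr_gt0 negbK => /eqP ->; rewrite invr0.
apply: measurable_fun_if => //.
- by apply: measurable_fun_ltr => //; exact: measurableT_comp.
- rewrite setTI (_ : _ @^-1` _ = [set y | y != 0]); last first.
    by apply/seteqP; split => y /=; rewrite normr_gt0.
  apply: open_continuous_measurable_fun; first exact: open_neq.
  by move=> y; rewrite inE => y0; exact: inv_continuous.
Qed.

Section dqm_step.
Context (d : measure_display) (T : measurableType d) (R : realType).
Variables (Q P : probability T R) (h : T -> R) (t : R).
Hypotheses (sh : square_integrable P h) (t0 : 0 < t).
Local Notation mu := (sum_measure Q P).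
Local Notation a := (sqrt_density Q P Q).
Local Notation b := (sqrt_density Q P P).

Let Qmu : Q `<< mu. Proof. exact: dominates_suml. Qed.
Let Pmu : P `<< mu. Proof. exact: dominates_sumr. Qed.

Let r (x : T) : R := (a x - b x) / t - 2^-1 * h x * b x.
Let rho : R := fine (dqm_remainder Q P h t).

Let a0 x : 0 <= a x. Proof. exact: sqrtr_ge0. Qed.
Let b0 x : 0 <= b x. Proof. exact: sqrtr_ge0. Qed.
Let ma : measurable_fun setT a. Proof. exact: (measurable_sqrt_density Qmu). Qed.
Let mb : measurable_fun setT b. Proof. exact: (measurable_sqrt_density Pmu). Qed.

Let s1 (M : probability T R) : square_integrable M (fun=> 1).
Proof. by split => //; exact: finite_measure_integrable_cst. Qed.

Let sa : square_integrable mu a.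
Proof.
have := square_integrable_sqrt_density Qmu (s1 Q).
by under eq_fun do rewrite mul1r.
Qed.

Let sb : square_integrable mu b.
Proof.
have := square_integrable_sqrt_density Pmu (s1 P).
by under eq_fun do rewrite mul1r.
Qed.

Let shb : square_integrable mu (fun x => h x * b x).
Proof. exact: (square_integrable_sqrt_density Pmu sh). Qed.

Let sr : square_integrable mu r.
Proof.
have := square_integrableB (square_integrableZ t^-1 (square_integrableB sa sb))
  (square_integrableZ 2^-1 shb).
by under eq_fun do rewrite mulrA [t^-1 * _]mulrC.
Qed.

Let rhoE : rho = \int[mu]_x r x ^+ 2.
Proof. by []. Qed.

Let rho0 : 0 <= rho.
Proof. by rewrite rhoE; apply: Rintegral_ge0 => x _; exact: sqr_ge0. Qed.

Let PE (F : T -> R) : P.-integrable setT (EFin \o F) ->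
  \int[P]_x F x = \int[mu]_x (F x * b x ^+ 2).
Proof. exact: (Rintegral_sqrt_density Pmu). Qed.

Let QE (F : T -> R) : Q.-integrable setT (EFin \o F) ->
  \int[Q]_x F x = \int[mu]_x (F x * a x ^+ 2).
Proof. exact: (Rintegral_sqrt_density Qmu). Qed.

Let Pi (F : T -> R) : P.-integrable setT (EFin \o F) ->
  mu.-integrable setT (EFin \o (fun x => F x * b x ^+ 2)).
Proof. exact: (integrable_sqrt_density Pmu). Qed.

Let Qi (F : T -> R) : Q.-integrable setT (EFin \o F) ->
  mu.-integrable setT (EFin \o (fun x => F x * a x ^+ 2)).
Proof. exact: (integrable_sqrt_density Qmu). Qed.

Let aE x : a x - b x = t * (2^-1 * h x * b x + r x).
Proof. by rewrite /r; field; rewrite gt_eqF. Qed.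

(** Substituting [a - b = t (h b / 2 + r)] turns [(a^2 - b^2) / t^2] into [(h b^2 + 2 b r) / t + h^2
    b^2 / 4 + h b r + r^2]. The term [h b^2 / t] is the one subtracted on the left. Terms linear in
    [r] go by Cauchy-Schwarz, and [|kap| <= t |B|] pays for the factor [1 / t]. *)
Lemma dqm_mean (kap B : T -> R) (K : R) : measurable_fun setT kap ->
  (forall x, `|kap x| <= K) -> square_integrable P B ->
  (forall x, `|kap x| <= t * `|B x|) ->
  `|t ^- 2 * (\int[Q]_x kap x - \int[P]_x kap x) - \int[P]_x (t^-1 * kap x * h x)|
  <= \int[P]_x (`|kap x| * h x ^+ 2)
     + (2 * Num.sqrt (\int[P]_x B x ^+ 2) + K * Num.sqrt (\int[P]_x h x ^+ 2))
       * Num.sqrt rho + K * rho.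
Proof.
move=> mk kK sB kB.
have K0 : 0 <= K by exact: le_trans (kK point).
have kQ : Q.-integrable setT (EFin \o kap) by exact: (@integrable_bounded _ _ _ Q _ K).
have kP : P.-integrable setT (EFin \o kap) by exact: (@integrable_bounded _ _ _ P _ K).
have skB : square_integrable P (fun x => t^-1 * kap x).
  apply: (square_integrable_le _ _ sB) => [|x]; first exact: measurable_funM.
  by rewrite normrM ger0_norm ?invr_ge0 ?(ltW t0)// mulrC ler_pdivrMr// mulrC.
have ikh := square_integrableM skB sh.
have ikh2 : P.-integrable setT (EFin \o (fun x => `|kap x| * h x ^+ 2)).
  apply: (integrable_dominated _ (integrable_EFinZl K sh.2)) => [|x].
    by apply: measurable_funM; [exact: measurableT_comp|apply: measurable_funX; exact: sh.1].
  by rewrite normrM normr_id (ger0_norm (sqr_ge0 _)) ler_wpM2r ?sqr_ge0.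
have sBb := square_integrable_norm (square_integrable_sqrt_density Pmu sB).
have sr' := square_integrable_norm sr.
have shb' := square_integrable_norm shb.
have i1 := square_integrableM sBb sr'.
have i2 := square_integrableM shb' sr'.
have := (Pi ikh2, Pi ikh, Pi kP, Qi kQ) => -[[[j1 j2] j3] j4].
rewrite (QE kQ) (PE kP) (PE ikh) (PE ikh2).
rewrite -RintegralB// -RintegralZl//; last exact: integrable_EFinB.
rewrite -RintegralB//; last by apply: integrable_EFinZl; exact: integrable_EFinB.
have cs u v : square_integrable mu u -> square_integrable mu v ->
    \int[mu]_x (u x * v x) <= Num.sqrt (\int[mu]_x u x ^+ 2) * Num.sqrt (\int[mu]_x v x ^+ 2).
  by move=> su sv; apply: le_trans (Rintegral_cauchy_schwarz su sv); exact: ler_norm.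
apply: (@le_trans _ _ (\int[mu]_x (`|kap x| * h x ^+ 2 * b x ^+ 2
   + (2 * (`|B x * b x| * `|r x|) + K * (`|h x * b x| * `|r x|)) + K * r x ^+ 2))).
  apply: normr_Rintegral_le.
  - apply: measurable_funB; last exact: integrable_EFin_measurable j2.
    apply: measurable_funM => //; apply: measurable_funB.
      exact: integrable_EFin_measurable j4.
    exact: integrable_EFin_measurable j3.
  - by do ![apply: integrable_EFinD|apply: integrable_EFinZl] => //; exact: sr.2.
  - move=> x.
    have -> : t ^- 2 * (kap x * a x ^+ 2 - kap x * b x ^+ 2) - t^-1 * kap x * h x * b x ^+ 2 =
       kap x * h x ^+ 2 * b x ^+ 2 / 4 + (2 * (t^-1 * kap x) * (b x * r x)
         + kap x * (h x * b x * r x)) + kap x * r x ^+ 2.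
      rewrite -(subrK (b x) (a x)) aE; field; by rewrite gt_eqF.
    have kB' : `|t^-1 * kap x| <= `|B x|.
      by rewrite normrM ger0_norm ?invr_ge0 ?(ltW t0)// mulrC ler_pdivrMr// mulrC.
    apply: le_trans (ler_normD _ _) _; apply: lerD; last first.
      by rewrite normrM (ger0_norm (sqr_ge0 _)) ler_wpM2r ?sqr_ge0.
    apply: le_trans (ler_normD _ _) _; apply: lerD.
      rewrite 3!normrM (@ger0_norm _ 4^-1)// 2!(ger0_norm (sqr_ge0 _)).
      rewrite ler_piMr//; last by lra.
      by apply: mulr_ge0; [apply: mulr_ge0 => //|]; exact: sqr_ge0.
    apply: le_trans (ler_normD _ _) _; apply: lerD.
      rewrite (_ : 2 * _ * _ = 2 * (t^-1 * kap x * b x * r x)); last by ring.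
      rewrite normrM (@ger0_norm _ 2)// ler_wpM2l// normrM ler_wpM2r//.
      by rewrite normrM [leRHS]normrM ler_wpM2r.
    by rewrite normrM (normrM (_ * _) (r x)) ler_wpM2r// mulr_ge0.
rewrite RintegralD//; [|by do ![apply: integrable_EFinD|apply: integrable_EFinZl]|by apply: integrable_EFinZl; exact: sr.2].
rewrite RintegralD//; [|by do ![apply: integrable_EFinD|apply: integrable_EFinZl]].
rewrite RintegralD//; [|by apply: integrable_EFinZl|by apply: integrable_EFinZl].
rewrite !RintegralZl//; [|exact: sr.2].
rewrite -rhoE lerD2r lerD2l [leRHS]mulrDl -!mulrA.
have E (u : T -> R) : \int[mu]_x `|u x| ^+ 2 = \int[mu]_x u x ^+ 2.
  by apply: eq_Rintegral => x _; rewrite real_normK ?num_real.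
have EP (u : T -> R) : square_integrable P u ->
    \int[mu]_x (u x * b x) ^+ 2 = \int[P]_x u x ^+ 2.
  by move=> su; rewrite (PE su.2); apply: eq_Rintegral => x _; rewrite exprMn.
apply: lerD; rewrite ler_wpM2l//.
  by have := cs _ _ sBb sr'; rewrite !E (EP _ sB).
by have := cs _ _ shb' sr'; rewrite !E (EP _ sh).
Qed.

(** The part of dQ/dP on which the root densities have ratio at most [2]: the full ratio may fail to
    be in L_2(P). Where [b x = 0] the test forces [a x = 0], and the value is [0]. *)
Definition likelihood_ratio (x : T) : R :=
  if a x <= 2 * b x then (a x * (b x)^-1) ^+ 2 else 0.

Definition large_ratio : set T := [set x | 2 * b x < a x].

Lemma measurable_large_ratio : measurable large_ratio.
Proof.
have : measurable_fun setT (fun x => 2 * b x < a x).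
  by apply: measurable_fun_ltr => //; exact: measurable_funM.
move=> /(_ measurableT [set true]); rewrite setTI; exact.
Qed.

Lemma measurable_likelihood_ratio : measurable_fun setT likelihood_ratio.
Proof.
apply: measurable_fun_ifT => //.
  by apply: measurable_fun_ler => //; exact: measurable_funM.
apply: measurable_funX; apply: measurable_funM => //.
exact: (measurableT_comp (@measurable_invr R)).
Qed.

Lemma likelihood_ratio_ge0 x : 0 <= likelihood_ratio x.
Proof. by rewrite /likelihood_ratio; case: ifP => // _; exact: sqr_ge0. Qed.

Let ratioE x : likelihood_ratio x * b x ^+ 2 = if a x <= 2 * b x then a x ^+ 2 else 0.
Proof.
rewrite /likelihood_ratio; case: ifPn => [ab|_]; last by rewrite mul0r.
have [b00|b00] := eqVneq (b x) 0.
  rewrite b00 invr0 mulr0 expr0n/= mul0r.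
  have /eqP -> : a x == 0 by rewrite eq_le a0 andbT; rewrite b00 mulr0 in ab.
  by rewrite expr0n.
by rewrite -exprMn divfK.
Qed.

Lemma likelihood_ratio_le4 x : likelihood_ratio x <= 4.
Proof.
rewrite /likelihood_ratio; case: ifPn => // ab.
have [b00|b00] := eqVneq (b x) 0; first by rewrite b00 invr0 mulr0 expr0n.
have bpos : 0 < b x by rewrite lt_neqAle eq_sym b00 b0.
have -> : 4 = 2 ^+ 2 :> R by rewrite -natrX.
by rewrite lerXn2r ?nnegrE ?mulr_ge0 ?invr_ge0// ler_pdivrMr.
Qed.

Let sratio : square_integrable P likelihood_ratio.
Proof.
split; first exact: measurable_likelihood_ratio.
apply: (@integrable_bounded _ _ _ P _ (4 ^+ 2)).
  exact/measurable_funX/measurable_likelihood_ratio.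
move=> x; rewrite normrX lerXn2r ?nnegrE//.
by rewrite ger0_norm ?likelihood_ratio_ge0// likelihood_ratio_le4.
Qed.

Let ratio_int : P.-integrable setT (EFin \o likelihood_ratio).
Proof.
have := square_integrableM sratio (s1 P).
by under eq_fun do rewrite mulr1.
Qed.

Let mass (M : probability T R) : M `<< mu -> \int[mu]_x sqrt_density Q P M x ^+ 2 = 1.
Proof.
move=> Mmu; rewrite -[RHS](Rintegral_prob_cst M 1) (Rintegral_sqrt_density Mmu).
  by apply: eq_Rintegral => x _; rewrite mul1r.
exact: finite_measure_integrable_cst.
Qed.

(** An upper bound for the squared Hellinger integral of [(a - b)^2] divided by [t^2], from
    [(u + v)^2 <= 2 u^2 + 2 v^2]. *)
Let H2 : R := \int[P]_x h x ^+ 2 / 2 + 2 * rho.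

Let int_shb : mu.-integrable setT (EFin \o (fun x => 2^-1 * (h x * b x) ^+ 2)).
Proof. exact: (integrable_EFinZl _ shb.2). Qed.

Let int_sr : mu.-integrable setT (EFin \o (fun x => 2 * r x ^+ 2)).
Proof. exact: (integrable_EFinZl _ sr.2). Qed.

Let H2E : H2 = \int[mu]_x (2^-1 * (h x * b x) ^+ 2 + 2 * r x ^+ 2).
Proof.
rewrite RintegralD//.
rewrite (RintegralZl _ measurableT shb.2) (RintegralZl _ measurableT sr.2).
rewrite /H2 rhoE (PE sh.2) mulrC; congr (_ * _ + _).
by apply: eq_Rintegral => x _; rewrite exprMn.
Qed.

Let int_H2 : mu.-integrable setT
  (EFin \o (fun x => 2^-1 * (h x * b x) ^+ 2 + 2 * r x ^+ 2)).
Proof. exact: integrable_EFinD. Qed.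

Let ab_le x : (a x - b x) ^+ 2 <= t ^+ 2 * (2^-1 * (h x * b x) ^+ 2 + 2 * r x ^+ 2).
Proof.
rewrite aE exprMn ler_wpM2l ?sqr_ge0//.
by have := sqr_ge0 (2^-1 * (h x * b x) - r x); lra.
Qed.

Let hellinger : \int[mu]_x (a x - b x) ^+ 2 <= t ^+ 2 * H2.
Proof.
rewrite H2E -RintegralZl//; apply: le_Rintegral => //.
- exact: (square_integrableB sa sb).2.
- exact: integrable_EFinZl.
Qed.

Lemma likelihood_ratio_mean : \int[P]_x likelihood_ratio x <= 1.
Proof.
rewrite (PE ratio_int) -(mass Qmu); apply: le_Rintegral => //.
- exact: Pi.
- exact: sa.2.
- by move=> x _; rewrite ratioE; case: ifP => // _; exact: sqr_ge0.
Qed.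

(** For a root ratio [s <= 2], [s^4 = 1 + 2 (s^2 - 1) + (s - 1)^2 (s + 1)^2] and [(s + 1)^2 <= 9].
    The middle term integrates to [0] because [Q] and [P] both have mass [1], so the excess over [1]
    is of second order in [a - b]. *)
Lemma likelihood_ratio_sqr : \int[P]_x likelihood_ratio x ^+ 2 <= 1 + 9 * t ^+ 2 * H2.
Proof.
have iab := (square_integrableB sa sb).2.
have i2 : mu.-integrable setT (EFin \o (fun x => 2 * (a x ^+ 2 - b x ^+ 2))).
  by apply: integrable_EFinZl; apply: integrable_EFinB; [exact: sa.2|exact: sb.2].
have i9 : mu.-integrable setT (EFin \o (fun x => 9 * (a x - b x) ^+ 2)).
  exact: (integrable_EFinZl _ iab).
apply: (@le_trans _ _ (\int[mu]_x (b x ^+ 2 + 2 * (a x ^+ 2 - b x ^+ 2)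
    + 9 * (a x - b x) ^+ 2))).
  rewrite (PE sratio.2); apply: le_Rintegral => //.
  - exact: (Pi sratio.2).
  - by apply: integrable_EFinD => //; apply: integrable_EFinD => //; exact: sb.2.
  - move=> x _; rewrite expr2 -mulrA ratioE.
    case: ifPn => [ab|]; last first.
      rewrite -ltNge mulr0 => ab.
      have := sqr_ge0 (a x - b x); have := b0 x; have := a0 x; nra.
    rewrite /likelihood_ratio ab.
    have [b00|b00] := eqVneq (b x) 0.
      rewrite b00 invr0 mulr0 expr0n/= mul0r.
      have := sqr_ge0 (a x); rewrite !subr0; lra.
    have bpos : 0 < b x by rewrite lt_neqAle eq_sym b00 b0.
    set s := a x * (b x)^-1.
    have -> : a x = s * b x by rewrite divfK.
    have s0 : 0 <= s by rewrite mulr_ge0// invr_ge0.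
    have s2 : s <= 2 by rewrite ler_pdivrMr.
    rewrite (_ : b x ^+ 2 + _ + _ = (1 + 2 * (s ^+ 2 - 1) + 9 * (s - 1) ^+ 2) * b x ^+ 2); last by ring.
    clearbody s; rewrite exprMn mulrA ler_wpM2r ?sqr_ge0//.
    rewrite -subr_ge0 (_ : _ - _ = (s - 1) ^+ 2 * (9 - (s + 1) ^+ 2)); last by ring.
    by rewrite mulr_ge0 ?sqr_ge0//; nra.
rewrite RintegralD//; last by apply: integrable_EFinD => //; exact: sb.2.
rewrite RintegralD//; last exact: sb.2.
rewrite (RintegralZl _ measurableT iab) RintegralZl//; last first.
  by apply: integrable_EFinB; [exact: sa.2|exact: sb.2].
rewrite RintegralB//; [|exact: sa.2|exact: sb.2].
rewrite (mass Qmu) (mass Pmu) subrr mulr0 addr0 lerD2l -mulrA ler_wpM2l//.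
Qed.

Let ind : T -> R := \1_large_ratio.

Let mind : measurable_fun setT ind.
Proof. exact: measurable_indic measurable_large_ratio. Qed.

Let indE x : ind x = if a x <= 2 * b x then 0 else 1.
Proof.
rewrite /ind indicE; case: leP => ab; last by rewrite mem_set.
by rewrite memNset// /large_ratio/= => /lt_geF; rewrite ab.
Qed.

(** Where [a > 2 b], one has [a <= 2 (a - b)], hence [a^2 <= 4 (a - b)^2 <= t^2 (2 h^2 b^2 + 8
    r^2)]. Keeping [h^2] restricted to the exceptional set is what makes the loss [o(t^2)] and not
    merely [O(t^2)]. *)
Lemma likelihood_ratio_missing (u : T -> R) : measurable_fun setT u ->
  (forall x, 0 <= u x <= 1) ->
  \int[Q]_x u x <= \int[P]_x (likelihood_ratio x * u x)
    + t ^+ 2 * (2 * \int[P]_(x in large_ratio) `|h x ^+ 2| + 8 * rho).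
Proof.
move=> mu_ u01.
have uQ : Q.-integrable setT (EFin \o u).
  apply: (@integrable_bounded _ _ _ Q _ 1) => // x.
  by have /andP[u0 u1] := u01 x; rewrite ger0_norm.
have uP : P.-integrable setT (EFin \o (fun x => likelihood_ratio x * u x)).
  apply: (@integrable_bounded _ _ _ P _ 4).
    by apply: measurable_funM => //; exact: measurable_likelihood_ratio.
  move=> x; have /andP[u0 u1] := u01 x; rewrite normrM !ger0_norm ?likelihood_ratio_ge0//.
  by rewrite -[leRHS]mulr1 ler_pM ?likelihood_ratio_ge0 ?likelihood_ratio_le4.
have ih : P.-integrable setT (EFin \o (fun x => h x ^+ 2 * ind x)).
  apply: (integrable_dominated _ sh.2) => [|x].
    by apply: measurable_funM => //; apply: measurable_funX; exact: sh.1.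
  rewrite indE; case: ifP => _; first by rewrite mulr0 normr0 sqr_ge0.
  by rewrite mulr1 ger0_norm ?sqr_ge0.
have -> : \int[P]_(x in large_ratio) `|h x ^+ 2| = \int[P]_x (h x ^+ 2 * ind x).
  rewrite Rintegral_mkcond; apply: eq_Rintegral => x _.
  rewrite patchE /ind indicE; case: (_ \in _); last by rewrite mulr0.
  by rewrite mulr1 ger0_norm ?sqr_ge0.
rewrite (QE uQ) (PE uP) (PE ih) rhoE.
have e1 := integrable_EFinZl 2 (Pi ih); have e2 := integrable_EFinZl 8 sr.2.
rewrite -(RintegralZl _ measurableT (Pi ih)) -(RintegralZl _ measurableT sr.2).
rewrite -RintegralD// -RintegralZl//; last exact: integrable_EFinD.
rewrite -RintegralD//; [|exact: Pi|by apply: integrable_EFinZl; exact: integrable_EFinD].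
apply: le_Rintegral => //; first exact: Qi.
  apply: integrable_EFinD; first exact: Pi.
  by apply: integrable_EFinZl; exact: integrable_EFinD.
move=> x _; have /andP[u0 u1] := u01 x.
rewrite mulrAC ratioE indE; case: ifPn => [_|].
  rewrite mulr0 mul0r mulr0 add0r mulrC lerDl.
  by rewrite mulr_ge0 ?sqr_ge0// mulr_ge0// sqr_ge0.
rewrite -ltNge mul0r add0r mulr1 => ab.
have := ab_le x; rewrite exprMn.
have := sqr_ge0 (a x); have := b0 x; have := a0 x.
set A := t ^+ 2 * _ => a0' b0' a2 abA.
have -> : t ^+ 2 * (2 * (h x ^+ 2 * b x ^+ 2) + 8 * r x ^+ 2) = 4 * A by rewrite /A; field.
apply: (@le_trans _ _ (a x ^+ 2)); first by rewrite ler_piMl.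
nra.
Qed.

(** On this set [b < a - b], so its P-mass is at most the Hellinger integral. *)
Lemma large_ratio_prob : fine (P large_ratio) <= t ^+ 2 * H2.
Proof.
apply: le_trans hellinger; rewrite -Rintegral_indic; last exact: measurable_large_ratio.
have iP : P.-integrable setT (EFin \o ind).
  apply: (@integrable_bounded _ _ _ P _ 1) => // x.
  by rewrite indE; case: ifP => _; rewrite ?normr0 ?normr1.
rewrite (PE iP); apply: le_Rintegral => //; first exact: Pi.
  exact: (square_integrableB sa sb).2.
move=> x _; rewrite indE; case: ifPn => [_|]; first by rewrite mul0r sqr_ge0.
rewrite -ltNge mul1r => ab; have := b0 x; nra.
Qed.

End dqm_step.

(** * Taylor bounds for sine and cosine *)

Section trigonometric_bounds.
Context {R : realType}.
Implicit Types x y : R.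

(** By the mean value theorem. Starting from [cos <= 1], each Taylor bound below makes the
    derivative in the next one nonnegative. *)
Lemma nonneg_is_derive (f df : R -> R) : (forall x, is_derive x 1 f (df x)) ->
  f 0 = 0 -> (forall x, 0 <= x -> 0 <= df x) -> forall x, 0 <= x -> 0 <= f x.
Proof.
move=> fdf f0 df0 x; rewrite le_eqVlt => /predU1P[<-|x0]; first by rewrite f0.
have [c] := MVT x0 (fun y _ => fdf y)
  (continuous_subspaceT (continuous_is_derive fdf)).
rewrite f0 !subr0 in_itv/= => /andP[c0 _] ->.
by rewrite mulr_ge0 ?df0// ltW.
Qed.

Lemma sin_le_id x : 0 <= x -> sin x <= x.
Proof.
move=> x0; have fdf y : is_derive y 1 (fun y : R => y - sin y) (1 - cos y).
  exact: trigger_derive.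
rewrite -subr_ge0; apply: (nonneg_is_derive fdf) => //; by rewrite sin0 subr0.
Qed.

Lemma cos_ge_quad_pos x : 0 <= x -> 1 - x ^+ 2 / 2 <= cos x.
Proof.
move=> x0; have fdf y : is_derive y 1 (fun y : R => cos y - (1 - y ^+ 2 / 2)) (y - sin y).
  by apply: trigger_derive; rewrite /GRing.scale/=; field.
rewrite -subr_ge0; apply: (nonneg_is_derive fdf) => //; first by rewrite cos0; field.
by move=> y y0; rewrite subr_ge0 sin_le_id.
Qed.

Lemma sin_ge_cubic x : 0 <= x -> x - x ^+ 3 / 6 <= sin x.
Proof.
move=> x0; have fdf y : is_derive y 1 (fun y : R => sin y - (y - y ^+ 3 / 6)) (cos y - (1 - y ^+ 2 / 2)).
  by apply: trigger_derive; rewrite /GRing.scale/=; field.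
rewrite -subr_ge0; apply: (nonneg_is_derive fdf) => //; first by rewrite sin0; field.
by move=> y y0; rewrite subr_ge0 cos_ge_quad_pos.
Qed.

Lemma cos_le_quartic_pos x : 0 <= x -> cos x <= 1 - x ^+ 2 / 2 + x ^+ 4 / 24.
Proof.
move=> x0; have fdf y : is_derive y 1 (fun y : R => 1 - y ^+ 2 / 2 + y ^+ 4 / 24 - cos y) (sin y - (y - y ^+ 3 / 6)).
  by apply: trigger_derive; rewrite /GRing.scale/=; field.
rewrite -subr_ge0; apply: (nonneg_is_derive fdf) => //; first by rewrite cos0; field.
by move=> y y0; rewrite subr_ge0 sin_ge_cubic.
Qed.

Lemma cos_norm x : cos `|x| = cos x.
Proof. by case: (ger0P x) => // _; rewrite cosN. Qed.

Lemma normr_sin x : `|sin x| = `|sin `|x| |.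
Proof. by case: (ger0P x) => // _; rewrite sinN normrN. Qed.

Lemma normr_sin_le x : `|sin x| <= `|x|.
Proof.
rewrite normr_sin; have := normr_ge0 x; move: `|x| => y y0.
rewrite ler_norml sin_le_id// andbT.
have [y1|y1] := leP y 1; last by rewrite (le_trans _ (sin_geN1 y))// lerN2 ltW.
have := sin_ge_cubic y0; nra.
Qed.

Lemma cosB1_bounds x : - (x ^+ 2 / 2) <= cos x - 1 <= 0.
Proof.
rewrite -cos_norm -(real_normK (num_real x)).
by have := cos_ge_quad_pos (normr_ge0 x); have := cos_le1 `|x|; lra.
Qed.

Lemma normr_cosB1_quad x : `|cos x - 1| <= x ^+ 2 / 2.
Proof. by have := cosB1_bounds x; rewrite ler_norml; have := sqr_ge0 x; lra. Qed.

Lemma normr_cosB1_le x : `|cos x - 1| <= `|x|.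
Proof.
have /andP[h1 h2] := cosB1_bounds x; have h3 := cos_geN1 x.
rewrite -(real_normK (num_real x)) in h1.
have y0 := normr_ge0 x; move: `|x| y0 h1 => y y0 h1.
rewrite ler_norml; apply/andP; split; last by lra.
by have [y2|y2] := leP y 2; [nra|lra].
Qed.

Lemma normr_sinB_cubic x : `|sin x - x| <= `|x| ^+ 3.
Proof.
have -> : `|sin x - x| = `|sin `|x| - `|x| |.
  by case: (ger0P x) => // _; rewrite sinN -opprD normrN.
have := normr_ge0 x; move: `|x| => y y0.
have := sin_ge_cubic y0; have := sin_le_id y0; rewrite ler_norml.
have : 0 <= y ^+ 3 by rewrite exprn_ge0. 
lra.
Qed.

(** The cubic bound gives pointwise limits, but [phi] has only two moments; this quadratic one,
    valid for all [x], supplies the integrable majorant. *)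
Lemma normr_sinB_quad x : `|sin x - x| <= x ^+ 2.
Proof.
have -> : `|sin x - x| = `|sin `|x| - `|x| |.
  by case: (ger0P x) => // _; rewrite sinN -opprD normrN.
rewrite -(real_normK (num_real x)).
have := normr_ge0 x; move: `|x| => y y0.
have h1 := sin_ge_cubic y0; have h2 := sin_le_id y0; have h3 := sin_geN1 y.
rewrite ler_norml; apply/andP; split; last by nra.
by have [y2|y2] := leP y 2; nra.
Qed.

Lemma normr_cosB_quartic x : `|cos x - 1 + x ^+ 2 / 2| <= x ^+ 4.
Proof.
rewrite -cos_norm -(real_normK (num_real x)) (_ : x ^+ 4 = `|x| ^+ 4); last first.
  by rewrite -normrX ger0_norm// exprn_even_ge0.
have := normr_ge0 x; move: `|x| => y y0.
have := cos_le_quartic_pos y0; have := cos_ge_quad_pos y0.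
have : 0 <= y ^+ 4 by rewrite exprn_ge0.
rewrite ler_norml; lra.
Qed.

End trigonometric_bounds.

(** * The scale n^{-1/2} of local alternatives *)

Section root_rate.
Context {R : realType}.

(** Since [0^-1 = 0], the value at [n = 0] is [0], and [rateV2] and [rate2] hold for every [n]. *)
Definition rate (n : nat) : R := (Num.sqrt n%:R)^-1.

Lemma rate_ge0 n : 0 <= rate n.
Proof. by rewrite invr_ge0 sqrtr_ge0. Qed.

Lemma rate_gt0 n : (0 < n)%N -> 0 < rate n.
Proof. by move=> n0; rewrite invr_gt0 sqrtr_gt0 ltr0n. Qed.

Lemma rateV2 n : rate n ^- 2 = n%:R.
Proof. by rewrite /rate exprVn invrK sqr_sqrtr. Qed.

Lemma rate2 n : rate n ^+ 2 = n%:R^-1.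
Proof. by rewrite -rateV2 invrK. Qed.

Lemma cvg_rate2 : rate n ^+ 2 @[n --> \oo] --> (0 : R).
Proof.
under eq_fun do rewrite rate2; apply/gtr0_cvgV0; last first.
  by apply/cvgryPge => A; near=> n; near: n; exact: nbhs_infty_ger.
by near=> n; rewrite ltr0n; near: n; exact: nbhs_infty_gt.
Unshelve. all: end_near. Qed.

Lemma cvg_rate : rate n @[n --> \oo] --> (0 : R).
Proof.
have E : Num.sqrt \o (fun n => rate n ^+ 2) = rate.
  by apply/funext => n /=; rewrite sqrtr_sqr ger0_norm ?rate_ge0.
rewrite -E -[X in _ --> X](@sqrtr0 R).
exact: (continuous_cvg _ (@sqrt_continuous R 0) cvg_rate2).
Qed.

End root_rate.

Section dqm_sequence.
Context (d : measure_display) (T : measurableType d) (R : realType).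
Variables (Q : nat -> probability T R) (P : probability T R) (h : T -> R).
Hypothesis sh : square_integrable P h.
Local Notation t := (@rate R).
Local Notation rho n := (fine (dqm_remainder (Q n) P h (t n))).
Hypothesis rho0 : rho n @[n --> \oo] --> (0 : R).

(** In the bound of [dqm_mean] the terms with [rho n] vanish, and so does the integral of
    [|kap n| h^2], dominated by [K h^2]. What remains is the mean under [P] plus the cross term,
    whose integrand is dominated by [|B| |h|]. *)
Lemma dqm_mean_cvg (kap : nat -> T -> R) (B beta : T -> R) (K alpha : R) :
  (forall n, measurable_fun setT (kap n)) -> (forall n x, `|kap n x| <= K) ->
  square_integrable P B -> (forall n x, `|kap n x| <= t n * `|B x|) ->
  (forall x, (t n)^-1 * kap n x @[n --> \oo] --> beta x) ->
  t n ^- 2 * \int[P]_x kap n x @[n --> \oo] --> alpha ->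
  t n ^- 2 * \int[Q n]_x kap n x @[n --> \oo] --> alpha + \int[P]_x (beta x * h x).
Proof.
move=> mk kK sB kB kbeta kalpha.
have K0 : 0 <= K by exact: le_trans (kK 0 point).
have kB' n x : `|(t n)^-1 * kap n x| <= `|B x|.
  have [->|n0] := posnP n; first by rewrite /rate sqrtr0 invr0 invr0 mul0r normr0.
  rewrite normrM ger0_norm ?invr_ge0 ?rate_ge0// mulrC ler_pdivrMr ?rate_gt0//.
  by rewrite mulrC.
have c1 : \int[P]_x ((t n)^-1 * kap n x * h x) @[n --> \oo] --> \int[P]_x (beta x * h x).
  apply: (Rdominated_cvg (g := fun x => `|B x| * `|h x|)).
  - by move=> n; apply: measurable_funM; [exact: measurable_funM|exact: sh.1].
  - by move=> x; apply: cvgM; [exact: kbeta|exact: cvg_cst].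
  - by apply: square_integrableM; exact: square_integrable_norm.
  - by move=> n x; rewrite normrM ler_wpM2r.
have c2 : \int[P]_x (`|kap n x| * h x ^+ 2) @[n --> \oo] --> (0 : R).
  rewrite (_ : 0 = \int[P]_x (0 : R)); last by rewrite Rintegral_prob_cst.
  apply: (Rdominated_cvg (g := fun x => K * h x ^+ 2)).
  - move=> n; apply: measurable_funM; first exact: measurableT_comp.
    by apply: measurable_funX; exact: sh.1.
  - move=> x; rewrite -[0](mul0r (h x ^+ 2)); apply: cvgM; last exact: cvg_cst.
    apply: (squeeze_cvgr (f := cst 0) (h := fun n => t n * `|B x|)).
    + by apply: nearW => n; rewrite normr_ge0 kB.
    + exact: cvg_cst.
    + by rewrite -[0](mul0r `|B x|); apply: cvgM; [exact: cvg_rate|exact: cvg_cst].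
  - by apply: integrable_EFinZl; exact: sh.2.
  - by move=> n x; rewrite normrM normr_id (ger0_norm (sqr_ge0 _)) ler_wpM2r ?sqr_ge0.
have c3 : t n ^- 2 * (\int[Q n]_x kap n x - \int[P]_x kap n x)
    - \int[P]_x ((t n)^-1 * kap n x * h x) @[n --> \oo] --> (0 : R).
  apply: norm_cvg0; pose C := 2 * Num.sqrt (\int[P]_x B x ^+ 2)
    + K * Num.sqrt (\int[P]_x h x ^+ 2).
  apply: (squeeze_cvgr (f := cst 0) (h := fun n => \int[P]_x (`|kap n x| * h x ^+ 2)
     + C * Num.sqrt (rho n) + K * rho n)).
  - near=> n; rewrite normr_ge0/= dqm_mean//.
    by apply: rate_gt0; near: n; exact: nbhs_infty_gt.
  - exact: cvg_cst.
  - rewrite (_ : 0 = 0 + C * Num.sqrt 0 + K * 0); last by rewrite sqrtr0 !mulr0 !addr0.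
    apply: cvgD; last by apply: cvgM; [exact: cvg_cst|exact: rho0].
    apply: cvgD; first exact: c2.
    apply: cvgM; first exact: cvg_cst.
    exact: (continuous_cvg _ (@sqrt_continuous R 0) rho0).
have E : (fun n => t n ^- 2 * \int[Q n]_x kap n x) = (fun n =>
    t n ^- 2 * (\int[Q n]_x kap n x - \int[P]_x kap n x)
    - \int[P]_x ((t n)^-1 * kap n x * h x) + t n ^- 2 * \int[P]_x kap n x
    + \int[P]_x ((t n)^-1 * kap n x * h x)).
  by apply/funext => n; rewrite [RHS]addrAC subrK mulrBr subrK.
by rewrite E -[alpha]add0r; apply: cvgD c1; exact: cvgD c3 kalpha.
Unshelve. all: end_near. Qed.

(* The likelihood ratio truncated at [4] has second moment [1 + O(1/n)]. *)
Lemma dqm_contiguous (A : forall n, set (n.-tuple T)) :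
  (forall n, measurable (A n)) ->
  prod_prob P n (A n) @[n --> \oo] --> 0%E ->
  fine (prod_prob (Q n) n (A n)) @[n --> \oo] --> (0 : R).
Proof.
move=> mA PA.
have PA' : fine (prod_prob P n (A n)) @[n --> \oo] --> (0 : R) by exact: fine_cvg PA.
pose S := \int[P]_x h x ^+ 2.
have S0 : 0 <= S by apply: Rintegral_ge0 => x _; exact: sqr_ge0.
have rho_ge0 n : 0 <= rho n.
  by apply: Rintegral_ge0 => x _; exact: sqr_ge0.
pose G n := large_ratio (Q n) P.
have mG n : measurable (G n) by exact: measurable_large_ratio.
have PG : fine (P (G n)) @[n --> \oo] --> (0 : R).
  apply: (squeeze_cvgr (f := cst 0) (h := fun n => t n ^+ 2 * (S / 2 + 2 * rho n))).
  - near=> n; rewrite fine_ge0//=; apply: large_ratio_prob => //.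
    by apply: rate_gt0; near: n; exact: nbhs_infty_gt.
  - exact: cvg_cst.
  - rewrite -[0](mul0r (S / 2 + 2 * 0)); apply: cvgM; first exact: cvg_rate2.
    apply: cvgD; first exact: cvg_cst.
    by apply: cvgM; [exact: cvg_cst|exact: rho0].
(* Absolute continuity of the integral of [h^2]: the sets [G n] have vanishing P-probability. *)
have hG : \int[P]_(x in G n) `|h x ^+ 2| @[n --> \oo] --> (0 : R).
  apply/cvgrPdist_lt => e e0.
  have [del [del0 Hdel]] := integral_normr_continuous sh.2 e0.
  have /cvgrPdist_lt /(_ del del0) := PG; apply: filterS => n.
  rewrite sub0r normrN ger0_norm ?fine_ge0// => Gn.
  rewrite sub0r normrN ger0_norm; last by apply: Rintegral_ge0.
  by apply: Hdel => //; rewrite -[X in (X < _)%E]fineK ?fin_num_measure// lte_fin.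
(* Bounds [S / 2 + 2 * rho n] as soon as [rho n < 1]. *)
pose C := S / 2 + 2.
have C0 : 0 <= C by rewrite addr_ge0// divr_ge0.
apply: (squeeze_cvgr (f := cst 0) (h := fun n =>
  Num.sqrt (expR (9 * C) * fine (prod_prob P n (A n)))
  + (2 * \int[P]_(x in G n) `|h x ^+ 2| + 8 * rho n))).
- near=> n; rewrite fine_ge0//=.
  have n0 : (0 < n)%N by near: n; exact: nbhs_infty_gt.
  have tn : 0 < t n by exact: rate_gt0.
  have r1 : rho n < 1.
    have : `|0 - rho n| < 1 by near: n; exact: (cvgrPdist_lt _ _).1 rho0 _ ltr01.
    by rewrite sub0r normrN ger0_norm.
  set e := t n ^+ 2 * (2 * \int[P]_(x in G n) `|h x ^+ 2| + 8 * rho n).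
  have e0 : 0 <= e.
    rewrite mulr_ge0 ?sqr_ge0// addr_ge0// mulr_ge0//.
    exact: Rintegral_ge0.
  set c := 1 + 9 * t n ^+ 2 * (S / 2 + 2 * rho n).
  have sk : square_integrable P (likelihood_ratio (Q n) P).
    split; first exact: measurable_likelihood_ratio.
    apply: (@integrable_bounded _ _ _ P _ (4 ^+ 2)).
      by apply: measurable_funX; exact: measurable_likelihood_ratio.
    move=> x; rewrite normrX lerXn2r ?nnegrE//.
    by rewrite ger0_norm ?likelihood_ratio_ge0// likelihood_ratio_le4.
  have := @prod_prob_contiguity _ _ _ P (Q n) _ c e sk (likelihood_ratio_ge0 _ _)
    e0 (likelihood_ratio_mean _ _) (likelihood_ratio_sqr (Q n) sh tn)
    (likelihood_ratio_missing (Q n) sh tn) n (A n) (mA n).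
  have nt : n%:R * t n ^+ 2 = 1 by rewrite rate2 divff// pnatr_eq0 -lt0n.
  have c0 : 0 <= c.
    apply: addr_ge0 => //; apply: mulr_ge0; first by apply: mulr_ge0 => //; exact: sqr_ge0.
    by apply: addr_ge0; [exact: divr_ge0|exact: mulr_ge0].
  (* Because [n t_n^2 = 1], the [n]-th power of this bound is the constant [expR (9 * C)]. *)
  have cE : c <= expR (9 * C * t n ^+ 2).
    apply: le_trans (expR_ge1Dx _); rewrite lerD2l mulrAC ler_wpM2r ?sqr_ge0//.
    by rewrite ler_wpM2l// /C lerD2l; move: r1; lra.
  have cn : c ^+ n <= expR (9 * C).
    rewrite -[X in expR X]mulr1 -[X in expR (_ * X)]nt mulrCA expRM_natl.
    by rewrite lerXn2r ?nnegrE ?expR_ge0.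
  move=> /le_trans; apply; apply: lerD.
    by rewrite ler_wsqrtr// ler_wpM2r ?fine_ge0.
  by rewrite /e mulrA nt mul1r.
- exact: cvg_cst.
- rewrite [X in _ --> X](_ : 0 = Num.sqrt (expR (9 * C) * 0) + (2 * 0 + 8 * 0)); last first.
    by rewrite !mulr0 sqrtr0 !addr0.
  apply: cvgD.
    apply: (continuous_cvg _ (@sqrt_continuous R _)).
    by apply: cvgM; [exact: cvg_cst|exact: PA'].
  by apply: cvgD; apply: cvgM; [exact: cvg_cst|exact: hG|exact: cvg_cst|exact: rho0].
Unshelve. all: end_near. Qed.

End dqm_sequence.

Section rate_limits.
Context {R : realType}.
Local Notation t := (@rate R).

Lemma cvg_near_le (u v : nat -> R) (l : R) :
  (\forall n \near \oo, `|u n - l| <= v n) -> v n @[n --> \oo] --> (0 : R) ->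
  u n @[n --> \oo] --> l.
Proof.
move=> uv /cvgrPdist_le v0; apply/cvgrPdist_le => e e0.
apply: filterS2 uv (v0 e e0) => n uvn; rewrite sub0r normrN distrC.
by apply: le_trans; apply: le_trans uvn (ler_norm _).
Qed.

Let n_gt0 : \forall n \near \oo, (0 < n)%N.
Proof. by near=> n; near: n; exact: nbhs_infty_gt. Unshelve. all: end_near. Qed.

Let cvg_rateZ (c : R) : t n * c @[n --> \oo] --> (0 : R).
Proof. by rewrite -[X in _ --> X](mul0r c); apply: cvgM; [exact: cvg_rate|exact: cvg_cst]. Qed.

Let cvg_rate2Z (c : R) : t n ^+ 2 * c @[n --> \oo] --> (0 : R).
Proof. by rewrite -[X in _ --> X](mul0r c); apply: cvgM; [exact: cvg_rate2|exact: cvg_cst]. Qed.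

Lemma cvg_rateV_cosB1 (y : R) : (t n)^-1 * (cos (t n * y) - 1) @[n --> \oo] --> (0 : R).
Proof.
apply: (cvg_near_le _ (cvg_rateZ (y ^+ 2 / 2))).
apply: filterS n_gt0 => n n0; rewrite subr0 normrM ger0_norm ?invr_ge0 ?rate_ge0//.
rewrite mulrC ler_pdivrMr ?rate_gt0//; apply: le_trans (normr_cosB1_quad _) _.
by rewrite exprMn; have := sqr_ge0 y; lra.
Qed.

Lemma cvg_rateV2_cosB1 (y : R) :
  t n ^- 2 * (cos (t n * y) - 1) @[n --> \oo] --> - (y ^+ 2 / 2).
Proof.
apply: (cvg_near_le _ (cvg_rate2Z (y ^+ 4))).
apply: filterS n_gt0 => n n0; have t0 := rate_gt0 (R := R) n0.
have -> : t n ^- 2 * (cos (t n * y) - 1) - - (y ^+ 2 / 2)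
    = t n ^- 2 * (cos (t n * y) - 1 + (t n * y) ^+ 2 / 2) by field; rewrite gt_eqF.
rewrite normrM ger0_norm ?invr_ge0 ?sqr_ge0// mulrC ler_pdivrMr ?exprn_gt0//.
apply: le_trans (normr_cosB_quartic _) _.
by rewrite (_ : (t n * y) ^+ 4 = t n ^+ 2 * y ^+ 4 * t n ^+ 2)//; ring.
Qed.

Lemma cvg_rateV_sin (y : R) : (t n)^-1 * sin (t n * y) @[n --> \oo] --> y.
Proof.
apply: (cvg_near_le _ (cvg_rate2Z (`|y| ^+ 3))).
apply: filterS n_gt0 => n n0; have t0 := rate_gt0 (R := R) n0.
have -> : (t n)^-1 * sin (t n * y) - y = (t n)^-1 * (sin (t n * y) - t n * y).
  by field; rewrite gt_eqF.
rewrite normrM ger0_norm ?invr_ge0 ?(ltW t0)// mulrC ler_pdivrMr//.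
apply: le_trans (normr_sinB_cubic _) _; rewrite normrM (gtr0_norm t0).
by rewrite (_ : (t n * `|y|) ^+ 3 = t n ^+ 2 * `|y| ^+ 3 * t n)//; ring.
Qed.

Lemma cvg_rateV2_sinB (y : R) :
  t n ^- 2 * (sin (t n * y) - t n * y) @[n --> \oo] --> (0 : R).
Proof.
apply: (cvg_near_le _ (cvg_rateZ (`|y| ^+ 3))).
apply: filterS n_gt0 => n n0; have t0 := rate_gt0 (R := R) n0.
rewrite subr0 normrM ger0_norm ?invr_ge0 ?sqr_ge0// mulrC ler_pdivrMr ?exprn_gt0//.
apply: le_trans (normr_sinB_cubic _) _; rewrite normrM (gtr0_norm t0).
by rewrite (_ : (t n * `|y|) ^+ 3 = t n * `|y| ^+ 3 * t n ^+ 2)//; ring.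
Qed.

Lemma rateV2_sinB_le n (y : R) : `|t n ^- 2 * (sin (t n * y) - t n * y)| <= y ^+ 2.
Proof.
have [->|n0] := posnP n.
  by rewrite /rate sqrtr0 invr0 expr0n invr0 mul0r normr0 sqr_ge0.
have t0 := rate_gt0 (R := R) n0.
rewrite normrM ger0_norm ?invr_ge0 ?sqr_ge0// mulrC ler_pdivrMr ?exprn_gt0//.
by apply: le_trans (normr_sinB_quad _) _; rewrite exprMn mulrC.
Qed.

Lemma rateV2_cosB1_le n (y : R) : `|t n ^- 2 * (cos (t n * y) - 1)| <= y ^+ 2.
Proof.
have [->|n0] := posnP n.
  by rewrite /rate sqrtr0 invr0 expr0n invr0 mul0r normr0 sqr_ge0.
have t0 := rate_gt0 (R := R) n0.
rewrite normrM ger0_norm ?invr_ge0 ?sqr_ge0// mulrC ler_pdivrMr ?exprn_gt0//.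
apply: le_trans (normr_cosB1_quad _) _; rewrite exprMn.
by have := mulr_ge0 (sqr_ge0 (t n)) (sqr_ge0 y); lra.
Qed.

Section normal_factor.
Variables V mu : R.
Hypothesis V0 : 0 <= V.

Lemma cvg_mulrn_expRB1 : n%:R * (expR (- (V / n%:R)) - 1) @[n --> \oo] --> - V.
Proof.
apply: (cvg_near_le _ (cvg_rate2Z (V ^+ 2))).
apply: filterS n_gt0 => n n0; have np : 0 < n%:R :> R by rewrite ltr0n.
rewrite rate2; set x := V / n%:R.
have x0 : 0 <= x by rewrite divr_ge0.
have Vx : V = x * n%:R by rewrite divfK// gt_eqF.
clearbody x.
have e1 := expR_ge1Dx (- x); have e2 := expR_ge1Dx x.
have e0 := expR_gt0 x; have eN : expR (- x) * expR x = 1 by rewrite -expRD addNr expR0.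
have eN0 := expR_gt0 (- x).
have -> : n%:R * (expR (- x) - 1) - - V = n%:R * (expR (- x) - 1 + x) by rewrite Vx; ring.
rewrite normrM gtr0_norm// ger0_norm; last by lra.
rewrite Vx (_ : n%:R^-1 * (x * n%:R) ^+ 2 = n%:R * x ^+ 2); last by field; rewrite gt_eqF.
rewrite ler_wpM2l ?(ltW np)//.
have : expR (- x) * (1 + x) <= 1 by rewrite -[leRHS]eN ler_wpM2l// ltW.
nra.
Qed.

Let inv0 : n%:R^-1 @[n --> \oo] --> (0 : R).
Proof. by under eq_fun do rewrite -rate2; exact: cvg_rate2. Qed.

Let cvg_divn (c : R) : c / n%:R @[n --> \oo] --> (0 : R).
Proof. by rewrite -[X in _ --> X](mulr0 c); apply: cvgM; [exact: cvg_cst|exact: inv0]. Qed.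

(** The limiting phase [expR (- V) * cos (mu + a)] is spread evenly over [n] factors, each with
    decay [V / n] and angle [mu / n]. This limit and the next are the [1/n] terms that one
    observation has to match. *)
Lemma cvg_mulrn_normal_cos :
  n%:R * (expR (- (V / n%:R)) * cos (mu / n%:R) - 1) @[n --> \oo] --> - V.
Proof.
have E : (fun n => n%:R * (expR (- (V / n%:R)) * cos (mu / n%:R) - 1)) = (fun n =>
    n%:R * (expR (- (V / n%:R)) - 1) * cos (mu / n%:R) + n%:R * (cos (mu / n%:R) - 1)).
  by apply/funext => n; ring.
have c1 : n%:R * (expR (- (V / n%:R)) - 1) * cos (mu / n%:R) @[n --> \oo] --> - V * cos 0.
  apply: cvgM; first exact: cvg_mulrn_expRB1.
  by apply: (continuous_cvg _ (@continuous_cos R 0)); exact: cvg_divn.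
rewrite cos0 mulr1 in c1; rewrite E -[- V]addr0; apply: cvgD; first exact: c1.
apply: (cvg_near_le _ (cvg_divn (mu ^+ 2))).
apply: filterS n_gt0 => n n0; have np : 0 < n%:R :> R by rewrite ltr0n.
rewrite subr0 normrM gtr0_norm//.
apply: le_trans (ler_wpM2l (ltW np) (normr_cosB1_quad _)) _.
rewrite (_ : n%:R * _ = mu ^+ 2 / n%:R / 2); last by field; rewrite gt_eqF.
by have := divr_ge0 (sqr_ge0 mu) (ltW np); lra.
Qed.

Lemma cvg_mulrn_normal_sin :
  n%:R * (expR (- (V / n%:R)) * sin (mu / n%:R)) @[n --> \oo] --> mu.
Proof.
have c1 : expR (- (V / n%:R)) @[n --> \oo] --> expR (- 0).
  apply: (continuous_cvg _ (@continuous_expR R (- 0))).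
  by apply: cvgN; exact: cvg_divn.
have c2 : n%:R * sin (mu / n%:R) @[n --> \oo] --> mu.
  apply: (cvg_near_le _ (cvg_divn (`|mu| ^+ 2))).
  apply: filterS n_gt0 => n n0; have np : 0 < n%:R :> R by rewrite ltr0n.
  have -> : n%:R * sin (mu / n%:R) - mu = n%:R * (sin (mu / n%:R) - mu / n%:R).
    by field; rewrite gt_eqF.
  rewrite normrM gtr0_norm//.
  apply: le_trans (ler_wpM2l (ltW np) (normr_sinB_quad _)) _.
  rewrite real_normK ?num_real// le_eqVlt; apply/orP; left; apply/eqP.
  by field; rewrite gt_eqF.
have c3 : expR (- (V / n%:R)) * (n%:R * sin (mu / n%:R)) @[n --> \oo]
    --> expR (- 0) * mu.
  by apply: cvgM.
rewrite oppr0 expR0 mul1r in c3.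
by under eq_fun do rewrite mulrCA.
Qed.

End normal_factor.
End rate_limits.

(** * Central limit theorem along local alternatives *)

Section dqm_clt.
Context (d : measure_display) (T : measurableType d) (R : realType).
Variables (Q : nat -> probability T R) (P : probability T R) (h phi : T -> R).
Hypotheses (sh : square_integrable P h) (sphi : square_integrable P phi).
Hypothesis phi0 : \int[P]_x phi x = 0.
Local Notation t := (@rate R).
Hypothesis rho0 : fine (dqm_remainder (Q n) P h (t n)) @[n --> \oo] --> (0 : R).

Let iphi : P.-integrable setT (EFin \o phi).
Proof.
have s1 : square_integrable P (fun=> 1).
  by split => //; exact: finite_measure_integrable_cst.
by have := square_integrableM sphi s1; under eq_fun do rewrite mulr1.
Qed.

Section fixed_frequency.
Variable s : R.
Local Notation B := (fun x => s * phi x).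
Let V := \int[P]_x (B x ^+ 2 / 2).
Let m := \int[P]_x (B x * h x).

Let sB : square_integrable P B. Proof. exact: square_integrableZ. Qed.

Let mtB n : measurable_fun setT (fun x => t n * B x).
Proof. by apply: measurable_funM => //; exact: sB.1. Qed.

Let mcos n : measurable_fun setT (fun x => cos (t n * B x)).
Proof. exact: measurable_cos_comp. Qed.

Let msin n : measurable_fun setT (fun x => sin (t n * B x)).
Proof.
apply: (@measurableT_comp _ _ _ _ _ _ (@sin R)) => //.
by apply: continuous_measurable_fun; exact: continuous_sin.
Qed.

Let tB_le n x : `|t n * B x| = t n * `|B x|.
Proof. by rewrite normrM (ger0_norm (rate_ge0 n)). Qed.

(** The cosine part is quadratic in [t n], so [beta = 0] in [dqm_mean_cvg] and the score leaves no
    trace: only the variance appears. *)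
Let cos_cvg : n%:R * (\int[Q n]_x cos (t n * B x) - 1) @[n --> \oo] --> - V.
Proof.
have ic n (M : probability T R) : M.-integrable setT (EFin \o (fun x => cos (t n * B x))).
  by apply: (@integrable_bounded _ _ _ M _ 1) => // x; exact: cos_max.
have i1 (M : probability T R) : M.-integrable setT (EFin \o (fun=> 1 : R)).
  exact: finite_measure_integrable_cst.
have cE n (M : probability T R) :
    \int[M]_x (cos (t n * B x) - 1) = \int[M]_x cos (t n * B x) - 1.
  by rewrite (RintegralB measurableT (ic n M) (i1 M)) Rintegral_prob_cst.
have lim : t n ^- 2 * \int[Q n]_x (cos (t n * B x) - 1) @[n --> \oo] -->
    - V + \int[P]_x (0 * h x).
  apply: (dqm_mean_cvg sh rho0 (B := B) (K := 2)).
  - by move=> n; exact: measurable_funB.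
  - move=> n x; rewrite ler_norml; have := cos_le1 (t n * B x).
    by have := cos_geN1 (t n * B x); lra.
  - exact: sB.
  - by move=> n x; rewrite -tB_le normr_cosB1_le.
  - by move=> x; exact: cvg_rateV_cosB1.
  - have -> : - V = \int[P]_x - (B x ^+ 2 / 2).
      rewrite RintegralN//; under [X in EFin \o X]eq_fun do rewrite mulrC.
      exact: (integrable_EFinZl _ sB.2).
    have E n : t n ^- 2 * \int[P]_x (cos (t n * B x) - 1)
        = \int[P]_x (t n ^- 2 * (cos (t n * B x) - 1)).
      by rewrite RintegralZl//; exact: (integrable_EFinB (ic n P) (i1 P)).
    under eq_fun do rewrite E.
    apply: (Rdominated_cvg (g := fun x => B x ^+ 2)).
    + by move=> n; apply: measurable_funM => //; exact: measurable_funB.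
    + by move=> x; exact: cvg_rateV2_cosB1.
    + exact: sB.2.
    + by move=> n x; exact: rateV2_cosB1_le.
move: lim; under eq_Rintegral do rewrite mul0r.
rewrite Rintegral_prob_cst addr0.
by under eq_fun do rewrite rateV2 cE.
Qed.

(** The sine part is linear in [t n]: its mean under [P] is negligible because [phi] is centered,
    and its covariance with the score gives the drift [m]. *)
Let sin_cvg : n%:R * \int[Q n]_x sin (t n * B x) @[n --> \oo] --> m.
Proof.
have is_ n : P.-integrable setT (EFin \o (fun x => sin (t n * B x))).
  by apply: (@integrable_bounded _ _ _ P _ 1) => // x; exact: sin_max.
have itB n : P.-integrable setT (EFin \o (fun x => t n * B x)).
  by do 2 apply: integrable_EFinZl.
have lim : t n ^- 2 * \int[Q n]_x sin (t n * B x) @[n --> \oo] --> 0 + m.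
  apply: (dqm_mean_cvg sh rho0 (B := B) (K := 1)) => //.
  - by move=> n x; exact: sin_max.
  - by move=> n x; rewrite -tB_le normr_sin_le.
  - by move=> x; exact: cvg_rateV_sin.
  (* Subtracting the centered term [t n * B x] leaves the integral unchanged and makes the integrand
     quadratically bounded after division by [t n ^+ 2]. *)
  - have E n : t n ^- 2 * \int[P]_x sin (t n * B x)
        = \int[P]_x (t n ^- 2 * (sin (t n * B x) - t n * B x)).
      rewrite RintegralZl//; last exact: integrable_EFinB.
      rewrite RintegralB// !RintegralZl//; last exact: integrable_EFinZl.
      by rewrite phi0 !mulr0 subr0.
    under eq_fun do rewrite E.
    have lim0 : \int[P]_x (t n ^- 2 * (sin (t n * B x) - t n * B x)) @[n --> \oo]
        --> \int[P]_x (0 : R).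
      apply: (Rdominated_cvg (g := fun x => B x ^+ 2)).
      + by move=> n; apply: measurable_funM => //; exact: measurable_funB.
      + by move=> x; exact: cvg_rateV2_sinB.
      + exact: sB.2.
      + by move=> n x; exact: rateV2_sinB_le.
    by rewrite Rintegral_prob_cst in lim0.
move: lim; rewrite add0r.
by under eq_fun do rewrite rateV2.
Qed.

Let V0 : 0 <= V.
Proof. by apply: Rintegral_ge0 => x _; rewrite divr_ge0// sqr_ge0. Qed.

Let phase_cvg a : \int[prod_prob (Q n) n]_w
    cos (\sum_(i < n) (t n * B (tnth w i)) + a) @[n --> \oo] -->
  expR (- V) * cos (m + a).
Proof.
pose c n := \int[Q n]_x cos (t n * B x); pose z n := \int[Q n]_x sin (t n * B x).
pose e n := expR (- (V / n%:R)).
(* The addition formula bounds the error for one observation by [D n], uniformly in the phase. The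
   [n]-fold replacement costs [n * D n], which vanishes by matching the [1/n] terms. *)
pose D n := `|c n - e n * cos (m / n%:R)| + `|z n - e n * sin (m / n%:R)|.
have ic n : (Q n).-integrable setT (EFin \o (fun x => cos (t n * B x))).
  by apply: (@integrable_bounded _ _ _ (Q n) _ 1) => // x; exact: cos_max.
have is_ n : (Q n).-integrable setT (EFin \o (fun x => sin (t n * B x))).
  by apply: (@integrable_bounded _ _ _ (Q n) _ 1) => // x; exact: sin_max.
have HD n b : `|\int[Q n]_x cos (t n * B x + b) - e n * cos (m / n%:R + b)| <= D n.
  have -> : \int[Q n]_x cos (t n * B x + b) = cos b * c n - sin b * z n.
    rewrite -(RintegralZl _ measurableT (ic n)) -(RintegralZl _ measurableT (is_ n)).
    rewrite -RintegralB//; [|exact: (integrable_EFinZl _ (ic n))|exact: (integrable_EFinZl _ (is_ n))].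
    by apply: eq_Rintegral => x _; rewrite cosD mulrC (mulrC (sin _)).
  rewrite cosD (_ : _ - _ = cos b * (c n - e n * cos (m / n%:R))
    - sin b * (z n - e n * sin (m / n%:R))); last by ring.
  apply: le_trans (ler_normB _ _) _; rewrite !normrM.
  by apply: lerD; rewrite ler_piMl// ?cos_max ?sin_max.
apply: (cvg_near_le (v := fun n => n%:R * D n)).
  near=> n; have n0 : n%:R != 0 :> R.
    by rewrite pnatr_eq0 -lt0n; near: n; exact: nbhs_infty_gt.
  have := prod_prob_phase (mtB n) (divr_ge0 V0 (ler0n _ n)) (HD n) n a.
  by rewrite !(mulrC n%:R (_ / _)) !divfK.
have -> : (fun n => n%:R * D n) = (fun n =>
    `|n%:R * (c n - 1) - n%:R * (e n * cos (m / n%:R) - 1)|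
    + `|n%:R * z n - n%:R * (e n * sin (m / n%:R))|).
  apply/funext => n; rewrite /D mulrDr -!mulrBr !normrM (@ger0_norm _ n%:R)//.
  by congr (_ * `| _ | + _); ring.
have k1 : `|n%:R * (c n - 1) - n%:R * (e n * cos (m / n%:R) - 1)| @[n --> \oo]
    --> `|- V - - V|.
  by apply: cvg_norm; apply: cvgB; [exact: cos_cvg|exact: cvg_mulrn_normal_cos].
have k2 : `|n%:R * z n - n%:R * (e n * sin (m / n%:R))| @[n --> \oo] --> `|m - m|.
  by apply: cvg_norm; apply: cvgB; [exact: sin_cvg|exact: cvg_mulrn_normal_sin].
rewrite !subrr normr0 in k1 k2.
by rewrite -[X in _ --> X]addr0; apply: cvgD.
Unshelve. all: end_near. Qed.

Lemma dqm_phase_cvg a : \int[prod_prob (Q n) n]_w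
    cos (s * (t n * \sum_(i < n) phi (tnth w i)) + a) @[n --> \oo] -->
  expR (- ((\int[P]_x phi x ^+ 2) * s ^+ 2 / 2)) * cos (s * (\int[P]_x (phi x * h x)) + a).
Proof.
have -> : (\int[P]_x phi x ^+ 2) * s ^+ 2 / 2 = V.
  rewrite -mulrA -RintegralZr//; last exact: sphi.2.
  by apply: eq_Rintegral => x _; rewrite exprMn; field.
have -> : s * (\int[P]_x (phi x * h x)) = m.
  rewrite -RintegralZl//; last exact: square_integrableM.
  by apply: eq_Rintegral => x _; rewrite mulrA.
have E n : \int[prod_prob (Q n) n]_w cos (s * (t n * \sum_(i < n) phi (tnth w i)) + a)
    = \int[prod_prob (Q n) n]_w cos (\sum_(i < n) (t n * B (tnth w i)) + a).
  apply: eq_Rintegral => w _; rewrite mulrCA !mulr_sumr.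
  by congr (cos (_ + a)); apply: eq_bigr.
under eq_fun do rewrite E.
exact: phase_cvg.
Qed.

End fixed_frequency.
End dqm_clt.

(** * Limit law under local alternatives *)

Section L2_square_integrable.
Context (d : measure_display) (T : measurableType d) (R : realType).
Variable P : probability T R.

Lemma L2_square_integrable (f : T -> R) : L2 P f <-> square_integrable P f.
Proof.
split=> [Lf|[mf f2]].
  by split; [move: Lf => /andP[/set_mem]|exact: Lfun2_integrable_sqr].
apply/andP; split; rewrite inE//= /finite_norm unlock poweR_lty//.
case/integrableP: f2 => _; apply: le_lt_trans; apply: ge0_le_integral => //.
- by move=> x _; rewrite lee_fin powR_ge0.
- apply/measurable_EFinP.
  apply: (@measurableT_comp _ _ _ _ _ _ (fun x : R => x `^ 2)) => //.
  exact: measurableT_comp.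
- by apply: measurableT_comp => //; apply/measurable_EFinP; exact: measurable_funX.
- by move=> x _ /=; rewrite lee_fin normrX powR_mulrn.
Qed.

Lemma L20_mean (f : T -> R) : L20 P f -> \int[P]_x f x = 0.
Proof. by case=> _; rewrite unlock /Rintegral => ->. Qed.

End L2_square_integrable.

Section slutsky.
Context {R : realType}.

Lemma normr_cosB (u v : R) : `|cos u - cos v| <= 2 * `|u - v|.
Proof.
rewrite -{1}(subrK v u) (addrC _ v) cosD; set w := u - v.
rewrite (_ : _ - cos v = cos v * (cos w - 1) - sin v * sin w); last by ring.
rewrite mulr2n mulrDl mul1r; apply: le_trans (ler_normB _ _) _; rewrite !normrM.
apply: lerD.
  by apply: le_trans (normr_cosB1_le w); rewrite ler_piMl// cos_max.
by apply: le_trans (normr_sin_le w); rewrite ler_piMl// sin_max.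
Qed.

Lemma cvg_rate_at_right : @rate R n @[n --> \oo] --> 0^'+.
Proof.
move=> A [e /= e0 He].
have /cvgrPdist_lt /(_ e e0) := @cvg_rate R.
move=> re; suff : \forall n \near \oo, A (@rate R n) by [].
near=> n; apply: He => /=; first by near: n.
by apply: rate_gt0; near: n; exact: nbhs_infty_gt.
Unshelve. all: end_near. Qed.

(** The continuity theorem concerns laws on the line, whereas the statistics live on sample spaces
    that vary with [n]; this transports bounded integrals between the two. *)
Lemma image_law (d : measure_display) (U : measurableType d) (M : probability U R)
    (Y : U -> R) : measurable_fun setT Y ->
  exists nu : law R, forall (g : R -> R) (K : R), measurable_fun setT g ->
    (forall x, `|g x| <= K) -> \int[nu]_x g x = \int[M]_w g (Y w).
Proof.
move=> mY.
pose Y' : {mfun U >-> measurableTypeR R} := HB.pack (Y : U -> measurableTypeR R)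
  (isMeasurableFun.Build _ _ U (measurableTypeR R) Y mY).
exists (distribution M Y') => g K mg gK.
congr fine; rewrite integral_distribution//; first exact/measurable_EFinP.
exact: (@integrable_bounded _ _ _ M (fun w => g (Y w)) K (measurableT_comp mg mY)).
Qed.

End slutsky.

Section local_limit.
Context (d : measure_display) (T : measurableType d) (R : realType).
Variables (model : set (probability T R)) (P : probability T R).
Variables (Psi : probability T R -> R) (Tn : forall n : nat, n.-tuple T -> R).
Arguments Tn : clear implicits.
Hypothesis Tn_measurable : forall n : nat, measurable_fun [set: n.-tuple T] (Tn n).
Variable phi : T -> R.
Hypothesis phi_L20 : L20 P phi.
Hypothesis Tn_linear : asymptotically_linear P Psi Tn phi.
Variables (h : T -> R) (Qt : R -> probability T R) (gam : R).
Hypothesis Qt_path : dqm_path model P h Qt.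
Hypothesis Psi_path : t^-1 * (Psi (Qt t) - Psi P) @[t --> 0^'+] --> gam.

Local Notation Q := (local_alt Qt).
Local Notation Y n := (@centered _ _ _ Psi Tn Q n).

Let sh : square_integrable P h.
Proof. by case: Qt_path => -[/L2_square_integrable]. Qed.

Let sphi : square_integrable P phi.
Proof. by case: phi_L20 => /L2_square_integrable. Qed.

Let rho0 : fine (dqm_remainder (Q n) P h (rate n)) @[n --> \oo] --> (0 : R).
Proof.
apply: fine_cvg; case: Qt_path => _ _ _ H.
exact: (cvg_comp _ _ (@cvg_rate_at_right R) H).
Qed.

Let shift n : R := Num.sqrt n%:R * (Psi (Q n) - Psi P).

Let shift_cvg : shift n @[n --> \oo] --> gam.
Proof.
have := cvg_comp _ _ (@cvg_rate_at_right R) Psi_path.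
by rewrite /comp /rate; under eq_fun do rewrite invrK.
Qed.

Let S n (w : n.-tuple T) : R := rate n * \sum_(i < n) phi (tnth w i).

Let rem n (w : n.-tuple T) : R := Num.sqrt n%:R * (Tn n w - Psi P) - S w.

Let YE n w : Y n w = S w + rem w - shift n.
Proof. by rewrite /centered /rem /shift; ring. Qed.

Let mS n : measurable_fun setT (@S n).
Proof. by apply: measurable_funM => //; apply: measurable_tsum; case: sphi. Qed.

Let mY n : measurable_fun setT (Y n).
Proof.
rewrite /centered; apply: measurable_funM => //; apply: measurable_funB => //.
exact: Tn_measurable.
Qed.

Let mrem n : measurable_fun setT (@rem n).
Proof.
rewrite /rem; apply: (measurable_funB _ (mS (n := n))); apply: measurable_funM => //.
apply: measurable_funB => //; exact: Tn_measurable.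
Qed.

Local Notation A e n := [set w : n.-tuple T | e <= `|rem w|].

Let mA (e : R) n : measurable (A e n).
Proof.
have : measurable_fun setT (fun w : n.-tuple T => e <= `|rem w|).
  apply: measurable_fun_ler => //; apply: (@measurableT_comp _ _ _ _ _ _ (@Num.norm R R)) => //; exact: mrem.
by move=> /(_ measurableT [set true]); rewrite setTI; exact.
Qed.

Let QA (e : R) : 0 < e -> fine (prod_prob (Q n) n (A e n)) @[n --> \oo] --> (0 : R).
Proof.
move=> e0; apply: (dqm_contiguous sh rho0 (A := fun n => A e n)) => [n|]; first exact: mA.
exact: Tn_linear.
Qed.

Let Yphase (s a : R) : \int[prod_prob (Q n) n]_w cos (s * Y n w + a) @[n --> \oo] -->
  phase (normal_law (L2inner P phi h - gam) (L2norm P phi ^+ 2)) s a.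
Proof.
have phi2 : 0 <= \int[P]_x phi x ^+ 2 by apply: Rintegral_ge0 => x _; exact: sqr_ge0.
rewrite phase_normal ?sqr_ge0// /L2norm sqr_sqrtr//.
(* The deterministic drift [gam] of the centering enters as a change of phase. *)
have := @dqm_phase_cvg _ _ _ _ _ _ _ sh sphi (L20_mean phi_L20) rho0 s (a - s * gam).
rewrite (_ : s * _ + (a - s * gam) = s * (L2inner P phi h - gam) + a); last first.
  by rewrite /L2inner; ring.
move=> lim; apply/cvgrPdist_lt => eps eps0.
(* Off the event [A e n] the arguments differ by at most [2 |s| e]; as cosine is used with Lipschitz
   constant [2], this costs [eps / 2]. The event itself costs [2 * (eps / 8)], and the phase limit
   the remaining [eps / 4]. *)
pose e := eps / (8 * (`|s| + 1)).
have s1 : 0 < `|s| + 1 by rewrite ltr_wpDl.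
have e0 : 0 < e by rewrite divr_gt0// mulr_gt0.
have eE : 8 * (`|s| * e) <= eps.
  have E : e * (8 * (`|s| + 1)) = eps by rewrite divfK// gt_eqF// mulr_gt0.
  by rewrite -[leRHS]E; move: (e0); lra.
have /cvgrPdist_lt /(_ (eps / 4)) := lim; rewrite divr_gt0// => /(_ isT) lim'.
have /cvgrPdist_lt /(_ e e0) shift' := shift_cvg.
have /cvgrPdist_lt /(_ (eps / 8)) := QA e0; rewrite divr_gt0// => /(_ isT) QA'.
near=> n.
have n1 : `|gam - shift n| < e by near: n.
have n2 : fine (prod_prob (Q n) n (A e n)) < eps / 8.
  have : `|0 - fine (prod_prob (Q n) n (A e n))| < eps / 8 by near: n.
  by rewrite sub0r normrN ger0_norm ?fine_ge0.
have := near lim' n; move=> /(_ _)/wrap[]//.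
set X := expR _ * _.
set I := \int[prod_prob (Q n) n]_w cos (s * Y n w + a).
set J := \int[prod_prob (Q n) n]_w cos (s * S w + (a - s * gam)) => n3.
have mc1 : measurable_fun setT (fun w : n.-tuple T => cos (s * Y n w + a)).
  by apply: measurable_cos_comp; apply: measurable_funD => //; apply: measurable_funM => //; exact: mY.
have mc2 : measurable_fun setT (fun w : n.-tuple T => cos (s * S w + (a - s * gam))).
  by apply: measurable_cos_comp; apply: measurable_funD => //; apply: measurable_funM => //; exact: mS.
have ic1 : (prod_prob (Q n) n).-integrable setT (EFin \o (fun w => cos (s * Y n w + a))).
  by apply: (@integrable_bounded _ _ _ (prod_prob (Q n) n) _ 1) => // w; exact: cos_max.
have ic2 : (prod_prob (Q n) n).-integrable setT
    (EFin \o (fun w => cos (s * S w + (a - s * gam)))).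
  by apply: (@integrable_bounded _ _ _ (prod_prob (Q n) n) _ 1) => // w; exact: cos_max.
have i1 c : (prod_prob (Q n) n).-integrable setT (EFin \o (fun=> c)).
  exact: finite_measure_integrable_cst.
have iA : (prod_prob (Q n) n).-integrable setT (EFin \o (fun w => \1_(A e n) w)).
  by apply: integrable_indic; exact: mA.
have IJ : `|I - J| <= 4 * (`|s| * e) + 2 * fine (prod_prob (Q n) n (A e n)).
  rewrite /I /J -RintegralB// -(Rintegral_indic _ (@mA e n)) -RintegralZl//.
  rewrite -[X in _ <= X + _](Rintegral_prob_cst (prod_prob (Q n) n)) -RintegralD//; last first.
    exact: integrable_EFinZl.
  apply: normr_Rintegral_le; first exact: measurable_funB.
    by apply: integrable_EFinD => //; exact: integrable_EFinZl.
  move=> w; rewrite indicE; case: (boolP (w \in A e n)) => [_|].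
    rewrite mulr1 (@le_trans _ _ 2)//; last by rewrite lerDr !mulr_ge0// ltW.
    apply: le_trans (ler_normB _ _) _.
    by have := cos_max (s * Y n w + a); have := cos_max (s * S w + (a - s * gam)); lra.
  rewrite notin_setE/= => /negP; rewrite -ltNge => remw.
  rewrite mulr0 addr0; apply: le_trans (normr_cosB _ _) _.
  rewrite YE (_ : _ - _ = s * (rem w + (gam - shift n))); last by ring.
  rewrite normrM (_ : 4 * _ = 2 * (`|s| * (e + e))); last by ring.
  rewrite ler_wpM2l// ler_wpM2l// (le_trans (ler_normD _ _))// lerD// ltW//.
have : `|X - I| <= `|X - J| + `|I - J|.
  by rewrite (_ : X - I = (X - J) - (I - J)) ?ler_normB//; ring.
move: IJ n3 n2 eE; lra.
Unshelve. all: end_near. Qed.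

Lemma local_weak_limit : weakly_converges Q (centered Psi Tn Q)
  (normal_law (L2inner P phi h - gam) (L2norm P phi ^+ 2)).
Proof.
move=> f cf bf.
have /choice[nu nuE] n := image_law (prod_prob (Q n) n) (mY (n := n)).
have lim : \int[nu n]_x f x @[n --> \oo] -->
    \int[normal_law (L2inner P phi h - gam) (L2norm P phi ^+ 2)]_x f x.
  apply: levy_continuity => // s a.
  have E n : phase (nu n) s a = \int[prod_prob (Q n) n]_w cos (s * Y n w + a).
    by apply: (nuE n _ 1) => [|x]; [exact: measurable_cosD|exact: cos_max].
  by under eq_fun do rewrite E; exact: Yphase.
have [K fK] := bf.
have E n : \int[nu n]_x f x = \int[prod_prob (Q n) n]_w f (Y n w).
  by apply: (nuE n _ K) => //; exact: continuous_measurable_fun.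
by move: lim; under eq_fun do rewrite E.
Qed.

End local_limit.

(** * Projections in L2 *)

Section L2_algebra.
Context (d : measure_display) (T : measurableType d) (R : realType).
Variable P : probability T R.
Implicit Types f g h : T -> R.
Local Notation L2 := (L2 P).
Local Notation "<< f , g >>" := (L2inner P f g).

Lemma L2_scaleD (a : R) f g : L2 f -> L2 g -> L2 (a *: f + g).
Proof.
move=> /L2_square_integrable sf /L2_square_integrable sg.
by apply/L2_square_integrable/(square_integrableD _ sg)/square_integrableZ.
Qed.

Lemma L2_0 : L2 0.
Proof.
apply/L2_square_integrable; split; first exact: measurable_cst.
by under [X in EFin \o X]eq_fun do rewrite expr0n; exact: integrable0.
Qed.

Lemma L2B f g : L2 f -> L2 g -> L2 (f - g).
Proof.
move=> Lf Lg; rewrite addrC -scaleN1r; exact: L2_scaleD.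
Qed.

Lemma L2innerC f g : <<f, g>> = <<g, f>>.
Proof. by apply: eq_Rintegral => x _; rewrite mulrC. Qed.

Lemma L2inner_linear (a : R) f g h : L2 f -> L2 g -> L2 h ->
  <<a *: f + g, h>> = a * <<f, h>> + <<g, h>>.
Proof.
move=> /L2_square_integrable sf /L2_square_integrable sg /L2_square_integrable sh.
have fh := square_integrableM sf sh; have gh := square_integrableM sg sh.
rewrite /L2inner -RintegralZl// -RintegralD//; last exact: integrable_EFinZl.
by apply: eq_Rintegral => x _; rewrite mulrA -mulrDl.
Qed.

Lemma L2inner0 h : <<0, h>> = 0.
Proof.
rewrite /L2inner; under eq_Rintegral do rewrite mul0r.
exact: Rintegral_prob_cst.
Qed.

Lemma L2innerBl f g h : L2 f -> L2 g -> L2 h ->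
  <<f - g, h>> = <<f, h>> - <<g, h>>.
Proof.
by move=> Lf Lg Lh; rewrite addrC -scaleN1r L2inner_linear// mulN1r addrC.
Qed.

Lemma L2inner_ge0 f : 0 <= <<f, f>>.
Proof. by apply: Rintegral_ge0 => x _; rewrite -expr2 sqr_ge0. Qed.

Lemma L2norm_sqr f : L2norm P f ^+ 2 = <<f, f>>.
Proof. by rewrite sqr_sqrtr// L2inner_ge0. Qed.

Lemma L2inner_cauchy_schwarz f g : L2 f -> L2 g ->
  `|<<f, g>>| <= L2norm P f * L2norm P g.
Proof.
by move=> /L2_square_integrable sf /L2_square_integrable sg;
  exact: Rintegral_cauchy_schwarz.
Qed.

Lemma L2inner_sqr (a : R) f g : L2 f -> L2 g ->
  <<a *: f + g, a *: f + g>> = a ^+ 2 * <<f, f>> + 2 * a * <<f, g>> + <<g, g>>.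
Proof.
move=> Lf Lg; have Lfg := L2_scaleD a Lf Lg; rewrite L2inner_linear//.
by rewrite [<<f, _>>]L2innerC [<<g, _>>]L2innerC !L2inner_linear// (L2innerC g f); ring.
Qed.

Lemma L2inner_ae f g h : L2 f -> L2 g -> L2 h -> f = g %[ae P] ->
  <<f, h>> = <<g, h>>.
Proof.
move=> /L2_square_integrable[mf _] /L2_square_integrable[mg _].
move=> /L2_square_integrable[mh _] fg; congr fine; apply: ae_eq_integral => //.
- by apply/measurable_EFinP; exact: measurable_funM.
- by apply/measurable_EFinP; exact: measurable_funM.
- by apply: filterS fg => x + _ => ->.
Qed.

Lemma L2inner_ae2 f g : L2 f -> L2 g -> f = g %[ae P] -> <<f, f>> = <<g, g>>.
Proof.
by move=> Lf Lg fg; rewrite (L2inner_ae Lf Lg)// L2innerC (L2inner_ae Lf Lg).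
Qed.

Lemma L2innerB_eq0_ae f g : L2 f -> L2 g -> <<f - g, f - g>> = 0 -> f = g %[ae P].
Proof.
move=> Lf Lg fg0; have /L2_square_integrable[mfg ifg] := L2B Lf Lg.
have : ae_eq P setT (EFin \o (fun x => (f - g) x ^+ 2)) (cst 0%E).
  apply/ae_eq_integral_abs => //; first by apply/measurable_EFinP; exact: measurable_funX.
  under eq_integral => x _ do rewrite /= ger0_norm ?sqr_ge0//.
  move: fg0; rewrite /L2inner /Rintegral; under eq_integral do rewrite -expr2.
  move=> fg0; rewrite -[LHS]fineK ?fg0//.
  exact: integrable_fin_num.
apply: filterS => x /(_ I) /= [] /eqP; rewrite sqrf_eq0 subr_eq0.
by move=> /eqP.
Qed.

Lemma L2inner_ae_norm f g : L2 f -> L2 g -> f = g %[ae P] ->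
  L2norm P f = L2norm P g.
Proof. by move=> Lf Lg fg; rewrite /L2norm (L2inner_ae2 Lf Lg). Qed.

End L2_algebra.

(** In the induction [(x + y)^2 <= 2 x^2 + 2 y^2] doubles the bound at each step, and the weights
    [2^i] absorb this. The right side is uniform in [k] once the weighted series converges. *)
Lemma weighted_telescope (R : realType) (v : nat -> R) (n k : nat) :
  (v (n + k)%N - v n) ^+ 2
  <= 2 * 2^-1 ^+ n * \sum_(n <= i < n + k) (2 ^+ i * (v i.+1 - v i) ^+ 2).
Proof.
elim: k n => [|k IH] n; first by rewrite addn0 big_geq// mulr0 subrr expr0n.
rewrite big_ltn; last by rewrite addnS ltnS leq_addr.
have := IH n.+1; rewrite addSnnS; set S := \sum_(_ <= _ < _) _ => H.
set x := v (n + k.+1)%N in H *.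
have e : 2^-1 ^+ n * 2 ^+ n = 1 :> R by rewrite -exprMn mulVf// expr1n.
set D := (v n.+1 - v n) ^+ 2; move: e H; rewrite (exprS 2^-1).
set p := 2^-1 ^+ n; set q := 2 ^+ n => e H.
have -> : 2 * p * (q * D + S) = 2 * (p * q) * D + 2 * p * S by ring.
rewrite e mulr1 /D.
have -> : x - v n = (x - v n.+1) + (v n.+1 - v n) by ring.
have e2 : 2 * (2^-1 * p) * S = p * S by field.
rewrite e2 in H; move: H; set a := x - _; set b := v n.+1 - _ => H.
by have := sqr_ge0 (a - b); nra.
Qed.

Lemma cvg_half_exp0 (R : realType) (K : R) :
  K * 2^-1 ^+ n @[n --> \oo] --> (0 : R).
Proof.
rewrite -[X in _ --> X](mulr0 K); apply: cvgM; first exact: cvg_cst.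
by apply: cvg_expr; rewrite ger0_norm// invf_lt1// ltr1n.
Qed.

Lemma geometric_squeeze (R : realType) (x K : R) :
  (forall n, x <= K * 2^-1 ^+ n) -> x <= 0.
Proof.
move=> H; have c := cvg_half_exp0 K; rewrite -(cvg_lim _ c)//.
by apply: limr_ge; [apply: cvgP c|exact: nearW].
Qed.

Section L2_complete.
Context (d : measure_display) (T : measurableType d) (R : realType).
Variable P : probability T R.
Local Notation L2 := (L2 P).
Local Notation "<< f , g >>" := (L2inner P f g).

(* The common majorant of the weighted squared increments makes a fast Cauchy
   sequence converge at every point where this majorant is finite. *)
Lemma L2_fast_cauchy (v : nat -> T -> R) (c : R) : 0 <= c ->
  (forall n, L2 (v n)) ->
  (forall n, <<v n.+1 - v n, v n.+1 - v n>> <= c * 8^-1 ^+ n) ->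
  exists (u : nat -> T -> R) (g : T -> R) (K : R),
    [/\ forall n, L2 (u n), forall n, v n = u n %[ae P], L2 g &
        forall n, <<g - u n, g - u n>> <= K * 2^-1 ^+ n].
Proof.
move=> c0 Lv vc.
have sv n : square_integrable P (v n) by exact/L2_square_integrable.
have mv n : measurable_fun setT (v n) by case: (sv n).
have sdv n : square_integrable P (v n.+1 - v n) by apply: square_integrableB.
(* Against the assumed decay [8^-k] the weight [2^k] leaves [4^-k <= 2^-k], so the integrated series
   is at most [2 c]. *)
pose dv k x : R := 2 ^+ k * (v k.+1 x - v k x) ^+ 2.
have dv0 k x : 0 <= dv k x by apply: mulr_ge0; [exact: exprn_ge0|exact: sqr_ge0].
have idv k : P.-integrable setT (EFin \o dv k).
  by apply: integrable_EFinZl; case: (sdv k).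
have mdv k : measurable_fun setT (dv k) by exact: integrable_EFin_measurable (idv k).
pose G x : \bar R := (\sum_(0 <= k <oo) (dv k x)%:E)%E.
have G0 x : (0 <= G x)%E by apply: nneseries_ge0 => k _ _; rewrite lee_fin.
have mG : measurable_fun setT G.
  have := @ge0_emeasurable_sum _ T R setT (fun k x => (dv k x)%:E) predT.
  by apply => [k x _ _|k _]; rewrite ?lee_fin//; exact/measurable_EFinP.
have IG : (\int[P]_x G x <= (2 * c)%:E)%E.
  rewrite integral_nneseries//; last 2 first.
  - by move=> k; exact/measurable_EFinP.
  - by move=> k x _; rewrite lee_fin.
  apply: (@le_trans _ _ (\sum_(0 <= i <oo) ((2 * c) / (2 ^ i.+1)%:R)%:E)%E); last first.
    exact: (epsilon_trick0 xpredT (mulr_ge0 (ler0n R 2) c0)).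
  apply: lee_nneseries => [k _ _|k _].
    by apply: integral_ge0 => x _; rewrite lee_fin.
  have -> : (\int[P]_x (dv k x)%:E)%E = (\int[P]_x dv k x)%:E.
    by rewrite fineK//; exact: (integrable_fin_num measurableT (idv k)).
  rewrite lee_fin RintegralZl//; last by case: (sdv k).
  have := vc k; rewrite /L2inner; under eq_Rintegral do rewrite -expr2.
  move=> H; apply: (le_trans (ler_wpM2l (exprn_ge0 k (ler0n R 2)) H)).
  have e8 : 8^-1 ^+ k * 2 ^+ k = (4^-1 : R) ^+ k.
    by rewrite -exprMn; congr (_ ^+ _); lra.
  rewrite mulrCA (mulrC (2 ^+ k)) e8 natrX exprS invfM.
  have -> : 2 * c * (2^-1 * (2 ^+ k)^-1) = c * (2 ^+ k)^-1 by field; exact: expf_neq0.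
  apply: ler_wpM2l => //; rewrite -exprVn; apply: lerXn2r; rewrite ?nnegrE; lra.
have iG : P.-integrable setT G.
  apply/integrableP; split => //.
  under eq_integral => x _ do rewrite gee0_abs//.
  exact: le_lt_trans IG (ltry _).
(* Off [A] the sequence is set to [0]: [u n] then converges everywhere and, [A] having full measure,
   still represents the class of [v n]. *)
pose A := [set x | G x \is a fin_num].
have mA : measurable A by rewrite -[A]setTI; exact: emeasurable_fin_num.
pose u n x := v n x * \1_A x.
have mu n : measurable_fun setT (u n).
  by apply: measurable_funM => //; exact: measurable_indic.
have su n : square_integrable P (u n).
  apply: square_integrable_le (sv n) => // x.
  by rewrite normrM ler_piMr// indicE; case: (_ \in _); rewrite ?normr1 ?normr0.
have vu n : v n = u n %[ae P].
  have := integrable_ae measurableT iG; apply: filterS => x /(_ I) Gx _.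
  by rewrite /u indicE mem_set// mulr1.
pose Gr x := fine (G x) * \1_A x.
have Gr0 x : 0 <= Gr x by rewrite mulr_ge0// fine_ge0.
have iGr : P.-integrable setT (EFin \o Gr).
  have -> : EFin \o Gr = (fun x => G x * (\1_A x)%:E)%E.
    apply/funext => x /=; rewrite EFinM indicE.
    case: (boolP (x \in A)) => [/set_mem xA|_]; first by rewrite fineK.
    by rewrite !mule0.
  have := integrable_mkcond G mA; rewrite /restrict.
  move=> /(_ P)/iffLR h.
  have -> : (fun x => G x * (\1_A x)%:E)%E = (fun x => if x \in A then G x else 0)%E.
    by apply/funext => x; rewrite indicE; case: (_ \in _); rewrite ?mule1 ?mule0.
  by apply: h; exact: integrableS iG.
have key n k x : (u (n + k)%N x - u n x) ^+ 2 <= 2 * Gr x * 2^-1 ^+ n.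
  rewrite /u /Gr indicE; case: (boolP (x \in A)) => [/set_mem xA|_]; last first.
    by rewrite !mulr0 mul0r subrr expr0n.
  rewrite !mulr1; apply: le_trans (weighted_telescope (fun i => v i x) n k) _.
  rewrite -!mulrA ler_pM2l// mulrC ler_wpM2r ?exprn_ge0// -lee_fin fineK//.
  rewrite -sumEFin; apply: (@le_trans _ _ (\sum_(0 <= i < n + k) (dv i x)%:E)%E).
    rewrite (@big_cat_nat _ _ _ n 0)//=; last exact: leq_addr.
    by rewrite leeDr// sume_ge0// => i _; rewrite lee_fin.
  by apply: nneseries_lim_ge => i _ _; rewrite lee_fin.
have cvu x : cvgn (u ^~ x).
  apply/cauchy_cvgP/cauchy_exP => e /= e0.
  have [N _ /(_ N (leqnn N)) HN] := cvgr_lt 0 (cvg_half_exp0 (2 * Gr x)) _ (exprn_gt0 2 e0).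
  exists (u N x); exists N => // m /= Nm; rewrite /ball/=.
  rewrite -(subnKC Nm) -ltr_sqr ?nnegrE ?(ltW e0)// distrC.
  rewrite real_normK ?num_real//; exact: le_lt_trans (key N _ x) HN.
pose g x := lim (u ^~ x @ \oo).
have ug x : u ^~ x @ \oo --> g x by exact: cvu.
have mg : measurable_fun setT g by apply: (measurable_fun_cvg mu) => x _; exact: ug.
have gu n x : (g x - u n x) ^+ 2 <= 2 * Gr x * 2^-1 ^+ n.
  have c3 : (u m x - u n x) ^+ 2 @[m --> \oo] --> (g x - u n x) ^+ 2.
    by rewrite !expr2; apply: cvgM; apply: cvgB => //; exact: cvg_cst.
  rewrite -(cvg_lim _ c3)//; apply: limr_le; first exact: cvgP c3.
  near=> m; have nm : (n <= m)%N by near: m; exact: nbhs_infty_ge.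
  by rewrite -(subnKC nm); exact: key.
have i2 n : P.-integrable setT (EFin \o (fun x => 2 * Gr x * 2^-1 ^+ n)).
  under [X in EFin \o X]eq_fun do rewrite mulrAC.
  exact: integrable_EFinZl.
have sgu n : square_integrable P (g - u n).
  have m1 : measurable_fun setT (g - u n) by exact: measurable_funB.
  split => //; apply: (integrable_dominated _ (i2 n)) => [|x].
    exact: measurable_funX.
  by rewrite ger0_norm ?sqr_ge0//; exact: gu.
exists u, g, (2 * \int[P]_x Gr x); split => //.
- by move=> n; exact/L2_square_integrable.
- apply/L2_square_integrable; have -> : g = (fun x => (g - u 0%N) x + u 0%N x).
    by apply/funext => x; rewrite /= subrK.
  exact: square_integrableD.
- move=> n; rewrite /L2inner; under eq_Rintegral do rewrite -expr2.
  rewrite mulrAC -RintegralZl//; apply: le_Rintegral => //.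
  + by case: (sgu n).
  + exact: integrable_EFinZl.
  + by move=> x _; apply: le_trans (gu n x) _; rewrite mulrAC.
Unshelve. all: by end_near.
Qed.

End L2_complete.

Section projection.
Context (d : measure_display) (T : measurableType d) (R : realType).
Variable P : probability T R.
Implicit Types f g h : T -> R.
Local Notation L2 := (L2 P).
Local Notation "<< f , g >>" := (L2inner P f g).

Section subspace.
Variables (V : set (T -> R)) (Vsub : linear_subspace P V).

Let VL2 f : V f -> L2 f. Proof. by case: Vsub => V20 _ _ _ /V20[]. Qed.
Let V0 : V 0. Proof. by case: Vsub. Qed.
Let Vlin (a : R) f g : V f -> V g -> V (a *: f + g).
Proof. by case: Vsub => _ _ _; exact. Qed.

(** The squared distance from [phi] to [s h + v] is a quadratic in [s] that never falls more than
    [e] below its value at [s = 0]; its discriminant bounds the slope there. *)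
Lemma almost_minimizer_almost_orthogonal phi (v h : T -> R) (m e : R) : L2 phi -> V v -> V h ->
  (forall w, V w -> m <= <<phi - w, phi - w>>) ->
  <<phi - v, phi - v>> <= m + e -> <<phi - v, h>> ^+ 2 <= <<h, h>> * e.
Proof.
move=> Lphi Vv Vh mle ve; apply: discriminant_le; first exact: L2inner_ge0.
move=> s; have Lpv : L2 (phi - v) by apply: L2B => //; exact: VL2.
have := mle _ (Vlin s Vh Vv).
have -> : phi - (s *: h + v) = (- s) *: h + (phi - v).
  by rewrite scaleNr opprD addrCA.
rewrite L2inner_sqr//; last exact: VL2.
by rewrite (L2innerC _ h); nra.
Qed.

(** The parallelogram law: the midpoint of [v] and [w] lies in [V], so its squared distance to [phi]
    is at least [m]. *)
Lemma almost_minimizers_close phi (v w : T -> R) (m e : R) : L2 phi -> V v -> V w ->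
  (forall w, V w -> m <= <<phi - w, phi - w>>) ->
  <<phi - v, phi - v>> <= m + e -> <<phi - w, phi - w>> <= m + e ->
  <<w - v, w - v>> <= 4 * e.
Proof.
move=> Lphi Vv Vw mle ve we.
have Lv : L2 (phi - v) by apply: L2B => //; exact: VL2.
have Lw : L2 (phi - w) by apply: L2B => //; exact: VL2.
have Vh f : V f -> V (2^-1 *: f) by move=> Vf; rewrite -[_ *: _]addr0; exact: Vlin.
have := mle _ (Vlin 2^-1 Vv (Vh _ Vw)).
set z := (z in <<z, z>> <= 4 * e); set y := phi - _.
have zE : z = (- 1) *: (phi - w) + (phi - v).
  by apply/funext => x; rewrite /z/=; change ((w x - v x) = (-1) * (phi x - w x) + (phi x - v x)); ring.
have yE : 2 *: y = 1 *: (phi - w) + (phi - v).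
  apply/funext => x; change (2 * (phi x - (2^-1 * v x + 2^-1 * w x)) =
    1 * (phi x - w x) + (phi x - v x)); by field.
have Ly : L2 y by apply: L2B => //; apply: VL2; apply: Vlin => //; exact: Vh.
have := L2inner_sqr 2 Ly (L2_0 P).
rewrite addr0 yE L2inner_sqr// (L2innerC _ y 0) !L2inner0 zE L2inner_sqr//.
lra.
Qed.

Lemma orthogonal_closure f : L2 f -> (forall h, V h -> <<f, h>> = 0) ->
  forall h, L2closure P V h -> <<f, h>> = 0.
Proof.
move=> Lf fV h [Lh Hh]; apply/eqP; rewrite -normr_eq0 eq_le normr_ge0 andbT.
apply/ler_addgt0Pr => e e0; rewrite add0r.
have e1 : 0 < e / (1 + L2norm P (f)).
  by rewrite divr_gt0// ltr_pwDl// sqrtr_ge0.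
have [h' Vh' hh'] := Hh _ e1.
have Lh' := VL2 Vh'.
have -> : <<f, h>> = <<f, h - h'>>.
  rewrite [RHS]L2innerC [RHS]L2innerBl// (L2innerC P h' (f)) (fV _ Vh') subr0.
  exact: L2innerC.
apply: le_trans (L2inner_cauchy_schwarz Lf (L2B Lh Lh')) _.
set N := L2norm P (f) in e1 hh' *; have N0 : 0 <= N by exact: sqrtr_ge0.
apply: le_trans (ler_wpM2l N0 (ltW hh')) _.
by rewrite mulrCA ler_piMr ?(ltW e0)// ler_pdivrMr ?mul1r ?lerDr// ltr_pwDl.
Qed.

(** [V] itself may fail to be closed: the minimizing sequence stays in [V], its limit lies in the
    closure, and orthogonality passes from [V] to the closure. *)
Lemma projection_exists phi : L2 phi -> exists g, is_projection P (L2closure P V) phi g.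
Proof.
move=> Lphi.
pose E := [set <<phi - w, phi - w>> | w in V].
have E0 : has_inf E.
  split; first by exists <<phi - 0, phi - 0>>; exists 0.
  by exists 0 => _ [w _ <-]; exact: L2inner_ge0.
set m := inf E.
have mle w : V w -> m <= <<phi - w, phi - w>>.
  by move=> Vw; apply: ge_inf; [case: E0|exists w].
(* The tolerance [8^-n] gives increments of squared norm at most [4 * 8^-n], the decay that
   [L2_fast_cauchy] expects. *)
have /choice[v Hv] n : exists v, V v /\ <<phi - v, phi - v>> <= m + 8^-1 ^+ n.
  have p8 : 0 < 8^-1 ^+ n :> R by rewrite exprn_gt0.
  by have [_ [w Vw <-] /ltW H] := inf_adherent p8 E0; exists w.
have Vv n : V (v n) by case: (Hv n).
have vm n : <<phi - v n, phi - v n>> <= m + 8^-1 ^+ n by case: (Hv n).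
have vinc n : <<v n.+1 - v n, v n.+1 - v n>> <= 4 * 8^-1 ^+ n.
  apply: (almost_minimizers_close Lphi (Vv n) (Vv n.+1) mle (vm n)).
  apply: le_trans (vm n.+1) _; rewrite lerD2l ler_wiXn2l//; lra.
have [u [g [K [Lu vu Lg gu]]]] :=
  L2_fast_cauchy (ler0n R 4) (fun n => VL2 (Vv n)) vinc.
have Vu n : V (u n) by case: Vsub => _ + _ _; apply; [exact: Vv|exact: Lu|exact: vu].
have um n : <<phi - u n, phi - u n>> <= m + 8^-1 ^+ n.
  rewrite (@L2inner_ae2 _ _ _ P (phi - u n) (phi - v n)) ?vm//.
  - exact: L2B.
  - by apply: L2B => //; exact: VL2.
  - by apply: filterS (vu n) => x vux _; change (phi x - u n x = phi x - v n x); rewrite vux.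
have Kge0 : 0 <= K.
  by have := gu 0; rewrite expr0 mulr1; apply: le_trans; exact: L2inner_ge0.
have orthoV h : V h -> <<phi - g, h>> = 0.
  move=> Vh; have Lh := VL2 Vh.
  apply/eqP; rewrite -sqrf_eq0 eq_le sqr_ge0 andbT; apply/eqP/eqP.
  (* [phi - g] splits through [u n]: near-orthogonality of [phi - u n] contributes the [1], the
     distance from [g] to [u n] contributes [K], and the factor [2] comes from squaring a sum. *)
  apply: (@geometric_squeeze _ _ (2 * <<h, h>> * (1 + K))) => n.
  have -> : phi - g = (- 1) *: (g - u n) + (phi - u n).
    by apply/funext => x; change (phi x - g x = (-1) * (g x - u n x) + (phi x - u n x)); ring.
  have Lpu := L2B Lphi (Lu n); have Lgu := L2B Lg (Lu n).
  rewrite L2inner_linear//.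
  have h1 := almost_minimizer_almost_orthogonal Lphi (Vu n) Vh mle (um n).
  have h2 : <<g - u n, h>> ^+ 2 <= <<h, h>> * (K * 2^-1 ^+ n).
    rewrite -real_normK ?num_real//.
    apply: le_trans (_ : (L2norm P (g - u n) * L2norm P h) ^+ 2 <= _).
      by rewrite lerXn2r ?nnegrE ?mulr_ge0 ?sqrtr_ge0// L2inner_cauchy_schwarz.
    by rewrite exprMn !L2norm_sqr mulrC ler_wpM2l ?L2inner_ge0.
  have h3 : 8^-1 ^+ n <= 2^-1 ^+ n :> R by rewrite lerXn2r ?nnegrE//; lra.
  have h4 := ler_wpM2l (L2inner_ge0 P h) h3.
  have := sqr_ge0 (<<g - u n, h>> + <<phi - u n, h>>).
  move: h1 h2 h4; set a := <<_, h>>; set b := <<_, h>>; set H := <<h, h>>.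
  by move: (2^-1 ^+ n) => q; nra.
exists g; split; first (split => // e e0).
  have [N _ /(_ N (leqnn N)) HN] := cvgr_lt 0 (cvg_half_exp0 K) _ (exprn_gt0 2 e0).
  exists (u N) => //; rewrite -ltr_sqr ?nnegrE ?sqrtr_ge0// ?(ltW e0)// L2norm_sqr.
  exact: le_lt_trans (gu N) HN.
by apply: orthogonal_closure => //; exact: L2B.
Qed.

Lemma L2closure_subset f : V f -> L2closure P V f.
Proof.
move=> Vf; split=> [|e e0]; first exact: VL2.
exists f => //; rewrite subrr /L2norm L2inner0 sqrtr0//.
Qed.

Lemma L2closureD (a : R) f g : L2closure P V f -> L2closure P V g ->
  L2closure P V (a *: f + g).
Proof.
move=> [Lf Hf] [Lg Hg]; split=> [|e e0]; first exact: L2_scaleD.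
have ea : 0 < e / (2 * (1 + `|a|)) by rewrite divr_gt0// mulr_gt0// ltr_pwDl.
have [f' Vf' ff'] := Hf _ ea.
have [g' Vg' gg'] := Hg (e / 2) (divr_gt0 e0 (ltr0n R 2)).
exists (a *: f' + g'); first exact: Vlin.
have Lff := L2B Lf (VL2 Vf'); have Lgg := L2B Lg (VL2 Vg').
have -> : a *: f + g - (a *: f' + g') = a *: (f - f') + (g - g').
  by apply/funext => x; change (a * f x + g x - (a * f' x + g' x) = a * (f x - f' x) + (g x - g' x)); ring.
rewrite -ltr_sqr ?nnegrE ?sqrtr_ge0// ?(ltW e0)// L2norm_sqr L2inner_sqr//.
have := L2inner_cauchy_schwarz Lff Lgg.
rewrite -!L2norm_sqr; set x := L2norm _ _ in ff' *; set y := L2norm _ _ in gg' *.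
have x0 : 0 <= x by exact: sqrtr_ge0.
have y0 : 0 <= y by exact: sqrtr_ge0.
set z := <<_, _>> => zxy.
have ax : `|a| * x < e / 2.
  rewrite ltr_pdivlMr ?mulr_gt0 ?ltr_pwDl// in ff'.
  by rewrite ltr_pdivlMr//; nra.
apply: (@le_lt_trans _ _ ((`|a| * x + y) ^+ 2)); last first.
  by rewrite ltrXn2r ?nnegrE ?addr_ge0 ?mulr_ge0// ?(ltW e0)//; lra.
have az : a * z <= `|a| * (x * y).
  by apply: le_trans (ler_norm _) _; rewrite normrM ler_wpM2l.
rewrite -(real_normK (num_real a)); nra.
Qed.

Lemma L2closureB f g : L2closure P V f -> L2closure P V g ->
  L2closure P V (f - g).
Proof. by move=> Vf Vg; rewrite addrC -scaleN1r; exact: L2closureD. Qed.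

Lemma projection_ae_unique phi f g : L2 phi -> is_projection P (L2closure P V) phi f ->
  is_projection P (L2closure P V) phi g -> f = g %[ae P].
Proof.
move=> Lphi [Vf Hf] [Vg Hg].
have Lf := Vf.1; have Lg := Vg.1; apply: L2innerB_eq0_ae => //.
have Vfg := L2closureB Vf Vg; have Lfg := Vfg.1.
have := Hf _ Vfg; have := Hg _ Vfg; rewrite !L2innerBl//; lra.
Qed.

Lemma projection_pythagoras phi g : L2 phi -> is_projection P (L2closure P V) phi g ->
  L2norm P phi ^+ 2 = L2norm P g ^+ 2 + L2norm P (phi - g) ^+ 2.
Proof.
move=> Lphi [Vg Hg]; have Lg := Vg.1; have Lpg := L2B Lphi Lg.
rewrite !L2norm_sqr; have := L2inner_sqr 1 Lpg Lg.
by rewrite scale1r subrK (Hg _ Vg) => ->; ring.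
Qed.

End subspace.
End projection.

(** * Riesz representers as projections *)

Section representer.
Context (d : measure_display) (T : measurableType d) (R : realType).
Variable P : probability T R.
Implicit Types f g h : T -> R.
Local Notation L2 := (L2 P).
Local Notation "<< f , g >>" := (L2inner P f g).

Lemma L2_1 : L2 (cst 1).
Proof.
apply/L2_square_integrable; split; first exact: measurable_cst.
apply: (@integrable_bounded _ _ _ P (fun=> 1 ^+ 2) 1) => [|x].
  exact: measurable_cst.
by rewrite expr1n normr1.
Qed.

(** Centering as orthogonality to the constant [1], so that [L20] inherits its subspace structure
    from the inner product. *)
Lemma L20E f : L20 P f <-> L2 f /\ <<f, cst 1>> = 0.
Proof.
have E1 : <<f, cst 1>> = \int[P]_x f x by apply: eq_Rintegral => x _; rewrite mulr1.
split=> [f0|[Lf]]; first by rewrite E1 L20_mean//; case: f0.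
rewrite E1 => f0; split => //; rewrite unlock -[LHS]fineK; first by rewrite [fine _]f0.
apply: integrable_fin_num => //; have /L2_square_integrable s1 := L2_1.
have /L2_square_integrable sf := Lf.
by have := square_integrableM sf s1; under [X in EFin \o X]eq_fun do rewrite mulr1.
Qed.

(** The span is the smallest subspace containing [C], so orthogonality spreads from [C] to it once
    the orthogonal vectors are known to form a subspace. *)
Lemma L2inner_eq0_subspace (V : set (T -> R)) f : linear_subspace P V -> L2 f ->
  linear_subspace P [set h | V h /\ <<f, h>> = 0].
Proof.
move=> [V20 Vae V0 Vlin] Lf; have VL2 h : V h -> L2 h by move=> /V20[].
split=> [h [/V20]//|g h [Vg fg] Lh gh||a g h [Vg fg] [Vh fh]].
- split; first exact: Vae gh.
  by rewrite L2innerC -(L2inner_ae (VL2 _ Vg) Lh Lf gh) L2innerC.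
- by split => //; rewrite L2innerC L2inner0.
- split; first exact: Vlin.
  have Lg := VL2 _ Vg; have Lh := VL2 _ Vh.
  by rewrite L2innerC L2inner_linear// !(L2innerC _ _ f) fg fh mulr0 addr0.
Qed.

Lemma L20_subspace : linear_subspace P (L20 P).
Proof.
split=> [//|f g /L20E[Lf f0] Lg fg||a f g /L20E[Lf f0] /L20E[Lg g0]]; apply/L20E.
- by split => //; rewrite -(L2inner_ae Lf Lg L2_1 fg).
- by split; [exact: L2_0|exact: L2inner0].
- split; first exact: L2_scaleD.
  by rewrite L2inner_linear ?f0 ?g0 ?mulr0 ?addr0//; exact: L2_1.
Qed.

(** [smallest] is an intersection; [L20] is one of the subspaces containing [C], which keeps the
    intersection inside [L20]. *)
Lemma L2span_subspace (C : set (T -> R)) : C `<=` L20 P ->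
  linear_subspace P (L2span P C).
Proof.
move=> C20; split=> [f|f g Sf Lg fg V [Vs CV]|V [[]]//|a f g Sf Sg V [Vs CV]].
- by apply; split => //; exact: L20_subspace.
- by case: (Vs) => _ + _ _; apply; [exact: Sf|exact: Lg|exact: fg].
- by case: (Vs) => _ _ _; apply; [exact: Sf|exact: Sg].
Qed.

Lemma L2span_id (V : set (T -> R)) : linear_subspace P V -> L2span P V = V.
Proof. by move=> Vs; apply: smallest_id. Qed.

Lemma L2inner_bounded_linear f (V : set (T -> R)) : L2 f -> (V `<=` L2) ->
  bounded_linear_on P V (fun h => <<f, h>>).
Proof.
move=> Lf VL2; split=> [a g h Vg Vh|].
  have Lg := VL2 _ Vg; have Lh := VL2 _ Vh.
  by rewrite L2innerC L2inner_linear// !(L2innerC _ _ f).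
by exists (L2norm P f) => h Vh; apply: L2inner_cauchy_schwarz => //; exact: VL2.
Qed.

(** Both sides say that [psi] lies in the closed span and has the inner products of [phi] there.
    Forward, [phi - psi] is orthogonal to [C], then to its span, then to the closure. Backward, the
    functional of [phi] serves as both [l] and [lbar]. *)
Lemma representer_projection (gamma : (T -> R) -> R) (C : set (T -> R)) phi psi :
  L2 phi -> C `<=` L20 P -> (forall h, C h -> gamma h = <<phi, h>>) ->
  is_representer P gamma C psi <-> is_projection P (L2closure P (L2span P C)) phi psi.
Proof.
move=> Lphi C20 gC; have Ss := L2span_subspace C20.
have CS : C `<=` L2span P C by exact: sub_gen_smallest.
have SL2 : L2span P C `<=` L2 by case: Ss => S20 _ _ _ f /S20[].
split=> [[l [lbar [_ gl _ lbarl [Wpsi lbarpsi]]]]|[Wpsi H]].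
  have Lpsi := Wpsi.1; have Lpp := L2B Lphi Lpsi.
  split => //; apply: orthogonal_closure => // h Sh.
  have Ms := L2inner_eq0_subspace Ss Lpp.
  suff: [set h | L2span P C h /\ <<phi - psi, h>> = 0] h by case.
  apply: Sh; split => // g Cg; split; first exact: CS.
  have Sg := CS _ Cg; have Lg := SL2 _ Sg; rewrite L2innerBl//.
  rewrite -lbarpsi; last exact: L2closure_subset.
  by rewrite lbarl// -gl// gC// subrr.
exists (fun h => <<phi, h>>), (fun h => <<phi, h>>); split => //.
- exact: L2inner_bounded_linear.
- by apply: L2inner_bounded_linear => // h [].
- split => // h Wh; have Lh := Wh.1.
  by have := H _ Wh; rewrite L2innerBl//; [lra|exact: Wpsi.1].
Qed.

Lemma L2proj_projection (V : set (T -> R)) phi : linear_subspace P V -> L2 phi ->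
  is_projection P (L2closure P V) phi (L2proj P (L2closure P V) phi).
Proof.
move=> Vs Lphi; have [g Hg] := projection_exists Vs Lphi.
exact: (@xgetPex _ 0 [set g | is_projection P (L2closure P V) phi g] (ex_intro _ g Hg)).
Qed.

Lemma representer_is_representer (gamma : (T -> R) -> R) (C : set (T -> R)) phi :
  L2 phi -> C `<=` L20 P -> (forall h, C h -> gamma h = <<phi, h>>) ->
  is_representer P gamma C (representer P gamma C).
Proof.
move=> Lphi C20 gC; have [g Hg] := projection_exists (L2span_subspace C20) Lphi.
have {}Hg : is_representer P gamma C g by exact/(representer_projection _ Lphi C20 gC).
exact: (@xgetPex _ 0 [set g | is_representer P gamma C g] (ex_intro _ g Hg)).
Qed.

Lemma representer_ae_projection (gamma : (T -> R) -> R) (C : set (T -> R)) phi :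
  L2 phi -> C `<=` L20 P -> (forall h, C h -> gamma h = <<phi, h>>) ->
  representer P gamma C = L2proj P (L2closure P (L2span P C)) phi %[ae P].
Proof.
move=> Lphi C20 gC; have Ss := L2span_subspace C20.
apply: (projection_ae_unique Ss Lphi (phi := phi)); last exact: L2proj_projection.
exact/(representer_projection _ Lphi C20 gC)/(representer_is_representer Lphi C20 gC).
Qed.

Lemma representer_norm (gamma : (T -> R) -> R) (C : set (T -> R)) phi :
  L2 phi -> C `<=` L20 P -> (forall h, C h -> gamma h = <<phi, h>>) ->
  L2norm P (representer P gamma C)
  = L2norm P (L2proj P (L2closure P (L2span P C)) phi).
Proof.
move=> Lphi C20 gC; apply: L2inner_ae_norm; last exact: representer_ae_projection.
- have := representer_is_representer Lphi C20 gC.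
  by move=> /(representer_projection _ Lphi C20 gC)[[]].
- by have [[]] := L2proj_projection (L2span_subspace C20) Lphi.
Qed.

End representer.

(** * Regular cones and subspaces *)

Section weak_limits.
Context (d : measure_display) (T : measurableType d) (R : realType).
Implicit Types (L M : law R) (Q : nat -> probability T R) (Y : forall n, n.-tuple T -> R).

Lemma weakly_converges_unique Q Y L M :
  weakly_converges Q Y L -> weakly_converges Q Y M -> eq_law L M.
Proof.
move=> YL YM; apply: eq_law_Rintegral => f cf bf.
exact: (cvg_unique _ (YL f cf bf) (YM f cf bf)).
Qed.

Lemma weakly_converges_eq_law Q Y L M :
  eq_law M L -> weakly_converges Q Y L -> weakly_converges Q Y M.
Proof. by move=> ML YL f cf bf; rewrite (Rintegral_eq_law _ ML); exact: YL. Qed.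

Lemma normal_law_mean_inj (m m' v : R) : 0 <= v ->
  eq_law (normal_law m v) (normal_law m' v) -> m = m'.
Proof.
move=> v0 mm; apply/eqP; apply: contraT => ne.
have d0 : m' - m != 0 by rewrite subr_eq0 eq_sym.
(* At this frequency the two means are half a period apart: with phase [- (t * m)] one law has a
   positive phase integral and the other its opposite. *)
pose t := pi / (m' - m).
have := etrans (esym (phase_normal m t (- (t * m)) v0))
  (etrans (phase_eq_law t (- (t * m)) mm) (phase_normal m' t (- (t * m)) v0)).
rewrite subrr cos0.
have -> : t * m' - t * m = pi by rewrite -mulrBr divfK.
rewrite cospi; have := expR_gt0 (- (v * t ^+ 2 / 2)); lra.
Qed.

Lemma deconvolution_normal L M (s w : R) : 0 <= s -> 0 <= w ->
  eq_law L (normal_law 0 (s + w)) ->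
  eq_law L (convolution (normal_law 0 s) M) <-> eq_law M (normal_law 0 w).
Proof.
move=> s0 w0 LE.
have split_exp t : expR (- ((s + w) * t ^+ 2 / 2)) =
    expR (- (s * t ^+ 2 / 2)) * expR (- (w * t ^+ 2 / 2)).
  by rewrite -expRD; congr expR; ring.
have pL t a : phase L t a = expR (- (s * t ^+ 2 / 2)) *
    (expR (- (w * t ^+ 2 / 2)) * cos (t * 0 + a)).
  by rewrite (phase_eq_law t a LE) (phase_normal 0 t a (addr_ge0 s0 w0)) split_exp mulrA.
have pC t a := phase_convolution_normal M t a s0.
have pN t a := phase_normal 0 t a w0.
split=> [LM|Mw]; apply: eq_law_phase => t a.
- have e := etrans (esym (pC t a)) (etrans (esym (phase_eq_law t a LM)) (pL t a)).
  apply: etrans _ (esym (pN t a)); apply: (mulfI _ e).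
  by rewrite gt_eqF// expR_gt0.
- apply: etrans (pL t a) (etrans _ (esym (pC t a))); congr (_ * _).
  exact: etrans (esym (pN t a)) (esym (phase_eq_law t a Mw)).
Qed.

Lemma dqm_path_cst (model : set (probability T R)) P : model P ->
  dqm_path model P 0 (fun=> P).
Proof.
move=> mP; split => //.
- by split; [exact: L2_0|rewrite expectation_cst].
- by exists 1.
- rewrite [X in X @ _ --> _](_ : _ = cst 0%E); first exact: cvg_cst.
  apply/funext => t; rewrite /dqm_remainder /=.
  apply: integral0_eq => x _.
  by rewrite subrr mul0r mulr0 mul0r subrr expr0n.
Qed.

End weak_limits.

Section regularity.
Context (d : measure_display) (T : measurableType d) (R : realType).
Variables (model : set (probability T R)) (P : probability T R).
Variables (tangent : set (T -> R)) (Psi : probability T R -> R).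
Variables (gamma : (T -> R) -> R) (Tn : forall n : nat, n.-tuple T -> R).
Hypothesis tangent_ok : tangent_assumption model P tangent.
Hypothesis Psi_diff : directionally_differentiable model P tangent Psi gamma.
Hypothesis Tn_measurable : forall n : nat, measurable_fun [set: n.-tuple T] (@Tn n).
Variable phi : T -> R.
Hypothesis phi_L20 : L20 P phi.
Hypothesis Tn_linear : asymptotically_linear P Psi Tn phi.
Let E := agreement_set P tangent gamma phi.

Lemma local_weak_limit_tangent h Q : tangent h -> dqm_path model P h Q ->
  weakly_converges (local_alt Q) (centered Psi Tn (local_alt Q))
    (normal_law (L2inner P phi h - gamma h) (L2norm P phi ^+ 2)).
Proof.
move=> th hQ.
exact: (local_weak_limit Tn_measurable phi_L20 Tn_linear hQ (Psi_diff.2 _ _ th hQ)).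
Qed.

Lemma regular_along_agreement (C : set (T -> R)) : C `<=` E ->
  regular_along model P Psi Tn C.
Proof.
move=> CE; exists (normal_law 0 (L2norm P phi ^+ 2)) => h Q /CE[th gh] hQ.
by have := local_weak_limit_tangent th hQ; rewrite gh subrr.
Qed.

(* The limit along [2 h] has twice the mean of the limit along [h]. *)
Lemma agreement_regular_along (C : set (T -> R)) : C `<=` tangent ->
  (forall h, C h -> C (2 *: h)) -> regular_along model P Psi Tn C -> C `<=` E.
Proof.
move=> Ct C2 [L HL] h Ch; split; first exact: Ct.
have limit g : C g ->
    eq_law L (normal_law (L2inner P phi g - gamma g) (L2norm P phi ^+ 2)).
  (* Regularity constrains a score only through its paths; the tangent assumption supplies one. *)
  move=> Cg; have [Q gQ] := tangent_ok.2 _ (Ct _ Cg).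
  exact: weakly_converges_unique (HL _ _ Cg gQ) (local_weak_limit_tangent (Ct _ Cg) gQ).
have l1 := limit _ Ch; have l2 := limit _ (C2 _ Ch).
have [Q [[Lh _] _ _ _]] := tangent_ok.2 _ (Ct _ Ch).
have : L2inner P phi h - gamma h = L2inner P phi (2 *: h) - gamma (2 *: h).
  apply: (normal_law_mean_inj (v := L2norm P phi ^+ 2)); first exact: sqr_ge0.
  by move=> A mA; exact: etrans (esym (l1 A mA)) (l2 A mA).
rewrite (Psi_diff.1 2 _ _ (Ct _ Ch))// (L2innerC P phi (2 *: h)) -[2 *: h]addr0.
have L0 := L2_0 P; have Lphi := phi_L20.1.
by rewrite L2inner_linear// L2inner0 (L2innerC P h phi); lra.
Qed.

Lemma regular_cones_agreement : regular_cones model P tangent Psi Tn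
  = [set C | convex_cone P C /\ C `<=` E].
Proof.
apply/seteqP; split=> [C [Cc Ct rC]|C [Cc CE]]; split => //.
- by apply: agreement_regular_along => // h Ch; case: Cc => _ _ _ _; exact.
- by move=> h /CE[].
- exact: regular_along_agreement.
Qed.

Lemma regular_subspaces_agreement : regular_subspaces model P tangent Psi Tn
  = [set V | linear_subspace P V /\ V `<=` E].
Proof.
apply/seteqP; split=> [V [Vs Vt rV]|V [Vs VE]]; split => //.
- apply: agreement_regular_along => // h Vh; rewrite -[2 *: h]addr0.
  by case: Vs => _ _ V0; exact.
- by move=> h /VE[].
- exact: regular_along_agreement.
Qed.

Lemma weak_limit_base (modelP : model P) :
  weakly_converges (fun=> P) (centered Psi Tn (fun=> P))
    (normal_law 0 (L2norm P phi ^+ 2)).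
Proof.
(* The constant path has score [0] and derivative [0], so the limit under [P^n] is an instance of
   the local limit. *)
have cP : t^-1 * (Psi ((fun=> P) t) - Psi P) @[t --> 0^'+] --> (0 : R).
  by under eq_fun do rewrite subrr mulr0; exact: cvg_cst.
have := local_weak_limit Tn_measurable phi_L20 Tn_linear (dqm_path_cst modelP) cP.
by rewrite L2innerC L2inner0 subr0.
Qed.

End regularity.

Theorem theorem4 (d : measure_display) (T : measurableType d) (R : realType)
  (model : set (probability T R)) (P : probability T R) (modelP : model P)
  (tangent : set (T -> R)) (tangent_linear : linear_subspace P tangent)
  (tangent_ok : tangent_assumption model P tangent)
  (Psi : probability T R -> R) (gamma : (T -> R) -> R)
  (Psi_diff : directionally_differentiable model P tangent Psi gamma)
  (Tn : forall n : nat, n.-tuple T -> R)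
  (Tn_measurable : forall n : nat, measurable_fun [set: n.-tuple T] (@Tn n))
  (phi : T -> R) (phi_L20 : L20 P phi)
  (Tn_linear : asymptotically_linear P Psi Tn phi) :
  let E := agreement_set P tangent gamma phi in
  [/\ regular_cones model P tangent Psi Tn
        = [set C | convex_cone P C /\ C `<=` E],
      regular_subspaces model P tangent Psi Tn
        = [set V | linear_subspace P V /\ V `<=` E],
      (forall V, regular_subspaces model P tangent Psi Tn V ->
        let psi := representer P gamma V in
        let pphi := L2proj P (L2closure P V) phi in
        [/\ is_representer P gamma V psi,
            psi = pphi %[ae P],
            (forall L : law R,
              weakly_converges (fun=> P) (centered Psi Tn (fun=> P)) L <->
              eq_law L (normal_law 0 (L2norm P phi ^+ 2))) &
            (forall L : law R,
              weakly_converges (fun=> P) (centered Psi Tn (fun=> P)) L ->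
              forall M : law R,
              eq_law L (convolution (normal_law 0 (L2norm P psi ^+ 2)) M) <->
              eq_law M (normal_law 0 (L2norm P (phi - pphi) ^+ 2)))]),
      (forall C, regular_cones model P tangent Psi Tn C ->
        is_representer P gamma C (representer P gamma C)) /\
      sup_bound model P tangent Psi Tn gamma
        = ereal_sup
            [set (L2norm P (L2proj P (L2closure P (L2span P C)) phi) ^+ 2)%:E
            | C in [set C | convex_cone P C /\ C `<=` E]] &
      (forall h Q, tangent h -> dqm_path model P h Q ->
        weakly_converges (local_alt Q) (centered Psi Tn (local_alt Q))
          (normal_law (L2inner P phi h - gamma h) (L2norm P phi ^+ 2)))].
Proof.
have Lphi := phi_L20.1.
have E20 (C : set (T -> R)) : C `<=` agreement_set P tangent gamma phi -> C `<=` L20 P.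
  by case: tangent_linear => t20 _ _ _ CE h /CE[/t20].
have Eg (C : set (T -> R)) : C `<=` agreement_set P tangent gamma phi ->
  forall h, C h -> gamma h = L2inner P phi h by move=> CE h /CE[].
have conesE := regular_cones_agreement tangent_ok Psi_diff Tn_measurable phi_L20 Tn_linear.
have subE := regular_subspaces_agreement tangent_ok Psi_diff Tn_measurable phi_L20 Tn_linear.
have base := weak_limit_base Tn_measurable phi_L20 Tn_linear modelP.
move=> E; split; [exact: conesE|exact: subE| | |].
- move=> V; rewrite subE => -[Vs VE] psi pphi.
  have rep := representer_is_representer Lphi (E20 _ VE) (Eg _ VE).
  have psiE := representer_ae_projection Lphi (E20 _ VE) (Eg _ VE).
  have normE := representer_norm Lphi (E20 _ VE) (Eg _ VE).
  rewrite (L2span_id Vs) in psiE normE.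
  split; [exact: rep|exact: psiE| |].
  + move=> L; split=> [YL|LE]; first exact: weakly_converges_unique YL base.
    exact: weakly_converges_eq_law LE base.
  + move=> L YL M; rewrite normE.
    (* Pythagoras splits the variance [|phi|^2] into the two variances that the deconvolution
       needs. *)
    have := projection_pythagoras Lphi (L2proj_projection Vs Lphi).
    have LE := weakly_converges_unique YL base.
    by move=> pyth; apply: deconvolution_normal; rewrite ?sqr_ge0 -?pyth.
- rewrite /sup_bound conesE; split=> [C [_ CE]|].
    exact: representer_is_representer Lphi (E20 _ CE) (Eg _ CE).
  congr ereal_sup; apply/seteqP; split=> _ [C [Cc CE] <-]; exists C => //;
  by rewrite /cone_bound (representer_norm Lphi (E20 _ CE) (Eg _ CE)).
- by move=> h Q; exact: local_weak_limit_tangent.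
Qed.
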